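(* Let $\mathcal{C}$ be a unital C*-algebra and $\alpha:\mathcal{C}\to\mathcal{C}$ a *-isomorphism (i.e. a *-automorphism). Then the C*-envelope of the (left) semicrossed product $\mathbb{Z}_+\times_\alpha\mathcal{C}$ is the (reduced) crossed product $C^*_l(\mathcal{C})$, where $\mathbb{Z}_+\times_\alpha\mathcal{C}$ is identified with a closed subalgebra of $C^*_l(\mathcal{C})$ in the natural way, via $\delta_n\otimes x\mapsto U^n\widehat{\pi}(x)$.
   Context: $\mathbb{Z}_+=\{0,1,2,\dots\}$. $\ell^1(\mathbb{Z}_+,\mathcal{C},\alpha)_l$ is the Banach algebra obtained as the closed linear span of monomials $\delta_n\otimes x$ ($n\in\mathbb{Z}_+$, $x\in\mathcal{C}$) under $|\sum_{n=0}^k\delta_n\otimes x_n|_1=\sum\|x_n\|$, with multiplication $(\delta_n\otimes x)*_l(\delta_m\otimes y)=\delta_{n+m}\otimes\alpha^m(x)y$. A left covariant contractive pair $(\pi,T)$ on a Hilbert space $H$ consists of a *-representation $\pi:\mathcal{C}\to\mathcal{B}(H)$ and a contraction $T\in\mathcal{B}(H)$ with $\pi(x)T=T\pi(\alpha(x))$, $x\in\mathcal{C}$; it induces $(T\times\pi)(\sum\delta_n\otimes x_n)=\sum T^n\pi(x_n)$. The left semicrossed product $\mathbb{Z}_+\times_\alpha\mathcal{C}$ is the completion of $\ell^1(\mathbb{Z}_+,\mathcal{C},\alpha)_l$ under $\|F\|_l=\sup\|(T\times\pi)(F)\|$, the supremum over all left covariant contractive pairs, with operator space structure given by the matrix norms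 $\|[F_{i,j}]\|_l=\sup\|[(T\times\pi)(F_{i,j})]\|$ over the same pairs. For a faithful *-representation $(H_0,\pi)$ of $\mathcal{C}$, on $H_0\otimes\ell^2(\mathbb{Z})$ let $\widehat{\pi}(x)=\mathrm{diag}\{\pi(\alpha^m(x)):m\in\mathbb{Z}\}$ and $U=1_{H_0}\otimes u$ with $u$ the bilateral shift $ue_m=e_{m+1}$. The reduced crossed product $C^*_l(\mathcal{C})$ is the norm closure of the range of the left regular representation, i.e. the norm-closed linear span of $\{U^n\widehat{\pi}(x):n\in\mathbb{Z},x\in\mathcal{C}\}$ (up to *-isomorphism it does not depend on $\pi$ and equals the universal crossed product of $\mathcal{C}$ by $\alpha$). The C*-envelope of a unital operator algebra $\mathcal{X}$ is the C*-algebra $\mathcal{B}$ generated by a unital completely isometric copy $j(\mathcal{X})$ of $\mathcal{X}$ ($j$ a homomorphism) with the universal property: for every unital completely isometric homomorphism $\iota:\mathcal{X}\to\mathcal{D}$ into a C*-algebra generated by $\iota(\mathcal{X})$ there is a surjective *-homomorphism $\Psi:\mathcal{D}\to\mathcal{B}$ with $\Psi\circ\iota=j$. *)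

(* Defs.v *)
From HB Require Import structures.
From mathcomp Require Import all_boot all_order all_algebra.
From mathcomp Require Import sesquilinear complex.
From mathcomp Require Import boolp classical_sets functions reals.
From mathcomp Require Import topology normedtype sequences ring lra zify.

Set Implicit Arguments.
Unset Strict Implicit.
Unset Printing Implicit Defensive.

Import Order.TTheory GRing.Theory Num.Theory numFieldNormedType.Exports.
Local Open Scope classical_set_scope.
Local Open Scope ring_scope.
Local Open Scope complex_scope.

(* Norms are real-valued functions rather than instances of normedModType R[i],
   whose norms take values in R[i]; besides, HB cannot join a ring structure
   with a normed module structure outside the numDomainType hierarchy. *)
Section NormConvergence.
Variables (R : realType) (V : zmodType) (N : V -> R).

Definition ncvg (u : nat -> V) (l : V) : Prop :=
  forall e : R, 0 < e ->
    exists n0 : nat, forall n, (n0 <= n)%N -> N (u n - l) < e.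

Definition ncauchy (u : nat -> V) : Prop :=
  forall e : R, 0 < e ->
    exists n0 : nat, forall m n, (n0 <= m)%N -> (n0 <= n)%N -> N (u m - u n) < e.

Definition ncomplete : Prop := forall u, ncauchy u -> exists l, ncvg u l.

Definition nclosed (E : set V) : Prop :=
  forall u l, (forall n, E (u n)) -> ncvg u l -> E l.

Definition ndense (E : set V) : Prop :=
  forall (x : V) (e : R), 0 < e -> exists2 y, E y & N (x - y) < e.

End NormConvergence.

Definition dnorm (R : realType) (U : lmodType R[i])
  (form : {dot U for @Num.conj R[i]}) (x : U) : R := Num.sqrt (complex.Re (form x x)).

HB.mixin Record isHilbert (R : realType) H & GRing.Lmodule R[i] H := {
  inner : {dot H for @Num.conj R[i]};
  hilbert_complete : ncomplete (dnorm inner)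
}.
#[short(type="hilbertType")]
HB.structure Definition Hilbert (R : realType) :=
  {H of GRing.Lmodule R[i] H & isHilbert R H}.

Definition hnorm (R : realType) (H : hilbertType R) : H -> R :=
  dnorm (@inner R H).

Section Operators.
Variables (R : realType) (H : hilbertType R).
Implicit Types (S T : H -> H).

Definition bounded_op T : Prop :=
  (forall (a : R[i]) (x y : H), T (a *: x + y) = a *: T x + T y) /\
  (exists M : R, forall x, hnorm (T x) <= M * hnorm x).

Definition contraction T : Prop :=
  bounded_op T /\ forall x, hnorm (T x) <= hnorm x.

Definition adjoint S T : Prop :=
  forall x y : H, inner (T x) y = inner x (S y).

Definition opnorm T : R := sup [set hnorm (T x) | x in [set x | hnorm x <= 1]].

(* The norm of [A i j] as an operator on the n-fold Hilbert sum of H. *)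
Definition sumnorm n (x : 'I_n -> H) : R :=
  Num.sqrt (\sum_(i < n) hnorm (x i) ^+ 2).

Definition opmx_norm n (A : 'M[H -> H]_n) : R :=
  sup [set sumnorm (fun i => \sum_(j < n) A i j (x j)) |
       x in [set x : 'I_n -> H | sumnorm x <= 1]].

Definition is_operator_cstar (B : set (H -> H)) : Prop :=
  [/\ (forall T, B T -> bounded_op T),
      B (fun=> 0) /\
      (forall (a : R[i]) S T, B S -> B T -> B (fun x => a *: S x + T x)),
      (forall S T, B S -> B T -> B (S \o T)),
      (forall T, B T -> exists2 S, B S & adjoint S T)
    & (forall T, bounded_op T ->
        (forall e : R, 0 < e -> exists2 S, B S & opnorm (T \- S) < e) -> B T)].

Definition closed_span (G : set (H -> H)) : set (H -> H) :=
  [set T | bounded_op T /\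
    forall e : R, 0 < e ->
      exists n (a : 'I_n -> R[i]) (S : 'I_n -> H -> H),
        (forall k, G (S k)) /\
        opnorm (fun x => T x - \sum_(k < n) a k *: S k x) < e].

End Operators.

Section AlgebraReps.
Variables (R : realType) (A : algType R[i]) (H : hilbertType R).

(* Not assumed nondegenerate: rho 1 is an idempotent. *)
Definition alg_rep (rho : A -> H -> H) : Prop :=
  [/\ (forall x, bounded_op (rho x)),
      (forall (a : R[i]) x y h, rho (a *: x + y) h = a *: rho x h + rho y h)
    & (forall x y, rho (x * y) = rho x \o rho y)].

End AlgebraReps.

HB.mixin Record isCStarAlgebra (R : realType) A & GRing.Algebra R[i] A := {
  cnorm : A -> R;
  star : A -> A;
  cnorm_eq0 : forall x, cnorm x = 0 -> x = 0;
  cnormD : forall x y, cnorm (x + y) <= cnorm x + cnorm y;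
  cnormZ : forall (a : R[i]) x, cnorm (a *: x) = complex.Re `|a| * cnorm x;
  cnormM : forall x y, cnorm (x * y) <= cnorm x * cnorm y;
  cnorm_complete : ncomplete cnorm;
  starK : involutive star;
  star_conjlinear : forall (a : R[i]) x y,
    star (a *: x + y) = Num.conj a *: star x + star y;
  starM : forall x y, star (x * y) = star y * star x;
  cstar_identity : forall x, cnorm (star x * x) = cnorm x ^+ 2
}.
#[short(type="cstarType")]
HB.structure Definition CStarAlgebra (R : realType) :=
  {A of GRing.Algebra R[i] A & isCStarAlgebra R A}.

Section CStar.
Variables (R : realType) (C : cstarType R).

Definition star_automorphism (alpha : C -> C) : Prop :=
  [/\ bijective alpha,
      (forall (a : R[i]) x y, alpha (a *: x + y) = a *: alpha x + alpha y),
      (forall x y, alpha (x * y) = alpha x * alpha y)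
    & (forall x, alpha (star x) = star (alpha x))].

Definition star_rep (H : hilbertType R) (rho : C -> H -> H) : Prop :=
  alg_rep rho /\ forall x, adjoint (rho (star x)) (rho x).

(* The C*-norm of M_n(C); any faithful rho attains the supremum. *)
Definition cstar_mxnorm n (A : 'M[C]_n) : R :=
  sup [set r | exists (H : hilbertType R) (rho : C -> H -> H),
                 star_rep rho /\ r = opmx_norm (map_mx rho A)].

Definition cstar_generated (E : set C) : Prop :=
  forall F : set C, E `<=` F ->
    (forall (a : R[i]) x y, F x -> F y -> F (a *: x + y)) ->
    (forall x y, F x -> F y -> F (x * y)) ->
    (forall x, F x -> F (star x)) ->
    nclosed (@cnorm R C) F -> F = setT.

End CStar.

HB.mixin Record isOperatorAlgebra (R : realType) A & GRing.Algebra R[i] A := {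
  mxnorm : forall n, 'M[A]_n -> R;
  operator_rep : exists (H : hilbertType R) (rho : A -> H -> H),
    [/\ alg_rep rho, rho 1 = id, injective rho
      & forall n (M : 'M[A]_n), mxnorm n M = opmx_norm (map_mx rho M)];
  mxnorm_complete : ncomplete (fun x => mxnorm 1%N (const_mx x : 'M[A]_1))
}.
#[short(type="opAlgType")]
HB.structure Definition OperatorAlgebra (R : realType) :=
  {A of GRing.Algebra R[i] A & isOperatorAlgebra R A}.

Arguments mxnorm {R s n} _.

Definition oanorm (R : realType) (X : opAlgType R) (x : X) : R :=
  mxnorm (const_mx x : 'M[X]_1).

Section CStarEnvelope.
Variables (R : realType) (X : opAlgType R).

Definition unital_hom_ci (D : cstarType R) (iota : X -> D) : Prop :=
  [/\ iota 1 = 1,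
      (forall (a : R[i]) x y, iota (a *: x + y) = a *: iota x + iota y),
      (forall x y, iota (x * y) = iota x * iota y)
    & (forall n (M : 'M[X]_n), cstar_mxnorm (map_mx iota M) = mxnorm M)].

(* B, a C*-algebra of operators on K whose unit may be a proper projection, is
   the C*-envelope of X by means of the embedding j. *)
Definition is_cstar_envelope (K : hilbertType R) (B : set (K -> K))
    (j : X -> K -> K) : Prop :=
  [/\ is_operator_cstar B,
      [/\ alg_rep j,
          (forall x, B (j x)),
          (forall T, B T -> j 1 \o T = T /\ T \o j 1 = T)
        & (forall n (M : 'M[X]_n), opmx_norm (map_mx j M) = mxnorm M)],
      (forall E : set (K -> K),
         is_operator_cstar E -> range j `<=` E -> B `<=` E)
    & forall (D : cstarType R) (iota : X -> D),
        unital_hom_ci iota -> cstar_generated (range iota) ->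
        exists Psi : D -> K -> K,
          [/\ star_rep Psi, range Psi = B & forall x, Psi (iota x) = j x]].

End CStarEnvelope.

Section Semicrossed.
Variables (R : realType) (C : cstarType R) (alpha : C -> C).

Definition l1 : set (nat -> C) :=
  [set F | cvgn (series (fun n => cnorm (F n)))].

Definition delta (n : nat) (x : C) : nat -> C :=
  fun k => if k == n then x else 0.

(* From (delta_n (x) x) *_l (delta_m (x) y) = delta_(n+m) (x) alpha^m(x) y. *)
Definition lmul (F G : nat -> C) : nat -> C :=
  fun k => \sum_(m < k.+1) iter m alpha (F (k - m)%N) * G m.

Definition left_covariant_pair (H : hilbertType R) (pi : C -> H -> H)
    (T : H -> H) : Prop :=
  [/\ star_rep pi, contraction T & forall x, pi x \o T = T \o pi (alpha x)].

(* For F in l1 the series converges in operator norm, hence pointwise. *)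
Definition covariant_rep (H : hilbertType R) (pi : C -> H -> H) (T : H -> H)
    (F : nat -> C) : H -> H :=
  fun h => xget 0 [set l | ncvg (@hnorm R H)
                    (fun k => \sum_(n < k) iter n T (pi (F n) h)) l].

Definition semicrossed_mxnorm n (F : 'M[nat -> C]_n) : R :=
  sup [set r | exists (H : hilbertType R) (pi : C -> H -> H) (T : H -> H),
                 left_covariant_pair pi T /\
                 r = opmx_norm (map_mx (covariant_rep pi T) F)].

(* X is the completion of l1 for the seminorms above, kappa : l1 -> X being the
   canonical map; this determines X up to completely isometric isomorphism.
   The values of kappa outside l1 are irrelevant. *)
Definition is_semicrossed_product (X : opAlgType R) (kappa : (nat -> C) -> X) :
    Prop :=
  [/\ (forall (a : R[i]) F G, l1 F -> l1 G ->
         kappa (a *: F + G) = a *: kappa F + kappa G),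
      (forall F G, l1 F -> l1 G -> kappa (lmul F G) = kappa F * kappa G),
      kappa (delta 0 1) = 1,
      (forall n (F : 'M[nat -> C]_n), (forall i j, l1 (F i j)) ->
         mxnorm (map_mx kappa F) = semicrossed_mxnorm F)
    & ndense (@oanorm R X) (kappa @` l1)].

End Semicrossed.

Section FormTheory.
Variables (R : realType) (U : lmodType R[i]) (form : {dot U for @Num.conj R[i]}).
Implicit Types (x y z : U) (a : R[i]).
Local Notation N := (dnorm form).

Lemma form_real x : form x x = (complex.Re (form x x))%:C.
Proof. by rewrite RRe_real // ger0_real // dnorm_ge0. Qed.

Lemma Im_form x : complex.Im (form x x) = 0.
Proof. by rewrite form_real. Qed.

Lemma Re_form_ge0 x : 0 <= complex.Re (form x x).
Proof. by rewrite -lecR -form_real dnorm_ge0. Qed.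

Lemma dnorm2 x : N x ^+ 2 = complex.Re (form x x).
Proof. by rewrite sqr_sqrtr // Re_form_ge0. Qed.

Lemma dnorm_pos x : 0 <= N x. Proof. exact: sqrtr_ge0. Qed.

Lemma form_herm x y : form y x = Num.conj (form x y).
Proof. by rewrite hermC /= expr0 mul1r. Qed.

Lemma Re_form_sym x y : complex.Re (form y x) = complex.Re (form x y).
Proof. by rewrite form_herm; case: (form x y). Qed.

Lemma dnorm2D x y :
  N (x + y) ^+ 2 = N x ^+ 2 + N y ^+ 2 + complex.Re (form x y) *+ 2.
Proof.
by rewrite !dnorm2 linearDl !linearDr /= !raddfD /= (Re_form_sym x y); ring.
Qed.

Lemma dnorm2Z a x : N (a *: x) ^+ 2 = complex.Re `|a| ^+ 2 * N x ^+ 2.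
Proof.
apply: (complexI (R := R)); rewrite !dnorm2 -form_real rmorphM /= -form_real.
have -> : (complex.Re `|a| ^+ 2)%:C = `|a| ^+ 2 by rewrite normc_def rmorphXn.
by rewrite linearZl_LR linearZr_LR /= mulrA -normCK.
Qed.

Lemma dnormN x : N (- x) = N x.
Proof. by rewrite /dnorm linearNl linearNr opprK. Qed.

Lemma dnorm2D_le x y : N (x + y) ^+ 2 <= 2 * N x ^+ 2 + 2 * N y ^+ 2.
Proof.
have := dnorm2D x (- y); have := dnorm2D x y.
rewrite dnormN linearNr raddfN /=.
have := sqr_ge0 (N (x - y)); lra.
Qed.

Lemma Re_form_le x y : `|complex.Re (form x y)| <= N x ^+ 2 + N y ^+ 2.
Proof.
have := dnorm2D x (- y); have := dnorm2D x y.
rewrite dnormN linearNr raddfN /=.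
have := sqr_ge0 (N (x - y)); have := sqr_ge0 (N (x + y)).
have := sqr_ge0 (N x); have := sqr_ge0 (N y).
rewrite ler_norml; lra.
Qed.

Lemma Im_form_le x y : `|complex.Im (form x y)| <= N x ^+ 2 + N y ^+ 2.
Proof.
have -> : complex.Im (form x y) = complex.Re (form ((- 'i) *: x) y).
  by rewrite linearZl_LR /=; case: (form x y) => u v /=; ring.
apply: le_trans (Re_form_le _ _) _; rewrite dnorm2Z normrN normc_def /=.
by rewrite expr0n /= add0r expr1n sqrtr1 expr1n mul1r.
Qed.

Lemma dnorm_eq0P x : N x = 0 -> x = 0.
Proof.
move=> x0; apply/eqP; rewrite -(dnorm_eq0 form) form_real -dnorm2 x0.
by rewrite expr0n.
Qed.

End FormTheory.

Section ComplexSeries.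
Variable R : realType.
Implicit Types s t : nat -> R[i].

Definition csummable s : Prop :=
  cvgn (series (fun n => complex.Re (s n))) /\
  cvgn (series (fun n => complex.Im (s n))).

Definition csum s : R[i] :=
  limn (series (fun n => complex.Re (s n))) +i*
  limn (series (fun n => complex.Im (s n))).

Lemma lim_series_comb (u v : R) (p q r : nat -> R) :
  cvgn (series p) -> cvgn (series q) -> cvgn (series r) ->
  limn (series (fun n => u * p n + v * q n + r n)) =
  u * limn (series p) + v * limn (series q) + limn (series r).
Proof.
move=> cp cq cr.
have cup : cvgn (series (u *: p)) := @is_cvg_seriesZ R p u cp.
have cvq : cvgn (series (v *: q)) := @is_cvg_seriesZ R q v cq.
rewrite (_ : (fun n => _) = u *: p + v *: q + r) //.
rewrite (lim_seriesD (is_cvg_seriesD cup cvq) cr) (lim_seriesD cup cvq).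
by rewrite (@lim_seriesZ R p u cp) (@lim_seriesZ R q v cq).
Qed.

Lemma csumZD (a : R[i]) s t : csummable s -> csummable t ->
  csum (fun n => a * s n + t n) = a * csum s + csum t.
Proof.
move=> [rs ims] [rt imt]; case: a => u v; rewrite /csum.
have -> : (fun n => complex.Re ((u +i* v) * s n + t n)) =
   (fun n => u * complex.Re (s n) + (- v) * complex.Im (s n) + complex.Re (t n)).
  by apply/funext => n; case: (s n) (t n) => ? ? [? ?] /=; rewrite mulNr.
have -> : (fun n => complex.Im ((u +i* v) * s n + t n)) =
   (fun n => u * complex.Im (s n) + v * complex.Re (s n) + complex.Im (t n)).
  by apply/funext => n; case: (s n) (t n) => ? ? [? ?] /=; rewrite [v * _]mulrC.
rewrite !lim_series_comb // mulNr.
by apply/eqP; rewrite eq_complex /= [v * _]mulrC !eqxx.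
Qed.

Lemma csumJ s : csummable s ->
  csum (fun n => Num.conj (s n)) = Num.conj (csum s).
Proof.
move=> [rs ims]; rewrite /csum.
have -> : (fun n => complex.Re (Num.conj (s n))) = (fun n => complex.Re (s n)).
  by apply/funext => n; case: (s n).
have -> : (fun n => complex.Im (Num.conj (s n))) = - (fun n => complex.Im (s n)).
  by apply/funext => n; rewrite !fctE; case: (s n).
by rewrite lim_seriesN.
Qed.

Lemma csummable_le s (v : nat -> R) : cvgn (series v) ->
  (forall n, `|complex.Re (s n)| <= v n) ->
  (forall n, `|complex.Im (s n)| <= v n) -> csummable s.
Proof.
move=> cv les lims; split; apply: normed_cvg; apply: series_le_cvg cv => //= n;
  [exact: le_trans (les n) | exact: le_trans (lims n)].
Qed.

End ComplexSeries.

Section L2Z.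
Variables (R : realType) (H0 : hilbertType R).
Implicit Types (f g : int -> H0) (a : R[i]).
Local Notation nrm := (@hnorm R H0).

Definition sqnorms f : nat -> R :=
  fun n => nrm (f n%:Z) ^+ 2 + nrm (f (Negz n)) ^+ 2.

Definition square_summable : pred (int -> H0) :=
  fun f => `[< cvgn (series (sqnorms f)) >].

Definition l2Z_form f g : R[i] := csum
  (fun n => inner (f n%:Z) (g n%:Z) + inner (f (Negz n)) (g (Negz n))).

(* H0 (x) l^2(Z) realized as l^2(Z; H0): h (x) e_m is the function with value h
   at m and 0 elsewhere. *)
Record l2Z := L2Z { l2Z_fun :> int -> H0; _ : l2Z_fun \in square_summable }.

HB.instance Definition _ := [isSub for l2Z_fun].
HB.instance Definition _ := [Choice of l2Z by <:].

Lemma sqnorms_ge0 f n : 0 <= sqnorms f n.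
Proof. by rewrite addr_ge0 ?sqr_ge0. Qed.

Lemma square_summableP f :
  reflect (cvgn (series (sqnorms f))) (f \in square_summable).
Proof. exact: asboolP. Qed.

Lemma l2Z_submod_closed : submod_closed square_summable.
Proof.
split=> [|a f g /square_summableP cf /square_summableP cg].
  apply/square_summableP.
  suff -> : sqnorms 0 = fun=> 0.
    by apply: cvgP; rewrite seriesEnat; apply: (cvg_trans _ (@cvg_cst R 0 _ \oo _));
       apply: near_eq_cvg; apply: nearW => n /=; rewrite big1.
  by apply/funext => n; rewrite /sqnorms /hnorm /dnorm !linear0l !sqrtr0 expr0n addr0.
apply/square_summableP.
pose v := (2 * complex.Re `|a| ^+ 2) *: sqnorms f + 2 *: sqnorms g.
have cv : cvgn (series v) by apply: is_cvg_seriesD; apply: is_cvg_seriesZ.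
apply: series_le_cvg cv => n; rewrite ?sqnorms_ge0 //.
  by rewrite addr_ge0 // mulr_ge0 ?sqnorms_ge0 // mulr_ge0 ?sqr_ge0.
have := dnorm2D_le (@inner R H0) (a *: f n%:Z) (g n%:Z).
have := dnorm2D_le (@inner R H0) (a *: f (Negz n)) (g (Negz n)).
rewrite !dnorm2Z /v /sqnorms !fctE /GRing.scale /= /hnorm; lra.
Qed.

HB.instance Definition _ :=
  GRing.isSubmodClosed.Build _ _ square_summable l2Z_submod_closed.
HB.instance Definition _ := [SubChoice_isSubLmodule of l2Z by <:].

Lemma l2Z_cvg (f : l2Z) : cvgn (series (sqnorms f)).
Proof. by apply/square_summableP; case: f. Qed.

Lemma l2ZD (f g : l2Z) m : (f + g) m = f m + g m. Proof. by []. Qed.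
Lemma l2ZB (f g : l2Z) m : (f - g) m = f m - g m. Proof. by []. Qed.
Lemma l2ZZ a (f : l2Z) m : (a *: f) m = a *: f m. Proof. by []. Qed.

Lemma l2Z_summable (f g : l2Z) : csummable
  (fun n => inner (f n%:Z) (g n%:Z) + inner (f (Negz n)) (g (Negz n))).
Proof.
apply: (@csummable_le _ _ (sqnorms f + sqnorms g)) => [|n|n].
- by apply: is_cvg_seriesD; exact: l2Z_cvg.
- rewrite raddfD /=; apply: le_trans (ler_normD _ _) _.
  have := Re_form_le (@inner R H0) (f n%:Z) (g n%:Z).
  have := Re_form_le (@inner R H0) (f (Negz n)) (g (Negz n)).
  rewrite !fctE /sqnorms /hnorm; lra.
- rewrite raddfD /=; apply: le_trans (ler_normD _ _) _.
  have := Im_form_le (@inner R H0) (f n%:Z) (g n%:Z).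
  have := Im_form_le (@inner R H0) (f (Negz n)) (g (Negz n)).
  rewrite !fctE /sqnorms /hnorm; lra.
Qed.

Definition l2Z_inner (f g : l2Z) : R[i] := l2Z_form f g.

Lemma l2Z_linearl (g : l2Z) a (f1 f2 : l2Z) :
  l2Z_inner (a *: f1 + f2) g = a * l2Z_inner f1 g + l2Z_inner f2 g.
Proof.
rewrite /l2Z_inner /l2Z_form -csumZD; try exact: l2Z_summable.
by congr csum; apply/funext => n; rewrite !linearPl /=; ring.
Qed.

Lemma l2Z_herm (f g : l2Z) : l2Z_inner f g = Num.conj (l2Z_inner g f).
Proof.
rewrite /l2Z_inner /l2Z_form -csumJ; last exact: l2Z_summable.
by congr csum; apply/funext => n; rewrite rmorphD /= -!form_herm.
Qed.

Lemma l2Z_linearr (f : l2Z) a (g1 g2 : l2Z) :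
  l2Z_inner f (a *: g1 + g2) = Num.conj a * l2Z_inner f g1 + l2Z_inner f g2.
Proof. by rewrite l2Z_herm l2Z_linearl rmorphD rmorphM /= -!l2Z_herm. Qed.

Lemma l2Z_norm (f : l2Z) : l2Z_inner f f = (limn (series (sqnorms f)))%:C.
Proof.
rewrite /l2Z_inner /l2Z_form /csum.
have -> : (fun n => complex.Re (inner (f n%:Z) (f n%:Z) +
    inner (f (Negz n)) (f (Negz n)))) = sqnorms f.
  by apply/funext => n; rewrite raddfD /= /sqnorms /hnorm !dnorm2.
congr (_ +i* _).
have -> : (fun n => complex.Im (inner (f n%:Z) (f n%:Z) +
    inner (f (Negz n)) (f (Negz n)))) = fun=> 0.
  by apply/funext => n; rewrite raddfD /= !Im_form addr0.
by apply/cvg_lim => //; rewrite (_ : series _ = fun=> 0);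
  [exact: cvg_cst | apply/funext => n; rewrite /series /= big1].
Qed.

Lemma l2Z_partial (f : l2Z) n :
  series (sqnorms f) n <= limn (series (sqnorms f)).
Proof.
apply: nondecreasing_cvgn_le; last exact: l2Z_cvg.
by apply: nondecreasing_series => k _ _; exact: sqnorms_ge0.
Qed.

Lemma l2Z_bilinear :
  bilinear_for *%R (@Num.conj R[i] \; *%R) l2Z_inner.
Proof. by split=> [g|f] a x y; [exact: l2Z_linearl | exact: l2Z_linearr]. Qed.

HB.instance Definition _ := bilinear_isBilinear.Build R[i] l2Z l2Z R[i]
  *%R (@Num.conj R[i] \; *%R) l2Z_inner l2Z_bilinear.

Lemma l2Z_hermitian (f g : l2Z) :
  l2Z_inner f g = (-1) ^+ false * Num.conj (l2Z_inner g f).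
Proof. by rewrite expr0 mul1r -l2Z_herm. Qed.

HB.instance Definition _ := isHermitianSesquilinear.Build R[i] l2Z false
  (@Num.conj R[i]) l2Z_inner l2Z_hermitian.

Lemma l2Z_coord2 (f : l2Z) m : nrm (f m) ^+ 2 <= limn (series (sqnorms f)).
Proof.
have [k km] : exists k, nrm (f m) ^+ 2 <= sqnorms f k.
  by case: m => k; exists k; rewrite /sqnorms ?lerDl ?lerDr sqr_ge0.
apply: le_trans km (le_trans _ (l2Z_partial f k.+1)).
by rewrite /series /= big_nat_recr //= lerDr sumr_ge0 // => *; exact: sqnorms_ge0.
Qed.

Lemma l2Z_definite (f : l2Z) : f != 0 -> 0 < l2Z_inner f f.
Proof.
move=> f0; rewrite l2Z_norm -[0]/(0%:C) ltcR lt_neqAle; apply/andP; split.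
  apply: contra_neq f0 => lim0; apply/val_inj/funext => m.
  apply: (dnorm_eq0P (form := @inner R H0)); apply/eqP.
  have := l2Z_coord2 f m; rewrite -lim0 => fm.
  by rewrite -sqrf_eq0 eq_le fm sqr_ge0.
by apply: le_trans (l2Z_partial f 0); rewrite /series /= big_geq.
Qed.

HB.instance Definition _ := isDotProduct.Build R[i] l2Z l2Z_inner l2Z_definite.

Definition l2Z_dot : {dot l2Z for @Num.conj R[i]} := l2Z_inner.

Lemma dnorm_l2Z (f : l2Z) : dnorm l2Z_dot f ^+ 2 = limn (series (sqnorms f)).
Proof. by rewrite dnorm2 (_ : l2Z_dot f f = l2Z_inner f f) // l2Z_norm. Qed.

Lemma sqnormsD f g n : sqnorms (f + g) n <= 2 * sqnorms f n + 2 * sqnorms g n.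
Proof.
have := dnorm2D_le (@inner R H0) (f n%:Z) (g n%:Z).
have := dnorm2D_le (@inner R H0) (f (Negz n)) (g (Negz n)).
rewrite /sqnorms /hnorm !fctE; lra.
Qed.

Lemma sqnorms_small (u : nat -> int -> H0) (g : int -> H0) :
  (forall m, ncvg nrm (fun n => u n m) (g m)) ->
  forall (k : nat) (d : R), 0 < d -> exists p0 : nat, forall p, (p0 <= p)%N ->
    series (sqnorms (u p - g)) k <= d.
Proof.
move=> ug; elim=> [|k IHk] d d0.
  by exists 0%N => p _; rewrite /series /= big_geq // ltW.
have d2 : 0 < d / 2 by lra.
have [p0 Hp0] := IHk _ d2.
pose e := Num.min 1 (d / 4).
have e0 : 0 < e by rewrite lt_min ltr01 /=; lra.
have [p1 Hp1] := ug k%:Z e e0; have [p2 Hp2] := ug (Negz k) e e0.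
exists (maxn p0 (maxn p1 p2)) => p; rewrite !geq_max => /and3P[h0 h1 h2].
rewrite /series /= big_nat_recr //=.
have small x : nrm x < e -> nrm x ^+ 2 <= d / 4.
  move=> xe; have x0 : 0 <= nrm x by exact: dnorm_pos.
  have := lt_min (nrm x) 1 (d / 4); rewrite xe => /esym/andP[x1 xd].
  by rewrite expr2; apply: le_trans (ltW xd); rewrite ler_piMr // ltW.
have := small _ (Hp1 _ h1); have := small _ (Hp2 _ h2); have := Hp0 _ h0.
rewrite /series /= [sqnorms _ k]/sqnorms !fctE; lra.
Qed.

Lemma l2Z_complete : ncomplete (dnorm l2Z_dot).
Proof.
move=> u uC.
have coord m : exists l, ncvg nrm (fun n => u n m) l.
  apply: hilbert_complete => e e0; have [n0 Hn0] := uC e e0.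
  exists n0 => a b a0 b0; apply: le_lt_trans (Hn0 a b a0 b0).
  rewrite -(@ler_pXn2r _ 2) ?nnegrE ?dnorm_pos // dnorm_l2Z -l2ZB.
  exact: l2Z_coord2.
have [g ug] := choice coord.
have key (e : R) : 0 < e -> exists n0 : nat, forall n, (n0 <= n)%N -> forall k,
    series (sqnorms ((u n : int -> H0) - g)) k <= 2 * e ^+ 2.
  move=> e0; have [n0 Hn0] := uC e e0; exists n0 => n nn0 k.
  apply/ler_addgt0Pr => d d0; have d2 : 0 < d / 2 by lra.
  have [p0 Hp0] := sqnorms_small ug k d2.
  pose p := maxn n0 p0.
  have := Hp0 p (leq_maxr _ _); have := Hn0 n p nn0 (leq_maxl _ _).
  set v : l2Z := u n - u p => vlt pd.
  have vle : series (sqnorms v) k <= e ^+ 2.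
    apply: le_trans (l2Z_partial _ _) _; rewrite -dnorm_l2Z.
    by rewrite ler_pXn2r ?nnegrE ?dnorm_pos // ltW.
  have : series (sqnorms ((u n : int -> H0) - g)) k <=
      2 * series (sqnorms v) k +
      2 * series (sqnorms ((u p : int -> H0) - g)) k.
    rewrite /series /= !mulr_sumr -big_split /=; apply: ler_sum => i _.
    have -> : (u n : int -> H0) - g = (v : int -> H0) + ((u p : int -> H0) - g).
      by apply/funext => m; rewrite !fctE /v l2ZB addrA subrK.
    exact: sqnormsD.
  by move: vle pd; lra.
have [n1 Hn1] := key 1 ltr01.
have gP : g \in square_summable.
  have dP : (u n1 : int -> H0) - g \in square_summable.
    apply/square_summableP; apply: nondecreasing_is_cvgn.
      by apply: nondecreasing_series => i _ _; exact: sqnorms_ge0.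
    by exists (2 * 1 ^+ 2) => _ [k _ <-]; exact: Hn1.
  rewrite -[g](subKr (u n1 : int -> H0)) rpredB //.
  by case: (u n1).
exists (L2Z gP) => e e0; have e2 : 0 < e / 2 by lra.
have [n0 Hn0] := key _ e2; exists n0 => n nn0.
rewrite -(@ltr_pXn2r _ 2) ?nnegrE ?dnorm_pos ?(ltW e0) // dnorm_l2Z.
apply: (@le_lt_trans _ _ (2 * (e / 2) ^+ 2)); last first.
  by have := mulr_gt0 e0 e0; rewrite expr2; lra.
by apply: limr_le; [exact: l2Z_cvg | apply: nearW => k; exact: Hn0].
Qed.

HB.instance Definition _ := isHilbert.Build R l2Z l2Z_complete.

End L2Z.

Section Shift.
Variables (R : realType) (H0 : hilbertType R).
Implicit Types (f : l2Z H0) (m : int).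
Local Notation nrm := (@hnorm R H0).

Lemma bishift_summable f : (fun m => f (m - 1)) \in square_summable (H0 := H0).
Proof.
have E n : series (sqnorms (fun m => f (m - 1))) n + nrm (f (n%:Z - 1)) ^+ 2 =
    series (sqnorms f) n + nrm (f (Negz n)) ^+ 2.
  elim: n => [|n IHn]; first by rewrite /series /= !big_geq.
  move: IHn; rewrite /series /= !big_nat_recr //= [sqnorms f n]/sqnorms.
  rewrite [sqnorms _ n]/sqnorms (_ : n.+1%:Z - 1 = n%:Z); last by rewrite -addn1 PoszD addrK.
  by rewrite (_ : Negz n - 1 = Negz n.+1); [lra | rewrite !NegzE; lia].
apply/square_summableP.
apply: nondecreasing_is_cvgn.
  by apply: nondecreasing_series => i _ _; exact: sqnorms_ge0.
exists (limn (series (sqnorms f)) + limn (series (sqnorms f))) => _ [n _ <-].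
have := E n; have := l2Z_partial f n; have := l2Z_coord2 f (Negz n).
by have := sqr_ge0 (nrm (f (n%:Z - 1))); lra.
Qed.

Lemma bishift_inv_summable f : (fun m => f (m + 1)) \in square_summable (H0 := H0).
Proof.
have E n : series (sqnorms (fun m => f (m + 1))) n + nrm (f (- n%:Z)) ^+ 2 =
    series (sqnorms f) n + nrm (f n%:Z) ^+ 2.
  elim: n => [|n IHn]; first by rewrite /series /= !big_geq.
  move: IHn; rewrite /series /= !big_nat_recr //= [sqnorms f n]/sqnorms.
  rewrite [sqnorms _ n]/sqnorms (_ : n%:Z + 1 = n.+1%:Z); last by rewrite -addn1 PoszD.
  rewrite (_ : - n.+1%:Z = Negz n) ?NegzE //.
  by rewrite (_ : - n.+1%:Z + 1 = - n%:Z); [lra | lia].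
apply/square_summableP.
apply: nondecreasing_is_cvgn.
  by apply: nondecreasing_series => i _ _; exact: sqnorms_ge0.
exists (limn (series (sqnorms f)) + limn (series (sqnorms f))) => _ [n _ <-].
have := E n; have := l2Z_partial f n; have := l2Z_coord2 f n%:Z.
by have := sqr_ge0 (nrm (f (- n%:Z))); lra.
Qed.

(* U (h (x) e_m) = h (x) e_(m+1), that is, (U f) m = f (m - 1). *)
Definition bishift f : l2Z H0 := L2Z (bishift_summable f).
Definition bishift_inv f : l2Z H0 := L2Z (bishift_inv_summable f).

Lemma bishiftK : cancel bishift bishift_inv.
Proof. by move=> f; apply/val_inj/funext => m /=; rewrite addrK. Qed.

Lemma bishift_invK : cancel bishift_inv bishift.
Proof. by move=> f; apply/val_inj/funext => m /=; rewrite subrK. Qed.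

Definition bishiftX (n : int) : l2Z H0 -> l2Z H0 :=
  match n with
  | Posz k => iter k bishift
  | Negz k => iter k.+1 bishift_inv
  end.

End Shift.

Section ReducedCrossedProduct.
Variables (R : realType) (C : cstarType R) (alpha : C -> C).
Variables (H0 : hilbertType R) (pi : C -> H0 -> H0).

Definition alpha_inv (y : C) : C := xget 0 [set x | alpha x = y].

Definition alphaX (m : int) : C -> C :=
  match m with
  | Posz k => iter k alpha
  | Negz k => iter k.+1 alpha_inv
  end.

(* diag (pi (alpha^m x)); the default value 0 is not used when alpha is a
   *-automorphism and pi a *-representation, as then all pi (alpha^m x) have
   norm at most cnorm x. *)
Definition pihat (x : C) (f : l2Z H0) : l2Z H0 :=
  insubd 0 (fun m => pi (alphaX m x) (f m)).

Definition reduced_crossed_product : set (l2Z H0 -> l2Z H0) :=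
  closed_span [set T | exists n x, T = bishiftX n \o pihat x].

End ReducedCrossedProduct.

(* Main.v *)
(** Scale the contraction of a covariant pair by r < 1. The semi-inner product
    <h,g> - r^2 <Th,Tg> makes h |-> ((rT)^k h)_k an isometry into sequences, on
    which the pair acts through Toeplitz matrices with entries in C; these
    matrices are also compressions of the regular representation. A faithful
    representation dominates, on matrices over C, every *-representation on a
    semi-inner product space, so the regular representation attains the norm of
    the semicrossed product at all matrix levels.

    For the universal property let D be generated by iota(X), put
    u = iota(delta_1), and call an element of D null when it vanishes on vectors
    along which all powers of u are asymptotically isometric. The elements d
    such that d u^M - iota(F) is null for some M and some polynomial F, with the
    same property for the adjoint of d, form a dense *-subalgebra, and
    d |-> j(F) U^(-M) is a *-homomorphism on it. It is
    contractive: the column with entries iota(F) and w u^k, with a large weight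
    w, has its norm determined by the norm of the same column over X, and U is
    unitary. Its extension to D has closed range, hence maps onto the crossed
    product. *)

From HB Require Import structures.
Require Import Defs.
From mathcomp Require Import all_boot all_order all_algebra.
From mathcomp Require Import sesquilinear complex.
From mathcomp Require Import boolp classical_sets functions reals.
From mathcomp Require Import topology normedtype sequences ring lra zify.

Set Implicit Arguments.
Unset Strict Implicit.
Unset Printing Implicit Defensive.

Import Order.TTheory GRing.Theory Num.Theory numFieldNormedType.Exports.
Local Open Scope classical_set_scope.
Local Open Scope ring_scope.
Local Open Scope complex_scope.

(** The obstacle in the universal property is that [u] need not be unitary in [D]; only its image in
    the envelope is. No quotient of [D] is formed. The ideal to be divided out is replaced by
    inequalities ([asym_null]) whose error is the gap ‖h‖² - ‖u^k h‖², uniform over all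
    representations of [D]. Uniformity matters because [unital_hom_ci] speaks only of suprema over
    representations. Likewise no isometric dilation of a covariant pair is built. Only the
    telescoping identity Σ_{k<K} defect(S^k h) = ‖h‖² - ‖S^K h‖² is used, and r < 1 is there to make
    the remainder decay. On the side of C*-algebras everything comes from one square root, that of 1
    - a with ‖a‖ ≤ 1, without functional calculus. It bounds positive functionals, hence
    representations. It also yields absolute values, with which an element can be replaced by one of
    comparable norm to its image under a representation. From this follow both the isometry of
    faithful representations and the closedness of ranges. *)

Lemma bernoulli (R : realDomainType) (t : R) (n : nat) : 0 <= t ->
  1 + n%:R * t <= (1 + t) ^+ n.
Proof.
move=> t0; elim: n => [|n IHn]; first by rewrite mul0r addr0 expr0.
rewrite exprS -natr1; have t1 : 0 <= 1 + t by rewrite addr_ge0.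
have := mulr_ge0 t0 (mulr_ge0 (@ler0n R n) t0).
by have := ler_wpM2l t1 IHn; lra.
Qed.

Lemma harmonic_small (R : realType) (e : R) : 0 < e ->
  exists n0 : nat, forall n, (n0 <= n)%N -> n.+1%:R^-1 <= e.
Proof.
move=> e0; exists (Num.bound (e^-1)) => n hn.
rewrite -[e]invrK lef_pV2 ?posrE ?invr_gt0 //; apply: ltW.
apply: lt_le_trans (archi_boundP _) _; first by rewrite invr_ge0 ltW.
by rewrite ler_nat (leq_trans hn).
Qed.

(** * Seminorms and convergence in norm *)

Section Seminorms.
Variables (R : realType) (V : zmodType) (N : V -> R).

Definition seminorm : Prop :=
  (forall x y, N (x + y) <= N x + N y) /\ (forall x, N (- x) = N x).

Hypothesis snN : seminorm.

Lemma seminorm_ge0 x : 0 <= N x.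
Proof.
case: snN => ND NN; have := ND x (- x); have := ND 0 (0 : V).
by rewrite subrr addr0 NN; lra.
Qed.

Lemma seminormB x y : N (x - y) <= N x + N y.
Proof. by case: snN => ND NN; rewrite -[N y]NN. Qed.

Lemma seminormC x y : N (x - y) = N (y - x).
Proof. by case: snN => _ NN; rewrite -NN opprB. Qed.

Lemma seminorm_dist x y z : N (x - z) <= N (x - y) + N (y - z).
Proof. by have := snN.1 (x - y) (y - z); rewrite addrA subrK. Qed.

Lemma seminorm_le_dist x y : N x <= N y + N (x - y).
Proof. by have := snN.1 y (x - y); rewrite addrC subrK. Qed.

Lemma ncvg_le (u : nat -> V) l (c : R) :
  ncvg N u l -> (forall n, N (u n) <= c) -> N l <= c.
Proof.
move=> ul uc; apply/ler_addgt0Pr => e e0; have [n0 /(_ n0 (leqnn _)) h] := ul e e0.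
have := seminorm_le_dist l (u n0); rewrite seminormC; have := uc n0; lra.
Qed.

Lemma ncvg_dist_le (u : nat -> V) l x (c : R) :
  ncvg N u l -> (exists n0 : nat, forall n, (n0 <= n)%N -> N (x - u n) <= c) ->
  N (x - l) <= c.
Proof.
move=> ul [n1 uc]; apply/ler_addgt0Pr => e e0; have [n0 hn0] := ul e e0.
have := hn0 _ (leq_maxl n0 n1); have := uc _ (leq_maxr n0 n1).
have := seminorm_dist x (u (maxn n0 n1)) l; lra.
Qed.

Lemma ncvgD (u v : nat -> V) l k :
  ncvg N u l -> ncvg N v k -> ncvg N (fun n => u n + v n) (l + k).
Proof.
move=> ul vk e e0; have e2 : 0 < e / 2 by lra.
have [n0 hn0] := ul _ e2; have [n1 hn1] := vk _ e2.
exists (maxn n0 n1) => n; rewrite geq_max => /andP[/hn0 h0 /hn1 h1].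
rewrite opprD addrACA; have := snN.1 (u n - l) (v n - k); lra.
Qed.

Lemma ncvg_sub (u : nat -> V) l (f : nat -> nat) :
  (forall n, (n <= f n)%N) -> ncvg N u l -> ncvg N (fun n => u (f n)) l.
Proof.
move=> fn ul e /ul[n0 hn0]; exists n0 => n n0n; apply: hn0.
exact: leq_trans n0n (fn n).
Qed.

Lemma ncvg_unique (u : nat -> V) l k : (forall x, N x = 0 -> x = 0) ->
  ncvg N u l -> ncvg N u k -> l = k.
Proof.
move=> Ndef ul uk; apply/subr0_eq/Ndef/le_anti; rewrite seminorm_ge0 andbT.
apply/ler_addgt0Pr => e e0; rewrite add0r; have e2 : 0 < e / 2 by lra.
have [n0 hn0] := ul _ e2; have [n1 hn1] := uk _ e2.
have := hn0 _ (leq_maxl n0 n1); have := hn1 _ (leq_maxr n0 n1).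
have := seminorm_dist l (u (maxn n0 n1)) k; rewrite (seminormC l (u _)); lra.
Qed.

End Seminorms.

Lemma ncvg_lip (R : realType) (V W : zmodType) (N : V -> R) (M : W -> R)
    (F : V -> W) (c : R) (u : nat -> V) (l : V) :
  0 <= c -> (forall x y, M (F x - F y) <= c * N (x - y)) ->
  ncvg N u l -> ncvg M (fun n => F (u n)) (F l).
Proof.
move=> c0 FL ul e e0.
have d0 : 0 < e / (c + 1) by rewrite divr_gt0 // ltr_wpDl.
have [n0 hn0] := ul _ d0; exists n0 => n /hn0 h.
apply: le_lt_trans (FL _ _) _; apply: (@le_lt_trans _ _ (c * (e / (c + 1)))).
  by rewrite ler_wpM2l // ltW.
by rewrite mulrCA gtr_pMr // ltr_pdivrMr ?mul1r ?ltrDl // ltr_wpDl.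
Qed.

Lemma Re_norm_ge0 (R : rcfType) (a : R[i]) : 0 <= complex.Re `|a|.
Proof. by rewrite normc_def /= sqrtr_ge0. Qed.

(** * Cauchy-Schwarz and polarization *)

Section DnormTheory.
Variables (R : realType) (U : lmodType R[i]) (form : {dot U for @Num.conj R[i]}).
Implicit Types (x y z : U) (a : R[i]).
Local Notation N := (dnorm form).

Lemma Re_form_CS x y : `|complex.Re (form x y)| <= N x * N y.
Proof.
rewrite -ler_sqr ?nnegrE ?mulr_ge0 ?dnorm_pos // real_normK ?num_real //.
set r := complex.Re _; rewrite exprMn.
have key (t : R) : 0 <= N x ^+ 2 + 2 * t * r + t ^+ 2 * N y ^+ 2.
  have := sqr_ge0 (N (x + t%:C *: y)); rewrite dnorm2D dnorm2Z linearZr_LR /=.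
  have -> : complex.Re (Num.conj (t%:C) * form x y) = t * r.
    by rewrite /r; case: (form x y) => p q /=; ring.
  rewrite /= expr0n addr0 sqrtr_sqr real_normK ?num_real //.
  by rewrite mulr2n; lra.
have [y0|y0] := eqVneq (N y) 0.
  by rewrite y0 /r (dnorm_eq0P y0) linear0r /= !expr0n mulr0.
have y2 : 0 < N y ^+ 2 by rewrite exprn_even_gt0.
(* The minimizer in [t] of the quadratic polynomial in [key]. *)
have := key (- r / N y ^+ 2); rewrite expr_div_n sqrrN.
set c := N y ^+ 2 in y2 *; set A := N x ^+ 2.
have -> : A + 2 * (- r / c) * r + r ^+ 2 / c ^+ 2 * c = A - r ^+ 2 / c.
  by field; rewrite gt_eqF.
by rewrite subr_ge0 ler_pdivrMr.
Qed.

Lemma dnormZ a x : N (a *: x) = complex.Re `|a| * N x.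
Proof.
apply/eqP; rewrite -(@eqrXn2 _ 2) ?dnorm_pos ?mulr_ge0 ?dnorm_pos //.
  by rewrite exprMn dnorm2Z.
exact: Re_norm_ge0.
Qed.

Lemma Im_form_CS x y : `|complex.Im (form x y)| <= N x * N y.
Proof.
have -> : complex.Im (form x y) = complex.Re (form ((- 'i) *: x) y).
  by rewrite linearZl_LR /=; case: (form x y) => u v /=; ring.
apply: le_trans (Re_form_CS _ _) _; rewrite dnormZ normrN normc_def /=.
by rewrite expr0n /= add0r expr1n sqrtr1 mul1r.
Qed.

Lemma dnormD x y : N (x + y) <= N x + N y.
Proof.
rewrite -ler_sqr ?nnegrE ?addr_ge0 ?dnorm_pos // dnorm2D sqrrD.
have := Re_form_CS x y; rewrite ler_norml => /andP[_ h].
by rewrite addrAC lerD2r lerD2l lerMn2r.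
Qed.

Lemma dnorm_seminorm : seminorm N.
Proof. by split; [exact: dnormD | exact: dnormN]. Qed.

Lemma dnorm0 : N 0 = 0.
Proof. by rewrite /dnorm linear0r /= sqrtr0. Qed.

End DnormTheory.

(** Polarization: [dnorm2D] recovers real parts, and replacing [x] by ['i *: x] recovers imaginary
    ones. The norm equality is asked only on a subspace [E], since the image of a unitary under a
    degenerate representation is isometric only on the range of the image of 1. *)
Lemma dnorm_isometry_form (R : realType) (U V : lmodType R[i])
    (f : {dot U for @Num.conj R[i]}) (g : {dot V for @Num.conj R[i]})
    (T : U -> V) (E : U -> Prop) :
  (forall a x y, T (a *: x + y) = a *: T x + T y) ->
  (forall a x y, E x -> E y -> E (a *: x + y)) ->
  (forall x, E x -> dnorm g (T x) = dnorm f x) ->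
  forall x y, E x -> E y -> g (T x) (T y) = f x y.
Proof.
move=> Tlin Elin iso.
have key x y : E x -> E y -> complex.Re (g (T x) (T y)) = complex.Re (f x y).
  move=> Ex Ey; have Exy : E (x + y) by rewrite -[x]scale1r; exact: Elin.
  have TD : T (x + y) = T x + T y by have := Tlin 1 x y; rewrite !scale1r.
  have := dnorm2D g (T x) (T y); rewrite -TD !iso // dnorm2D.
  by rewrite !mulr2n; lra.
move=> x y Ex Ey; have E0 : E 0 by have := Elin (-1) _ _ Ex Ex; rewrite scaleN1r addNr.
have T0 : T 0 = 0 by have := Tlin (-1) 0 0; rewrite !scaleN1r !addNr.
have EZ : E ('i *: x) by have := Elin 'i _ _ Ex E0; rewrite addr0.
have TZ : T ('i *: x) = 'i *: T x by have := Tlin 'i x 0; rewrite !addr0 T0 addr0.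
have h1 := key _ _ Ex Ey; have := key _ _ EZ Ey; rewrite TZ !linearZl_LR /=.
move: h1; case: (g _ _) (f x y) => [p q] [p' q'] /= -> h; congr (_ +i* _); lra.
Qed.

(** * Square roots and representations of C*-algebras *)

Section BanachSqrt.
Variables (R : realType) (A : pzRingType) (N : A -> R) (g : A).
Hypotheses (snN : seminorm N) (N_eq0 : forall x, N x = 0 -> x = 0).
Hypotheses (NM : forall x y, N (x * y) <= N x * N y) (N_complete : ncomplete N).
Hypotheses (gg : g + g = 1) (gC : forall x, g * x = x * g).
Hypothesis Ng : forall x, N (g * x) = N x / 2.

Let N_ge0 := seminorm_ge0 snN.
Let N0 : N 0 = 0.
Proof. by have := Ng 0; rewrite mulr0; lra. Qed.

Section Iteration.
Variable a : A.
Hypothesis Na : N a <= 1.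

(* With [1 - y] for the root, [(1 - y)^2 = 1 - a] reads [y = (a + y^2) / 2]; the
   iteration is dominated by the scalar one for [a = 1]. *)
Fixpoint sqrt_iter (n : nat) : A :=
  if n is m.+1 then g * (a + sqrt_iter m * sqrt_iter m) else 0.

Fixpoint sqrt_majorant (n : nat) : R :=
  if n is m.+1 then (1 + sqrt_majorant m ^+ 2) / 2 else 0.

Lemma sqrt_majorant_itv n : 0 <= sqrt_majorant n <= 1.
Proof.
elim: n => [|n /= /andP[h0 h1]]; first by rewrite /= lexx ler01.
have : sqrt_majorant n ^+ 2 <= 1 by rewrite expr_le1.
by have := sqr_ge0 (sqrt_majorant n); lra.
Qed.

Lemma sqrt_iter_le n : N (sqrt_iter n) <= sqrt_majorant n.
Proof.
elim: n => [|n IHn] /=; first by rewrite N0.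
rewrite Ng ler_pM2r ?invr_gt0 ?ltr0n //; apply: le_trans (snN.1 _ _) _.
apply: lerD => //; apply: le_trans (NM _ _) _; rewrite expr2.
by apply: ler_pM.
Qed.

(** The identity y1² - y0² = y1 (y1 - y0) + (y1 - y0) y0 needs no commutativity, and the scalar
    majorant satisfies it too. *)
Lemma sqrt_iter_step n :
  N (sqrt_iter n.+1 - sqrt_iter n) <= sqrt_majorant n.+1 - sqrt_majorant n.
Proof.
elim: n => [|n IHn]; first by rewrite /= mul0r addr0 !subr0 Ng expr0n /= addr0 ler_pM2r ?invr_gt0.
set y1 := sqrt_iter n.+1; set y0 := sqrt_iter n.
set s1 := sqrt_majorant n.+1; set s0 := sqrt_majorant n.
have -> : sqrt_iter n.+2 - y1 = g * (y1 * (y1 - y0) + (y1 - y0) * y0).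
  have E : y1 * (y1 - y0) + (y1 - y0) * y0 = (a + y1 * y1) - (a + y0 * y0).
    by rewrite mulrBr mulrBl addrA subrK opprD addrACA subrr add0r.
  by rewrite E mulrBr.
have -> : sqrt_majorant n.+2 - s1 = (s1 * (s1 - s0) + (s1 - s0) * s0) / 2.
  have -> : sqrt_majorant n.+2 = (1 + s1 ^+ 2) / 2 by [].
  have : s1 = (1 + s0 ^+ 2) / 2 by [].
  by move: s1 s0 => s1 s0 ->; field.
rewrite Ng ler_pM2r ?invr_gt0 ?ltr0n //; apply: le_trans (snN.1 _ _) _.
apply: lerD; apply: le_trans (NM _ _) _; apply: ler_pM => //; exact: sqrt_iter_le.
Qed.

Lemma sqrt_iter_dist n k :
  N (sqrt_iter (n + k) - sqrt_iter n) <= sqrt_majorant (n + k) - sqrt_majorant n.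
Proof.
elim: k => [|k IHk]; first by rewrite addn0 !subrr N0.
rewrite addnS; apply: le_trans (seminorm_dist snN _ (sqrt_iter (n + k)) _) _.
have := sqrt_iter_step (n + k); lra.
Qed.

Lemma sqrt_iter_cauchy : ncauchy N sqrt_iter.
Proof.
have mono n k : sqrt_majorant n <= sqrt_majorant (n + k).
  by rewrite -subr_ge0; apply: le_trans (sqrt_iter_dist n k).
have [l ml lub] : exists2 l, (forall n, sqrt_majorant n <= l) &
    forall e, 0 < e -> exists n, l - e < sqrt_majorant n.
  have hs : has_sup (range sqrt_majorant).
    split; first by exists (sqrt_majorant 0), 0%N.
    by exists 1 => _ [n _ <-]; case/andP: (sqrt_majorant_itv n).
  exists (sup (range sqrt_majorant)) => [n|e e0].
    by apply: ub_le_sup; [exact: hs.2 | exists n].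
  by have [_ [n _ <-] h] := sup_adherent e0 hs; exists n.
move=> e e0; have e2 : 0 < e / 2 by lra.
have [n0 hn0] := lub _ e2; exists n0.
have near m : (n0 <= m)%N -> N (sqrt_iter m - sqrt_iter n0) < e / 2.
  move=> /subnKC <-; apply: le_lt_trans (sqrt_iter_dist _ _) _.
  by have := ml (n0 + (m - n0))%N; lra.
move=> m n /near h1 /near h2.
have := seminorm_dist snN (sqrt_iter m) (sqrt_iter n0) (sqrt_iter n).
by rewrite (seminormC snN (sqrt_iter n0)); lra.
Qed.

(** The element [g] plays 1/2. Only a ring is assumed, possibly zero, so that the result serves [C]
    and ['M[C]_n] alike. The last clause transfers to the root every closed property that the
    iteration preserves; self-adjointness and commutation are obtained in this way. *)
Lemma banach_sqrt : exists y : A,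
  [/\ N y <= 1, (1 - y) * (1 - y) = 1 - a &
      forall P : set A, P 0 -> (forall x, P x -> P (g * (a + x * x))) ->
        nclosed N P -> P y].
Proof.
have [y yl] := N_complete sqrt_iter_cauchy; exists y.
have Ny : N y <= 1.
  apply: (ncvg_le snN yl) => n; apply: le_trans (sqrt_iter_le n) _.
  by case/andP: (sqrt_majorant_itv n).
(* The step of the iteration is 1-Lipschitz on the unit ball, so the limit is a fixed point. *)
have fix_y : y = g * (a + y * y).
  apply: (@ncvg_unique R A N snN (fun n => sqrt_iter n.+1) _ _ N_eq0).
    exact: (ncvg_sub (f := S) _ yl).
  move=> e e0; have [n0 hn0] := yl _ e0; exists n0 => n /hn0 h.
  set x := sqrt_iter n in h *.
  rewrite /= -/x -mulrBr Ng opprD addrACA subrr add0r.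
  have -> : x * x - y * y = x * (x - y) + (x - y) * y.
    by rewrite mulrBr mulrBl addrA subrK.
  have Nx : N x <= 1.
    by apply: le_trans (sqrt_iter_le n) _; case/andP: (sqrt_majorant_itv n).
  apply: (@le_lt_trans _ _ (N (x - y))) => //.
  rewrite ler_pdivrMr ?ltr0n //; apply: le_trans (snN.1 _ _) _.
  rewrite mulr_natr mulr2n; apply: lerD; apply: le_trans (NM _ _) _.
    by rewrite ler_piMl.
  by rewrite ler_piMr.
have yy : y + y = a + y * y by rewrite {1 2}fix_y -mulrDl gg mul1r.
split=> // [|P P0 Pg Pcl].
  have -> : (1 - y) * (1 - y) = 1 - (y + y - y * y).
    by rewrite mulrBl mul1r mulrBr mulr1 -[LHS]addrA -opprD addrA.
  by rewrite yy addrK.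
by apply: (Pcl sqrt_iter) => // n; elim: n => [|n IHn] //=; exact: Pg.
Qed.

End Iteration.

Variable (st : A -> A) (c : R).
Hypotheses (stK : involutive st) (stD : forall x y, st (x + y) = st x + st y).
Hypotheses (stM : forall x y, st (x * y) = st y * st x) (st_g : st g = g).
Hypotheses (c_ge0 : 0 <= c) (st_le : forall x, N (st x) <= c * N x).

Lemma st0 : st 0 = 0.
Proof. by apply: (addrI (st 0)); rewrite -stD !addr0. Qed.

Lemma stN x : st (- x) = - st x.
Proof. by apply: (addrI (st x)); rewrite -stD !subrr st0. Qed.

Lemma st1 : st 1 = 1.
Proof. by have := stM (st 1) 1; rewrite mulr1 !stK mulr1 => <-. Qed.

Lemma selfadjoint_sqrt a : N a <= 1 -> st a = a ->
  exists z : A, [/\ st z = z, z * z = 1 - a, N (1 - z) <= 1 &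
    forall b, a * b = b * a -> z * b = b * z].
Proof.
move=> Na sa; have [y [Ny yE Py]] := banach_sqrt Na; exists (1 - y).
split=> // [||b ab].
- rewrite stD st1 stN (_ : st y = y) //; apply: (Py (fun x => st x = x)).
  + exact: st0.
  + by move=> x xE; rewrite stM stD stM st_g sa xE gC.
  move=> u l uE ul; apply: (ncvg_unique snN N_eq0 _ ul).
  rewrite (_ : u = fun n => st (u n)); last by apply/funext => n; rewrite uE.
  apply: (ncvg_lip c_ge0 _ ul) => x x'; by rewrite -stN -stD.
- by rewrite opprB addrC subrK.
rewrite mulrBl mulrBr mul1r mulr1 (_ : y * b = b * y) //.
apply: (Py (fun x => x * b = b * x)).
- by rewrite mul0r mulr0.
- move=> x xb; rewrite -mulrA mulrDl ab -mulrA xb mulrA xb -mulrA -mulrDr.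
  by rewrite !mulrA gC.
move=> u l ub ul; apply: (@ncvg_unique R A N snN (fun n => u n * b) _ _ N_eq0).
  apply: (ncvg_lip (F := fun x => x * b) (N_ge0 b) _ ul) => x x'.
  by rewrite -mulrBl [_ * N _]mulrC NM.
rewrite (_ : (fun n => _) = fun n => b * u n); last by apply/funext => n; rewrite ub.
by apply: (ncvg_lip (F := fun x => b * x) (N_ge0 b) _ ul) => x x'; rewrite -mulrBr NM.
Qed.

(* [1 - x^* x] has a self-adjoint square root. *)
Lemma positive_functional_le (phi : A -> R) :
  (forall x y, phi (x + y) = phi x + phi y) -> (forall y, 0 <= phi (st y * y)) ->
  forall x, N (st x * x) <= 1 -> phi (st x * x) <= phi 1.
Proof.
move=> phiD phi_ge0 x Nx.
have sa : st (st x * x) = st x * x by rewrite stM stK.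
have [z [sz zz _ _]] := selfadjoint_sqrt Nx sa.
have := phi_ge0 z; rewrite sz zz; have := phiD (1 - st x * x) (st x * x).
by rewrite subrK => ->; lra.
Qed.

End BanachSqrt.

Lemma half_double (R : realType) (V : lmodType R[i]) (x : V) :
  (2^-1 : R)%:C *: x + (2^-1 : R)%:C *: x = x.
Proof.
rewrite -scalerDl -[in RHS](scale1r x); congr (_ *: _).
by apply/eqP; rewrite eq_complex /= addr0 eqxx andbT; apply/eqP; lra.
Qed.

(** * Self-adjoint elements and unitaries *)

Section CStarBasics.
Variables (R : realType) (C : cstarType R).
Implicit Types (x y b d : C) (r s : R).
Local Notation N := (@cnorm R C).

Lemma Re_norm_real r : complex.Re `|r%:C| = `|r|.
Proof. by rewrite normc_def /= expr0n addr0 sqrtr_sqr. Qed.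

Lemma cnormZR r x : N (r%:C *: x) = `|r| * N x.
Proof. by rewrite cnormZ Re_norm_real. Qed.

Lemma cnormN x : N (- x) = N x.
Proof. by rewrite -scaleN1r cnormZ normrN normr1 mul1r. Qed.

Lemma cnorm_seminorm : seminorm N.
Proof. by split; [exact: cnormD | exact: cnormN]. Qed.

Lemma cnorm_ge0 x : 0 <= N x. Proof. exact: seminorm_ge0 cnorm_seminorm _. Qed.

Lemma cnorm0 : N 0 = 0.
Proof. by rewrite -(scale0r (0 : C)) cnormZ normr0 mul0r. Qed.

Lemma starD x y : star (x + y) = star x + star y.
Proof. by have := star_conjlinear 1 x y; rewrite !scale1r conjC1 scale1r. Qed.

Lemma star0 : star (0 : C) = 0.
Proof. by apply: (addrI (star 0)); rewrite -starD !addr0. Qed.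

Lemma starZ (a : R[i]) x : star (a *: x) = Num.conj a *: star x.
Proof. by have := star_conjlinear a x 0; rewrite star0 !addr0. Qed.

Lemma starN x : star (- x) = - star x.
Proof. by apply: (addrI (star x)); rewrite -starD !subrr star0. Qed.

Lemma starB x y : star (x - y) = star x - star y.
Proof. by rewrite starD starN. Qed.

Lemma star1 : star (1 : C) = 1.
Proof. by have := starM (star 1 : C) 1; rewrite mulr1 !starK mulr1 => <-. Qed.

Lemma conjC_real r : Num.conj (r%:C) = r%:C.
Proof. by rewrite conj_Creal // complex_real. Qed.

Lemma starZR r x : star (r%:C *: x) = r%:C *: star x.
Proof. by rewrite starZ conjC_real. Qed.

Lemma cnorm_star x : N (star x) = N x.
Proof.
have le y : N y <= N (star y).
  have [->|y0] := eqVneq (N y) 0; first exact: cnorm_ge0.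
  have yp : 0 < N y by rewrite lt_neqAle eq_sym y0 cnorm_ge0.
  by rewrite -(ler_pM2r yp) -expr2 -cstar_identity cnormM.
by apply/le_anti; rewrite le (le_trans (le (star x))) ?starK.
Qed.

Lemma cnorm1_le : N 1 <= 1.
Proof.
have := cstar_identity (1 : C); rewrite star1 mulr1 expr2.
have := cnorm_ge0 1; have [->|n0] := eqVneq (N 1) 0; first by rewrite ler01.
by move=> _ h; rewrite -(mulr1 (N 1)) in h *; have := mulfI n0; move/(_ 1 (N 1 * 1)) => /=;
   rewrite !mulr1 in h *; move=> ->.
Qed.

Lemma cnorm_scalar r : N (r%:C%:A) <= `|r|.
Proof. by rewrite cnormZR ler_piMr // cnorm1_le. Qed.

Lemma cnorm_sa_sq b : star b = b -> N (b * b) = N b ^+ 2.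
Proof. by move=> sb; rewrite -cstar_identity sb. Qed.

Let g : C := (2^-1 : R)%:C%:A.

Let gE x : g * x = (2^-1 : R)%:C *: x. Proof. by rewrite mulr_algl. Qed.

Lemma cstar_sqrt x : N x <= 1 -> star x = x ->
  exists z : C, [/\ star z = z, z * z = 1 - x, N (1 - z) <= 1 &
    forall b, x * b = b * x -> z * b = b * z].
Proof.
move=> Nx sx; apply: (@selfadjoint_sqrt R C N g _ _ _ _ _ _ _ star 1) => //.
- exact: cnorm_seminorm.
- exact: cnorm_eq0.
- exact: cnormM.
- exact: cnorm_complete.
- exact: half_double.
- by move=> y; rewrite mulr_algl mulr_algr.
- by move=> y; rewrite gE cnormZR ger0_norm ?invr_ge0 // mulrC.
- exact: starK.
- exact: starD.
- exact: starM.
- by rewrite /g starZR star1.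
- by move=> y; rewrite cnorm_star mul1r.
Qed.

Lemma cstar_positive_functional (phi : C -> R) :
  (forall x y, phi (x + y) = phi x + phi y) -> (forall y, 0 <= phi (star y * y)) ->
  forall x, N x <= 1 -> phi (star x * x) <= phi 1.
Proof.
move=> phiD phi0 x Nx.
have Nxx : N (star x * x) <= 1 by rewrite cstar_identity expr_le1 // cnorm_ge0.
have sxx : star (star x * x) = star x * x by rewrite starM starK.
have [z [sz zz _ _]] := cstar_sqrt Nxx sxx.
have := phi0 z; rewrite sz zz; have := phiD (1 - star x * x) (star x * x).
by rewrite subrK => ->; lra.
Qed.

(** With [b] as a cosine and the root [z] of [1 - b * b] as a sine, [b + 'i *: z] is a unitary with
    real part [b]. *)
Lemma sa_unitary b : star b = b -> N b <= 1 ->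
  exists z : C, [/\ star z = z, z * z = 1 - b * b, z * b = b * z,
    star (b + 'i *: z) = b - 'i *: z &
    star (b + 'i *: z) * (b + 'i *: z) = 1 /\
    (b + 'i *: z) * star (b + 'i *: z) = 1].
Proof.
move=> sb Nb.
have Nbb : N (b * b) <= 1 by rewrite cnorm_sa_sq // expr_le1 // cnorm_ge0.
have sbb : star (b * b) = b * b by rewrite starM sb.
have [z [sz zz _ /(_ b)]] := cstar_sqrt Nbb sbb; rewrite mulrA => /(_ erefl) zb.
have sv : star (b + 'i *: z) = b - 'i *: z.
  by rewrite starD starZ sb sz conjCi scaleNr.
have ii : 'i * 'i = -1 :> R[i] by rewrite -expr2 sqrCi.
exists z; split=> //; rewrite sv; split.
  rewrite mulrDl !mulrDr !mulNr -!scalerAl -!scalerAr !scalerA ii scaleN1r opprK zz.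
  by rewrite zb addrA -[_ + _ - _]addrA addrN addr0 addrC subrK.
rewrite mulrDl !mulrDr !mulrN -!scalerAl -!scalerAr !scalerA ii scaleN1r opprK zz.
by rewrite zb addrA -[_ - _ + _]addrA addNr addr0 addrC subrK.
Qed.

Lemma unitary_le x : star x * x = 1 -> N x <= 1.
Proof.
move=> xx; have := cstar_identity x; rewrite xx.
have := cnorm1_le; have := cnorm_ge0 x => x0 n1 E.
by rewrite -ler_sqr ?nnegrE // -E expr1n.
Qed.

(** The double-angle formula: for the unitary [v] with real part [b], 1 - 2b² is minus the mean of
    v² and (star v)², and both are contractions. It replaces the statement that the spectrum of b²
    lies in [0, 1]. *)
Lemma cnorm_1_sub_2sq b : star b = b -> N b <= 1 -> N (1 - (b * b + b * b)) <= 1.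
Proof.
move=> sb Nb; have [z [sz zz zb sv [uv uv']]] := sa_unitary sb Nb.
set v := b + 'i *: z in sv uv uv'.
have ii : 'i * 'i = -1 :> R[i] by rewrite -expr2 sqrCi.
have Nv := unitary_le uv.
have Nv' : N (star v) <= 1 by rewrite cnorm_star.
pose w := 'i *: (b * z) + 'i *: (b * z).
have vv : v * v = (b * b + b * b - 1) + w.
  rewrite /v mulrDl !mulrDr -!scalerAl -!scalerAr !scalerA ii scaleN1r zb zz /w.
  rewrite opprB (addrC ('i *: _) (b * b - 1)) addrACA.
  by rewrite [b * b + (b * b - 1)]addrA.
have vv' : star v * star v = (b * b + b * b - 1) - w.
  rewrite sv mulrBl !mulrBr -!scalerAl -!scalerAr !scalerA ii scaleN1r zb zz /w.
  rewrite opprK opprD opprB (addrC (- ('i *: _)) (b * b - 1)) addrACA.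
  by rewrite [b * b + (b * b - 1)]addrA -opprD.
have -> : 1 - (b * b + b * b) =
    (2^-1 : R)%:C *: (- (v * v)) + (2^-1 : R)%:C *: (- (star v * star v)).
  rewrite -scalerDr -opprD vv vv' addrACA subrr addr0 scalerN scalerDr half_double.
  by rewrite opprB.
apply: le_trans (cnormD _ _) _; rewrite !cnormZR !cnormN ger0_norm ?invr_ge0 //.
have : N (v * v) <= 1 by apply: le_trans (cnormM _ _) _; rewrite mulr_ile1 ?cnorm_ge0.
have : N (star v * star v) <= 1.
  by apply: le_trans (cnormM _ _) _; rewrite mulr_ile1 ?cnorm_ge0.
lra.
Qed.

End CStarBasics.

Section PsdForms.
Variables (R : realType) (V : lmodType R[i]).

(** Real-valued and possibly degenerate: the real part of an inner product is one instance, the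
    defect of a contraction the other. *)
Definition psd_form (b : V -> V -> R) : Prop :=
  [/\ (forall (r : R) x y z, b (r%:C *: x + y) z = r * b x z + b y z),
      (forall x y, b x y = b y x) & forall x, 0 <= b x x].

Variable b : V -> V -> R.
Hypothesis bP : psd_form b.

Lemma psdDl x y z : b (x + y) z = b x z + b y z.
Proof. by case: bP => h _ _; have := h 1 x y z; rewrite scale1r mul1r. Qed.

Lemma psd0l z : b 0 z = 0.
Proof. by have := psdDl 0 0 z; rewrite addr0; lra. Qed.

Lemma psdZl (r : R) x z : b (r%:C *: x) z = r * b x z.
Proof. by case: bP => h _ _; have := h r x 0 z; rewrite !addr0 psd0l addr0. Qed.

Lemma psdNl x z : b (- x) z = - b x z.
Proof. by apply/eqP; rewrite -addr_eq0 -psdDl addNr psd0l. Qed.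

Lemma psdZ (r : R) x : b (r%:C *: x) (r%:C *: x) = r ^+ 2 * b x x.
Proof. by case: bP => _ s _; rewrite psdZl s psdZl mulrA expr2. Qed.

End PsdForms.

Section Abs.
Variables (R : realType) (C : cstarType R).
Implicit Types (x y b d : C) (r s : R).
Local Notation N := (@cnorm R C).

(** [e] is |b|, the root of 1 - (1 - b²), where 1 - b² is the mean of 1 and 1 - 2b² and so is a
    contraction. As 1 - e is again a contraction, [e] has a root [z], and [cnorm_1_sub_2sq] at [z]
    places [e] in the ball of centre 1/2 and radius 1/2. *)
Lemma cstar_abs1 b : star b = b -> N b <= 1 -> exists e z : C,
  [/\ star e = e, e * e = b * b, star z = z, z * z = e &
    N (1 - (e + e)) <= 1 /\ e * b = b * e].
Proof.
move=> sb Nb; have x2 := cnorm_1_sub_2sq sb Nb.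
have Nbb : N (b * b) <= 1 by rewrite cnorm_sa_sq // expr_le1 // cnorm_ge0.
have Nx : N (1 - b * b) <= 1.
  have -> : 1 - b * b = (2^-1 : R)%:C *: (1 + (1 - (b * b + b * b))).
    by rewrite opprD addrA addrACA scalerDr half_double.
  rewrite cnormZR ger0_norm ?invr_ge0 //; have := cnormD 1 (1 - (b * b + b * b)).
  by have := cnorm1_le C; lra.
have sx : star (1 - b * b) = 1 - b * b by rewrite starB star1 starM sb.
have [e [se]] := cstar_sqrt Nx sx; rewrite subKr => ee Ne eC.
have eb : e * b = b * e by apply: eC; rewrite mulrBl mulrBr mul1r mulr1 mulrA.
have s1e : star (1 - e) = 1 - e by rewrite starB star1 se.
have [z [sz]] := cstar_sqrt Ne s1e; rewrite subKr => zz _ _.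
exists e, z; split=> //; split=> //; rewrite -zz; apply: cnorm_1_sub_2sq => //.
have Nee : N e <= 1.
  by rewrite -ler_sqr ?nnegrE ?cnorm_ge0 // -cnorm_sa_sq // ee expr1n.
by rewrite -ler_sqr ?nnegrE ?cnorm_ge0 // -cnorm_sa_sq // zz expr1n.
Qed.

(* [e] is the absolute value of [b], with spectrum in [[0, s]]. *)
Lemma cstar_abs b s : star b = b -> N b <= s -> 0 < s -> exists e z : C,
  [/\ star e = e, e * e = b * b, star z = z, z * z = e &
    N (e - (s / 2)%:C%:A) <= s / 2 /\ e * b = b * e].
Proof.
move=> sb Nb s0; have sC : s%:C != 0 by rewrite (eq_complex s%:C) /= eqxx andbT gt_eqF.
pose b' := (s^-1)%:C *: b.
have bE : b = s%:C *: b' by rewrite scalerA -rmorphM mulfV ?gt_eqF // scale1r.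
have [||e [z [se ee sz zz [Ne eb]]]] := @cstar_abs1 b'.
- by rewrite starZR sb.
- by rewrite cnormZR ger0_norm ?invr_ge0 ?(ltW s0) // mulrC ler_pdivrMr ?mul1r.
exists (s%:C *: e), ((Num.sqrt s)%:C *: z); clearbody b'.
split; first by rewrite starZR se.
- by rewrite bE -!scalerAl -!scalerAr ee.
- by rewrite starZR sz.
- by rewrite -scalerAl -scalerAr scalerA -rmorphM -expr2 sqr_sqrtr ?ltW // zz.
split; last by rewrite bE -!scalerAl -!scalerAr eb.
have -> : s%:C *: e - (s / 2)%:C%:A = (- (s / 2))%:C *: (1 - (e + e)).
  by rewrite rmorphN scaleNr -scalerN opprB scalerBr scalerDr -scalerDl -rmorphD -splitr.
have s2 : 0 <= s / 2 by rewrite divr_ge0 // ltW.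
by rewrite cnormZR normrN (ger0_norm s2) ler_piMr.
Qed.

End Abs.

(** * Contractivity of representations *)

Section StarReps.
Variables (R : realType) (C : cstarType R) (H : hilbertType R).
Variable rho : C -> H -> H.
Hypothesis rho_rep : star_rep rho.
Implicit Types (x y b d : C) (r s : R) (h k : H).
Local Notation N := (@cnorm R C).
Local Notation nH := (@hnorm R H).

Let rho_alg : alg_rep rho := rho_rep.1.

Definition re_inner h k : R := complex.Re (inner h k).

Lemma re_inner_psd : psd_form re_inner.
Proof.
split=> [r x y z|x y|x]; last exact: Re_form_ge0.
- rewrite /re_inner linearPl /=; case: (inner x z) => p q /=.
  by rewrite raddfD /=; ring.
- exact: Re_form_sym.
Qed.

Lemma hnorm2 h : nH h ^+ 2 = re_inner h h. Proof. exact: dnorm2. Qed.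

Lemma repP (a : R[i]) x y h : rho (a *: x + y) h = a *: rho x h + rho y h.
Proof. by case: rho_alg. Qed.

Lemma repD x y h : rho (x + y) h = rho x h + rho y h.
Proof. by rewrite -[x]scale1r repP !scale1r. Qed.

Lemma rep0 h : rho 0 h = 0.
Proof. by apply: (addrI (rho 0 h)); rewrite -repD !addr0. Qed.

Lemma repZ (a : R[i]) x h : rho (a *: x) h = a *: rho x h.
Proof. by rewrite -[a *: x]addr0 repP rep0 addr0. Qed.

Lemma repN x h : rho (- x) h = - rho x h.
Proof. by rewrite -scaleN1r repZ scaleN1r. Qed.

Lemma repB x y h : rho (x - y) h = rho x h - rho y h.
Proof. by rewrite repD repN. Qed.

Lemma repM x y h : rho (x * y) h = rho x (rho y h).
Proof. by case: rho_alg => _ _ ->. Qed.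

Lemma rep1 x h : rho x (rho 1 h) = rho x h.
Proof. by rewrite -repM mulr1. Qed.

Lemma rep_linear x (a : R[i]) h k : rho x (a *: h + k) = a *: rho x h + rho x k.
Proof. by case: rho_alg => /(_ x)[]. Qed.

Lemma rep_adj x h k : inner (rho x h) k = inner h (rho (star x) k).
Proof. exact: rho_rep.2. Qed.

(** The functional [y |-> b (rho y h) h] is positive, hence controlled by its value at 1. The form
    is arbitrary because defect forms are needed besides the inner product; [rho 1] stays on the
    right because [rho] may be degenerate. *)
Lemma rep_form_le (b : H -> H -> R) : psd_form b ->
  (forall x h k, b (rho (star x) h) k = b h (rho x k)) ->
  forall x (c : R) h, N x <= c ->
    b (rho x h) (rho x h) <= c ^+ 2 * b (rho 1 h) (rho 1 h).
Proof.
move=> bP badj x c h Nx.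
have b11 : b (rho 1 h) (rho 1 h) = b (rho 1 h) h.
  by rewrite -badj star1 rep1.
have key y : N y <= 1 -> b (rho y h) (rho y h) <= b (rho 1 h) (rho 1 h).
  move=> Ny; rewrite -badj b11 -repM.
  apply: (@cstar_positive_functional R C (fun y => b (rho y h) h)) => //.
    by move=> u v; rewrite repD psdDl.
  by move=> u; rewrite repM badj; case: bP.
have c0 : 0 <= c := le_trans (cnorm_ge0 x) Nx.
have [cz|cn] := eqVneq c 0.
  have -> : x = 0 by apply/cnorm_eq0/le_anti; rewrite cnorm_ge0 -cz Nx.
  by rewrite rep0 psd0l // cz expr0n mul0r.
have cp : 0 < c by rewrite lt_neqAle eq_sym cn.
have := key ((c^-1)%:C *: x); rewrite cnormZR ger0_norm ?invr_ge0 //.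
rewrite repZ psdZ // mulrC ler_pdivrMr // mul1r => /(_ Nx).
by rewrite exprVn mulrC ler_pdivrMr ?exprn_gt0 // mulrC.
Qed.

Lemma rep_le x (c : R) h : N x <= c -> nH (rho x h) <= c * nH (rho 1 h).
Proof.
move=> Nx; have c0 : 0 <= c := le_trans (cnorm_ge0 x) Nx.
rewrite -ler_sqr ?nnegrE ?mulr_ge0 ?dnorm_pos // exprMn !hnorm2.
apply: rep_form_le => //; first exact: re_inner_psd.
by move=> y u v; rewrite /re_inner rep_adj starK.
Qed.

Lemma rep1_le h : nH (rho 1 h) <= nH h.
Proof.
rewrite -ler_sqr ?nnegrE ?dnorm_pos //.
have [->|n0] := eqVneq (nH (rho 1 h)) 0; first by rewrite expr0n sqr_ge0.
have np : 0 < nH (rho 1 h) by rewrite lt_neqAle eq_sym n0 dnorm_pos.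
have : nH (rho 1 h) ^+ 2 <= nH h * nH (rho 1 h).
  rewrite hnorm2 /re_inner rep_adj star1 rep1.
  exact: le_trans (ler_norm _) (Re_form_CS _ _ _).
by rewrite ler_sqr ?nnegrE ?dnorm_pos // expr2 ler_pM2r.
Qed.

Lemma rep_contractive x h : nH (rho x h) <= N x * nH h.
Proof.
by apply: le_trans (rep_le h (lexx _)) _; rewrite ler_wpM2l ?cnorm_ge0 ?rep1_le.
Qed.

End StarReps.

(** * Replacing an element by one of norm comparable to its image *)

Section Lifting.
Variables (R : realType) (C : cstarType R) (H : hilbertType R).
Variable rho : C -> H -> H.
Hypothesis rho_rep : star_rep rho.
Implicit Types (x y b d : C) (r s : R) (h k : H).
Local Notation N := (@cnorm R C).
Local Notation nH := (@hnorm R H).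

(** Where [b] acts as a nonpositive operator, |b| acts as -b. Put k = (e + b)h. Then (e - b)k = 0
    because e² = b², so ‖zk‖² = <ek, k> = <bk, k> ≤ 0. Hence ek = bk = 0, and ‖k‖² = <h, (e + b)k>
    vanishes. *)
Lemma rep_abs_nonpositive b e z :
  star b = b -> star e = e -> e * e = b * b -> star z = z -> z * z = e ->
  e * b = b * e -> (forall h, re_inner (rho b h) h <= 0) ->
  forall h, rho e h = - rho b h.
Proof.
move=> sb se ee sz zz eb bneg h; set k := rho (e + b) h.
have ebk : rho (e - b) k = 0.
  rewrite /k -(repM rho_rep) mulrBl !mulrDr ee eb.
  by rewrite [b * b + _]addrC subrr (rep0 rho_rep).
have {}ebk : rho e k = rho b k.
  by apply/subr0_eq; rewrite -(repB rho_rep).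
have zk : nH (rho z k) ^+ 2 = re_inner (rho e k) k.
  by rewrite hnorm2 /re_inner (rep_adj rho_rep) sz -(repM rho_rep) zz Re_form_sym.
have zk0 : rho z k = 0.
  apply: (dnorm_eq0P (form := inner)); apply/eqP.
  rewrite -sqrf_eq0 eq_le sqr_ge0 andbT -[dnorm _ _]/(nH _) zk ebk; exact: bneg.
have ek0 : rho e k = 0.
  rewrite -zz (repM rho_rep) zk0.
  by have := rep_linear rho_rep z (-1) 0 0; rewrite !scaleN1r !addNr.
have k0 : k = 0.
  apply: (dnorm_eq0P (form := inner)); apply/eqP.
  rewrite -sqrf_eq0 -[dnorm _ _]/(nH _) hnorm2 /re_inner {1}/k (rep_adj rho_rep).
  by rewrite starD se sb (repD rho_rep) -ebk ek0 addr0 linear0r.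
by apply/eqP; rewrite -addr_eq0 -(repD rho_rep) -/k k0.
Qed.

(* [d'] is the minimum [(d + c - |d - c|) / 2] of [d] and [c]. *)
Lemma cut_above d (m c r : R) : star d = d -> N (d - m%:C%:A) <= r ->
  0 < r + `|m - c| ->
  (forall h, re_inner (rho d h) h <= c * re_inner (rho 1 h) h) ->
  exists d', [/\ star d' = d', (forall h, rho d' h = rho d h) &
    N (d' - (m / 2 + c / 2 - (r + `|m - c|) / 4)%:C%:A) <= r / 2 + (r + `|m - c|) / 4].
Proof.
move=> sd Nd; set s := r + `|m - c| => s0 dc.
pose b := d - c%:C%:A.
have sb : star b = b by rewrite /b starB sd starZR star1.
have Nb : N b <= s.
  have -> : b = (d - m%:C%:A) + (m - c)%:C%:A.
    by rewrite rmorphB scalerBl addrA subrK.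
  by apply: le_trans (cnormD _ _) _; apply: lerD => //; exact: cnorm_scalar.
have [e [z [se ee sz zz [Ne eb]]]] := cstar_abs sb Nb s0.
have rb h : rho b h = rho d h - c%:C *: rho 1 h.
  by rewrite /b (repB rho_rep) (repZ rho_rep).
have bneg h : re_inner (rho b h) h <= 0.
  have P := re_inner_psd H.
  by rewrite rb (psdDl P) (psdNl P) (psdZl P) subr_le0.
have re := rep_abs_nonpositive sb se ee sz zz eb bneg.
exists ((2^-1 : R)%:C *: ((d + c%:C%:A) - e)); split.
- by rewrite starZR starB starD sd se starZR star1.
- move=> h; rewrite (repZ rho_rep) (repB rho_rep) (repD rho_rep) (repZ rho_rep) re opprK rb.
  by rewrite addrACA subrr addr0 scalerDr half_double.
(* The centre is half of [m + c - s / 2], as [d] is centred at [m] and [e] at [s / 2]. *)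
have -> : (2^-1 : R)%:C *: ((d + c%:C%:A) - e) - (m / 2 + c / 2 - s / 4)%:C%:A =
    (2^-1 : R)%:C *: (d - m%:C%:A) - (2^-1 : R)%:C *: (e - (s / 2)%:C%:A).
  have -> : (m / 2 + c / 2 - s / 4)%:C%:A = (2^-1 : R)%:C *: (m%:C%:A) +
      (2^-1 : R)%:C *: (c%:C%:A) - (2^-1 : R)%:C *: ((s / 2)%:C%:A) :> C.
    rewrite !scalerA -!rmorphM -[in RHS]scalerDl -[in RHS]scalerBl -rmorphD -rmorphB.
    by congr (_ *: _); apply/eqP; rewrite eq_complex /= eqxx andbT; apply/eqP; lra.
  rewrite !scalerBr scalerDr; move: (_ *: d) (_ *: e) => d1 e1.
  move: (_ *: (m%:C *: _)) (_ *: (c%:C *: _)) (_ *: ((s / 2)%:C *: _)) => m1 c1 s1.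
  rewrite [_ + c1 - s1]addrAC opprD addrA [d1 + c1 - e1]addrAC.
  by rewrite [X in X + _ = _]addrAC addrK !opprB [s1 - _]addrC addrACA [s1 - _]addrC.
apply: le_trans (seminormB (cnorm_seminorm C) _ _) _; rewrite !cnormZR ger0_norm ?invr_ge0 //.
by move: Nd Ne; lra.
Qed.

Lemma rep_numrange d s h : (forall h, nH (rho d h) <= s * nH h) ->
  `|re_inner (rho d h) h| <= s * re_inner (rho 1 h) h.
Proof.
move=> ds.
have -> : re_inner (rho 1 h) h = nH (rho 1 h) ^+ 2.
  by rewrite hnorm2 /re_inner [in RHS](rep_adj rho_rep) star1 (rep1 rho_rep) Re_form_sym.
have -> : re_inner (rho d h) h = re_inner (rho d (rho 1 h)) (rho 1 h).
  by rewrite /re_inner (rep1 rho_rep) -{1}(mul1r d) (repM rho_rep) (rep_adj rho_rep) star1.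
apply: le_trans (Re_form_CS _ _ _) _; rewrite expr2 mulrA.
by rewrite ler_wpM2r ?dnorm_pos //; exact: ds.
Qed.

(** Truncating [d] at 1/2 from above and at -1/2 from below is invisible under [rho], where the
    numerical range already lies between these bounds, but it shrinks the norm in [C]. *)
Lemma lift_step d : star d = d -> N d <= 1 ->
  (forall h, nH (rho d h) <= 2^-1 * nH h) ->
  exists d', [/\ star d' = d', (forall h, rho d' h = rho d h) & N d' <= 3 / 4].
Proof.
move=> sd Nd ds.
have rng h := rep_numrange h ds.
(* With m = 0, c = 1/2, r = 1 the cut element lies in the ball of centre -1/8 and radius 7/8. *)
have [||h|d1 [sd1 r1 N1]] := @cut_above d 0 2^-1 1 sd.
- by rewrite scale0r subr0.
- by rewrite ltr_wpDr.
- exact: le_trans (ler_norm _) (rng h).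
have E1 : `|0 - 2^-1 : R| = 2^-1 by rewrite sub0r normrN ger0_norm ?invr_ge0.
have E2 : `|8^-1 - 2^-1 : R| = 3 / 8.
  by rewrite distrC ger0_norm; lra.
have sd1' : star (- d1) = - d1 by rewrite starN sd1.
(* With m = 1/8, c = 1/2, r = 7/8 the centre returns to 0 and the radius drops to 3/4. *)
have [||h|d2 [sd2 r2 N2]] := @cut_above (- d1) 8^-1 2^-1 (7 / 8) sd1'.
- rewrite -opprD cnormN; move: N1; rewrite E1.
  rewrite (_ : 0 / 2 + 2^-1 / 2 - (1 + 2^-1) / 4 = - 8^-1 :> R); last by lra.
  rewrite (_ : 1 / 2 + (1 + 2^-1) / 4 = 7 / 8 :> R); last by lra.
  by rewrite rmorphN scaleNr opprK.
- by rewrite E2; lra.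
- rewrite (repN rho_rep) r1 (psdNl (re_inner_psd H)).
  by have := rng h; rewrite ler_norml => /andP[? _]; lra.
exists (- d2); split.
- by rewrite starN sd2.
- by move=> h; rewrite (repN rho_rep) r2 (repN rho_rep) opprK r1.
rewrite cnormN; move: N2; rewrite E2.
rewrite (_ : _ - _ = 0 :> R); last by lra.
by rewrite rmorph0 scale0r subr0; lra.
Qed.

(** As long as the norm bound [t] is at least [2 * s], dividing by [t] brings [lift_step] into play
    and the bound drops by the factor 3/4. *)
Lemma lift_selfadjoint d s : star d = d -> 0 < s ->
  (forall h, nH (rho d h) <= s * nH h) ->
  exists d', [/\ star d' = d', (forall h, rho d' h = rho d h) & N d' <= 2 * s].
Proof.
move=> sd s0 ds.
have key n : forall d, star d = d -> (forall h, nH (rho d h) <= s * nH h) ->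
    N d <= (4 / 3) ^+ n * (2 * s) ->
    exists d', [/\ star d' = d', (forall h, rho d' h = rho d h) & N d' <= 2 * s].
  elim: n => [|n IHn] {}d {}sd {}ds Nd; first by exists d; split=> //; lra.
  set t := (4 / 3) ^+ n.+1 * (2 * s) in Nd.
  have t2 : 2 * s <= t.
    by apply: ler_peMl; [lra | apply: exprn_ege1; lra].
  have t0 : 0 < t by lra.
  have tV : 0 <= t^-1 by rewrite invr_ge0 ltW.
  have [|||d' [sd' rd' Nd']] := @lift_step ((t^-1)%:C *: d).
  - by rewrite starZR sd.
  - by rewrite cnormZR ger0_norm // mulrC ler_pdivrMr // mul1r.
  - move=> h; rewrite (repZ rho_rep) /hnorm dnormZ Re_norm_real ger0_norm //.
    rewrite mulrC ler_pdivrMr //; apply: le_trans (ds h) _.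
    rewrite mulrAC; apply: ler_wpM2r; [exact: dnorm_pos | lra].
  have tC : t%:C * (t^-1)%:C = 1 by rewrite -rmorphM mulfV ?gt_eqF.
  have rE h : rho (t%:C *: d') h = rho d h.
    by rewrite (repZ rho_rep) rd' (repZ rho_rep) scalerA tC scale1r.
  have [|h||d2 [sd2 rd2 Nd2]] := IHn (t%:C *: d').
  - by rewrite starZR sd'.
  - by rewrite rE.
  - rewrite cnormZR gtr0_norm //; apply: (@le_trans _ _ (t * (3 / 4))).
      by rewrite ler_wpM2l // ltW.
    by rewrite /t exprS; lra.
  by exists d2; split=> // h; rewrite rd2 rE.
(* Bernoulli gives (4/3)^n ≥ 1 + n/3, which exceeds N d / (2s) for this [n]. *)
pose n := Num.bound (3 * (N d / (2 * s))).
apply: (key n) => //; rewrite -ler_pdivrMr; last by lra.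
have c0 : 0 <= N d / (2 * s) by rewrite divr_ge0 ?cnorm_ge0 //; lra.
have : 3 * (N d / (2 * s)) < n%:R.
  by apply: archi_boundP; rewrite mulr_ge0.
have := @bernoulli R 3^-1 n; rewrite invr_ge0 ler0n => /(_ isT).
by rewrite (_ : 1 + 3^-1 = 4 / 3 :> R); lra.
Qed.

(** The real and imaginary parts are replaced separately and contribute [2 * s] each. *)
Lemma lift_bounded x s : 0 < s -> (forall h, nH (rho x h) <= s * nH h) ->
  (forall h, nH (rho (star x) h) <= s * nH h) ->
  exists x', (forall h, rho x' h = rho x h) /\ N x' <= 4 * s.
Proof.
move=> s0 xs xs'.
have n2 : `|2^-1 : R| = 2^-1 by rewrite ger0_norm ?invr_ge0.
pose p := (2^-1 : R)%:C *: (x + star x); pose q := (2^-1 : R)%:C *: ((- 'i) *: (x - star x)).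
have sp : star p = p by rewrite /p starZR starD starK addrC.
have sq : star q = q.
  have -> : q = (2^-1 : R)%:C *: ('i *: (star x - x)).
    by rewrite /q -[in RHS]opprB scalerN scaleNr.
  by rewrite starZR starZ starB starK conjCi scaleNr -scalerN opprB.
have i2 : `|'i : R[i]| = 1 by rewrite normCi.
have ps h : nH (rho p h) <= s * nH h.
  rewrite /p (repZ rho_rep) (repD rho_rep) /hnorm dnormZ Re_norm_real n2.
  have := dnormD inner (rho x h) (rho (star x) h).
  have := xs h; have := xs' h; rewrite /hnorm; lra.
have qs h : nH (rho q h) <= s * nH h.
  rewrite /q 2!(repZ rho_rep) (repB rho_rep) /hnorm 2!dnormZ Re_norm_real n2 normrN i2 /= mul1r.
  have := seminormB (dnorm_seminorm inner) (rho x h) (rho (star x) h).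
  have := xs h; have := xs' h; rewrite /hnorm; lra.
have [p' [_ rp Np]] := lift_selfadjoint sp s0 ps.
have [q' [_ rq Nq]] := lift_selfadjoint sq s0 qs.
exists (p' + 'i *: q'); split=> [h|].
  rewrite (repD rho_rep) (repZ rho_rep) rp rq -(repZ rho_rep) -(repD rho_rep); congr (rho _ h).
  rewrite /p /q !scalerA mulrAC mulrN -expr2 sqrCi opprK mul1r -scalerDr.
  by rewrite addrACA subrr addr0 scalerDr half_double.
apply: le_trans (cnormD _ _) _; rewrite cnormZ i2 /= mul1r; lra.
Qed.

Hypothesis rho_inj : injective rho.

(** By injectivity the element supplied by [lift_selfadjoint] is [d] itself, so N d ≤ 2s. The same
    holds for d^(2^n) and s^(2^n), and the C*-identity makes the norm multiplicative on these
    powers; hence (N d / s)^(2^n) ≤ 2 for all n, and the factor 2 disappears. *)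
Lemma faithful_selfadjoint d s : star d = d -> 0 < s ->
  (forall h, nH (rho d h) <= s * nH h) -> N d <= s.
Proof.
have key n : forall d s, star d = d -> 0 < s ->
    (forall h, nH (rho d h) <= s * nH h) -> N d ^+ (2 ^ n) <= 2 * s ^+ (2 ^ n).
  elim: n => [|n IHn] {}d {}s sd s0 ds.
    have [d' [_ rd' Nd']] := lift_selfadjoint sd s0 ds.
    by rewrite !expr1 -(rho_inj (funext rd')).
  rewrite expnS !exprM -cnorm_sa_sq //; apply: IHn.
  - by rewrite starM sd.
  - by rewrite exprn_gt0.
  move=> h; rewrite (repM rho_rep) expr2 -mulrA.
  by apply: le_trans (ds _) _; rewrite ler_wpM2l // ltW.
move=> sd s0 ds; rewrite -(mul1r s) -ler_pdivrMr // leNgt; apply/negP => gt1.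
pose x := N d / s - 1; have x0 : 0 < x by rewrite subr_gt0.
have le2 (k : nat) : (1 + x) ^+ (2 ^ k) <= 2.
  have -> : 1 + x = N d / s by rewrite /x addrC subrK.
  by rewrite expr_div_n ler_pdivrMr ?exprn_gt0 // key.
pose n := Num.bound x^-1.
have xn : x^-1 < n%:R.
  by apply: archi_boundP; rewrite invr_ge0 ltW.
have : 1 < n%:R * x by rewrite -ltr_pdivrMr // mul1r.
have : (n%:R : R) <= (2 ^ n)%:R by rewrite ler_nat ltnW // ltn_expl.
move=> /(ler_wpM2r (ltW x0)); have := bernoulli (2 ^ n)%N (ltW x0); have := le2 n; lra.
Qed.

(** The C*-identity reduces the claim to the self-adjoint element [star x * x]. A strictly positive
    bound is treated first, since [faithful_selfadjoint] divides by it. *)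
Lemma faithful_isometric x s : 0 <= s -> (forall h, nH (rho x h) <= s * nH h) -> N x <= s.
Proof.
have key t : 0 < t -> (forall h, nH (rho x h) <= t * nH h) -> N x <= t.
  move=> t0 xt.
  have xt' h : nH (rho (star x) h) <= t * nH h.
    have [->|n0] := eqVneq (nH (rho (star x) h)) 0.
      by rewrite mulr_ge0 ?dnorm_pos ?ltW.
    have np : 0 < nH (rho (star x) h) by rewrite lt_neqAle eq_sym n0 dnorm_pos.
    rewrite -(ler_pM2r np) -expr2 hnorm2 /re_inner (rep_adj rho_rep) starK.
    apply: le_trans (ler_norm _) _; apply: le_trans (Re_form_CS _ _ _) _.
    rewrite -[dnorm _ _]/(nH _) mulrC -[dnorm _ _]/(nH _) mulrAC.
    by rewrite ler_wpM2r ?dnorm_pos.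
  rewrite -ler_sqr ?nnegrE ?cnorm_ge0 ?(ltW t0) // -cstar_identity.
  apply: faithful_selfadjoint; rewrite ?exprn_gt0 //; first by rewrite starM starK.
  move=> h; rewrite (repM rho_rep) expr2 -mulrA.
  by apply: le_trans (xt' _) _; rewrite ler_wpM2l // ltW.
move=> s0 xs; apply/ler_addgt0Pr => e e0; apply: key; first by rewrite ltr_wpDl.
move=> h; apply: le_trans (xs h) _; rewrite ler_wpM2r ?dnorm_pos // lerDl ltW //.
Qed.

End Lifting.

(** * Automatic compatibility with the involution *)

Section ContractiveReps.
Variables (R : realType) (C : cstarType R) (H : hilbertType R).
Variable th : C -> H -> H.
Hypothesis th_alg : alg_rep th.
Hypothesis th_le : forall x h, hnorm (th x h) <= cnorm x * hnorm h.
Hypothesis th1_adj : forall h k, inner (th 1 h) k = inner h (th 1 k).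

(* A contractive representation sends unitaries to unitaries, since both the
   image of [v] and its inverse are contractions; unitaries span [C]. *)
Lemma contractive_rep_star : star_rep th.
Proof.
have [thb thP thM] := th_alg.
have thlin x := (thb x).1.
have thM' x y h : th (x * y) h = th x (th y h) by rewrite thM.
pose S x := forall h k, inner (th x h) k = inner h (th (star x) k).
have SP (a : R[i]) x y : S x -> S y -> S (a *: x + y).
  move=> Sx Sy h k; rewrite thP star_conjlinear thP linearPl /= linearDr /= linearZr_LR /=.
  by rewrite Sx Sy conjCK.
have S0 : S 0.
  by move=> h k; rewrite star0; have := thP (-1) 1 1;
     rewrite scaleN1r addNr => E; rewrite !E !scaleN1r !addNr linear0l linear0r.
have SZ (a : R[i]) x : S x -> S (a *: x).
  by move=> Sx; rewrite -[a *: x]addr0; exact: SP.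
have unit v : star v * v = 1 -> v * star v = 1 -> S v.
  move=> vv vv' h k.
  have th1 x g : th x (th 1 g) = th x g by rewrite -thM' mulr1.
  have th1' x g : th 1 (th x g) = th x g by rewrite -thM' mul1r.
  have iso := @dnorm_isometry_form R H H inner inner (th v) (fun g => th 1 g = g) (thlin v).
  have Nv := unitary_le vv.
  have Nv' : cnorm (star v) <= 1 by rewrite cnorm_star.
  (* On the range of [th 1] the operator [th v] is isometric and so preserves inner products. The
     second vector is chosen because [th v] sends it to [th 1 k]. *)
  have E : inner (th v (th 1 h)) (th v (th (star v) k)) = inner (th 1 h) (th (star v) k).
    apply: iso => //.
    - by move=> a x y hx hy; rewrite thlin hx hy.
    - move=> x hx; apply/le_anti/andP; split.
        by apply: le_trans (th_le _ _) _; rewrite ler_piMl ?dnorm_pos.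
      have {1}-> : x = th (star v) (th v x) by rewrite -thM' vv hx.
      by apply: le_trans (th_le _ _) _; rewrite ler_piMl ?dnorm_pos.
  by move: E; rewrite th1 -thM' vv' th1_adj th1' -th1_adj th1'.
suff SA x : S x by split=> // x h k; exact: SA.
have sa1 b : star b = b -> cnorm b <= 1 -> S b.
  move=> sb Nb; have [z [sz zz zb sv [uv uv']]] := sa_unitary sb Nb.
  have Sv := unit _ uv uv'.
  have Sv' : S (star (b + 'i *: z)) by apply: unit; rewrite starK.
  have -> : b = (2^-1 : R)%:C *: (1 *: (b + 'i *: z) + star (b + 'i *: z)).
    by rewrite sv scale1r addrACA subrr addr0 scalerDr half_double.
  by apply: SZ; apply: SP.
have sa b : star b = b -> S b.
  move=> sb; have t0 : 0 < cnorm b + 1 by rewrite ltr_wpDl ?cnorm_ge0.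
  have -> : b = (cnorm b + 1)%:C *: (((cnorm b + 1)^-1)%:C *: b).
    by rewrite scalerA -rmorphM mulfV ?gt_eqF // scale1r.
  apply: SZ; apply: sa1; first by rewrite starZR sb.
  by rewrite cnormZR ger0_norm ?invr_ge0 ?(ltW t0) // mulrC ler_pdivrMr // mul1r lerDl.
have -> : x = 'i *: ((2^-1 : R)%:C *: ('i *: (star x - x))) +
    (2^-1 : R)%:C *: (x + star x).
  rewrite scalerA mulrC -scalerA [in 'i *: ('i *: _)]scalerA -expr2 sqrCi scaleN1r opprB.
  by rewrite -scalerDr addrACA addNr addr0 scalerDr half_double.
apply: SP; apply: sa; last by rewrite starZR starD starK addrC.
by rewrite starZR starZ starB starK conjCi scaleNr -scalerN opprB.
Qed.

End ContractiveReps.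

(** * Matrices over a C*-algebra *)

Section SumSpace.
Variables (R : realType) (H : hilbertType R) (n : nat).
Local Notation V := ('I_n -> H).
Implicit Types (x y : V) (a : R[i]).
Local Notation nH := (@hnorm R H).

Definition sum_inner x y : R[i] := \sum_(i < n) inner (x i) (y i).

Lemma sum_inner_herm x y : sum_inner x y = Num.conj (sum_inner y x).
Proof. by rewrite rmorph_sum; apply: eq_bigr => i _; exact: form_herm. Qed.

Lemma sum_inner_linearl y a x1 x2 :
  sum_inner (a *: x1 + x2) y = a * sum_inner x1 y + sum_inner x2 y.
Proof.
rewrite /sum_inner mulr_sumr -big_split; apply: eq_bigr => i _ /=.
by rewrite !fctE linearPl.
Qed.

Lemma sum_inner_linearr x a y1 y2 :
  sum_inner x (a *: y1 + y2) = Num.conj a * sum_inner x y1 + sum_inner x y2.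
Proof. by rewrite sum_inner_herm sum_inner_linearl rmorphD rmorphM /= -!sum_inner_herm. Qed.

Lemma sum_inner_bilinear :
  bilinear_for *%R (@Num.conj R[i] \; *%R) sum_inner.
Proof. by split=> [y|x] a u v; [exact: sum_inner_linearl | exact: sum_inner_linearr]. Qed.

HB.instance Definition _ := bilinear_isBilinear.Build R[i] V V R[i]
  *%R (@Num.conj R[i] \; *%R) sum_inner sum_inner_bilinear.

Lemma sum_inner_hermitian x y :
  sum_inner x y = (-1) ^+ false * Num.conj (sum_inner y x).
Proof. by rewrite expr0 mul1r -sum_inner_herm. Qed.

HB.instance Definition _ := isHermitianSesquilinear.Build R[i] V false
  (@Num.conj R[i]) sum_inner sum_inner_hermitian.

Lemma sum_inner_definite x : x != 0 -> 0 < sum_inner x x.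
Proof.
move=> x0; rewrite lt_neqAle sumr_ge0 ?andbT => [|i _]; last exact: dnorm_ge0.
rewrite eq_sym; apply: contra_neq x0 => s0; apply/funext => i.
apply/eqP; rewrite -(dnorm_eq0 inner); move/eqP: s0; rewrite psumr_eq0.
  by move/allP/(_ i); rewrite mem_index_enum => /(_ isT).
by move=> j _; exact: dnorm_ge0.
Qed.

HB.instance Definition _ := isDotProduct.Build R[i] V sum_inner sum_inner_definite.

Definition sum_dot : {dot V for @Num.conj R[i]} := sum_inner.

Lemma sumnormE x : sumnorm x = dnorm sum_dot x.
Proof.
rewrite /sumnorm /dnorm; congr Num.sqrt.
rewrite (_ : sum_dot x x = sum_inner x x) // /sum_inner raddf_sum.
by apply: eq_bigr => i _; exact: dnorm2.
Qed.

Lemma sumnorm_ge0 x : 0 <= sumnorm x. Proof. exact: sqrtr_ge0. Qed.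

Lemma sumnorm2 x : sumnorm x ^+ 2 = \sum_i nH (x i) ^+ 2.
Proof. by rewrite sqr_sqrtr // sumr_ge0 // => i _; exact: sqr_ge0. Qed.

Lemma sumnorm_coord x i : nH (x i) <= sumnorm x.
Proof.
rewrite -ler_sqr ?nnegrE ?dnorm_pos ?sumnorm_ge0 // sumnorm2 (bigD1 i) //=.
by rewrite lerDl sumr_ge0 // => j _; exact: sqr_ge0.
Qed.

Lemma sumnorm0 : sumnorm (0 : V) = 0. Proof. by rewrite sumnormE dnorm0. Qed.

Lemma sumnormD x y : sumnorm (x + y) <= sumnorm x + sumnorm y.
Proof. by rewrite !sumnormE dnormD. Qed.

Lemma sumnormZ a x : sumnorm (a *: x) = complex.Re `|a| * sumnorm x.
Proof. by rewrite !sumnormE dnormZ. Qed.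

Lemma sumnorm_eq0 x : sumnorm x = 0 -> x = 0.
Proof. by rewrite sumnormE => /dnorm_eq0P. Qed.

Lemma sumnorm_le_sum x : sumnorm x <= \sum_i nH (x i).
Proof.
rewrite -ler_sqr ?nnegrE ?sumnorm_ge0 ?sumr_ge0 // => [|i _]; last exact: dnorm_pos.
rewrite sumnorm2; suff [] : \sum_i nH (x i) ^+ 2 <= (\sum_i nH (x i)) ^+ 2 /\
    0 <= \sum_i nH (x i) by [].
apply: (big_rec2 (fun u v => u <= v ^+ 2 /\ 0 <= v)); first by rewrite expr0n.
move=> i u v _ [uv v0]; split; last by rewrite addr_ge0 ?dnorm_pos.
by have := mulr_ge0 (dnorm_pos inner (x i)) v0; rewrite sqrrD -[dnorm _ _]/(nH _); lra.
Qed.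

Definition mxapp (A : 'M[H -> H]_n) x : V := fun i => \sum_(j < n) A i j (x j).

Definition bounded_mx (A : 'M[H -> H]_n) := forall i j, bounded_op (A i j).

Lemma mxapp_linear A a x y : bounded_mx A ->
  mxapp A (a *: x + y) = a *: mxapp A x + mxapp A y.
Proof.
move=> bA; apply/funext => i; rewrite /mxapp !fctE scaler_sumr -big_split.
by apply: eq_bigr => j _; have [h _] := bA i j; rewrite h.
Qed.

Lemma mxapp_bounded A : bounded_mx A ->
  exists2 c, 0 <= c & forall x, sumnorm (mxapp A x) <= c * sumnorm x.
Proof.
move=> bA.
have /choice[M AM] : forall ij : 'I_n * 'I_n, exists M : R, 0 <= M /\
    forall h, nH (A ij.1 ij.2 h) <= M * nH h.
  move=> [i j]; have [_ [M hM]] := bA i j; exists `|M|; split=> // h.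
  by apply: le_trans (hM h) _; rewrite ler_wpM2r ?dnorm_pos // ler_norm.
exists (\sum_i \sum_j M (i, j)) => [|x].
  by apply: sumr_ge0 => i _; apply: sumr_ge0 => j _; case: (AM (i, j)).
apply: le_trans (sumnorm_le_sum _) _; rewrite mulr_suml; apply: ler_sum => i _.
rewrite mulr_suml; apply: (@le_trans _ _ (\sum_j nH (A i j (x j)))).
  rewrite /mxapp; apply: (big_rec2 (fun u v => nH u <= v)).
    by rewrite /hnorm dnorm0.
  by move=> j u v _ uv; apply: le_trans (dnormD _ _ _) _; rewrite lerD2l.
apply: ler_sum => j _; have [M0 Mh] := AM (i, j).
by apply: le_trans (Mh _) _; rewrite ler_wpM2l ?sumnorm_coord.
Qed.

Lemma opmx_norm_has_sup A : bounded_mx A ->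
  has_sup [set sumnorm (mxapp A x) | x in [set x : V | sumnorm x <= 1]].
Proof.
move=> bA; split.
  by exists (sumnorm (mxapp A 0)), 0 => //=; rewrite sumnorm0 ler01.
have [c c0 hc] := mxapp_bounded bA; exists c => _ [x /= x1 <-].
by apply: le_trans (hc x) _; rewrite ler_piMr.
Qed.

Lemma opmx_norm_ge0 A : bounded_mx A -> 0 <= opmx_norm A.
Proof.
move=> bA; apply: le_trans (sumnorm_ge0 (mxapp A 0)) _.
apply: ub_le_sup; first by have [] := opmx_norm_has_sup bA.
by exists 0 => //=; rewrite sumnorm0 ler01.
Qed.

Lemma opmx_normP A x : bounded_mx A -> sumnorm (mxapp A x) <= opmx_norm A * sumnorm x.
Proof.
move=> bA; have [x0|x0] := eqVneq (sumnorm x) 0.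
  have E : mxapp A 0 = 0.
    by have := mxapp_linear (-1) 0 0 bA; rewrite !scaleN1r !addNr.
  by rewrite x0 mulr0 (sumnorm_eq0 x0) E sumnorm0.
have xp : 0 < sumnorm x by rewrite lt_neqAle eq_sym x0 sumnorm_ge0.
have V0 : 0 <= (sumnorm x)^-1 by rewrite invr_ge0 ltW.
rewrite -ler_pdivrMr // mulrC; apply: ub_le_sup; first by have [] := opmx_norm_has_sup bA.
exists (((sumnorm x)^-1)%:C *: x); first rewrite /=.
  by rewrite sumnormZ Re_norm_real ger0_norm // mulVf.
rewrite -[LHS]/(sumnorm (mxapp A _)).
have -> : mxapp A (((sumnorm x)^-1)%:C *: x) = ((sumnorm x)^-1)%:C *: mxapp A x.
  have E : mxapp A 0 = 0.
    by have := mxapp_linear (-1) 0 0 bA; rewrite !scaleN1r !addNr.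
  by have := mxapp_linear ((sumnorm x)^-1)%:C x 0 bA; rewrite E !addr0.
by rewrite sumnormZ Re_norm_real ger0_norm.
Qed.

Lemma opmx_norm_le A (c : R) : 0 <= c ->
  (forall x, sumnorm (mxapp A x) <= c * sumnorm x) -> opmx_norm A <= c.
Proof.
move=> c0 hc; apply: ge_sup.
  by exists (sumnorm (mxapp A 0)), 0 => //=; rewrite sumnorm0 ler01.
by move=> _ [x /= x1 <-]; apply: le_trans (hc x) _; rewrite ler_piMr.
Qed.

End SumSpace.

(** * Bounded operators and their norms *)

Section Opnorm.
Variables (R : realType) (H : hilbertType R).
Implicit Types (S T : H -> H).
Local Notation nH := (@hnorm R H).

Lemma op0 T : bounded_op T -> T 0 = 0.
Proof. by case=> h _; have := h (-1) 0 0; rewrite !scaleN1r !addNr. Qed.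

Lemma opD T x y : bounded_op T -> T (x + y) = T x + T y.
Proof. by case=> h _; have := h 1 x y; rewrite !scale1r. Qed.

Lemma opZ T (a : R[i]) x : bounded_op T -> T (a *: x) = a *: T x.
Proof. by move=> bT; have := bT.1 a x 0; rewrite (op0 bT) !addr0. Qed.

Lemma opN T x : bounded_op T -> T (- x) = - T x.
Proof. by move=> bT; rewrite -scaleN1r (opZ _ _ bT) scaleN1r. Qed.

Lemma opB T x y : bounded_op T -> T (x - y) = T x - T y.
Proof. by move=> bT; rewrite (opD _ _ bT) (opN _ bT). Qed.

Lemma op_sum T (I : Type) (r : seq I) (P : pred I) (F : I -> H) : bounded_op T ->
  T (\sum_(i <- r | P i) F i) = \sum_(i <- r | P i) T (F i).
Proof.
move=> bT; apply: (big_morph T) => [x y|]; [exact: opD | exact: op0].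
Qed.

Lemma hnorm0 : nH 0 = 0. Proof. exact: dnorm0. Qed.

Lemma hnorm_sum (I : Type) (r : seq I) (P : pred I) (F : I -> H) :
  nH (\sum_(i <- r | P i) F i) <= \sum_(i <- r | P i) nH (F i).
Proof.
apply: (big_rec2 (fun u v => nH u <= v)); first by rewrite hnorm0.
by move=> j u v _ uv; apply: le_trans (dnormD _ _ _) _; rewrite lerD2l.
Qed.

Lemma bounded_op_ge0 T : bounded_op T -> exists2 c, 0 <= c & forall h, nH (T h) <= c * nH h.
Proof.
case=> _ [M hM]; exists `|M| => // h.
by apply: le_trans (hM h) _; rewrite ler_wpM2r ?dnorm_pos // ler_norm.
Qed.

Lemma opnorm_has_sup T : bounded_op T ->
  has_sup [set nH (T x) | x in [set x | nH x <= 1]].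
Proof.
move=> /bounded_op_ge0[c c0 hc]; split.
  by exists (nH (T 0)), 0 => //=; rewrite hnorm0 ler01.
by exists c => _ [x /= x1 <-]; apply: le_trans (hc x) _; rewrite ler_piMr.
Qed.

Lemma opnorm_ge0 T : bounded_op T -> 0 <= opnorm T.
Proof.
move=> bT; apply: le_trans (dnorm_pos inner (T 0)) _.
apply: ub_le_sup; first by have [] := opnorm_has_sup bT.
by exists 0 => //=; rewrite hnorm0 ler01.
Qed.

Lemma opnormP T h : bounded_op T -> nH (T h) <= opnorm T * nH h.
Proof.
move=> bT; have [h0|h0] := eqVneq (nH h) 0.
  by rewrite h0 mulr0 (dnorm_eq0P h0) (op0 bT) hnorm0.
have hp : 0 < nH h by rewrite lt_neqAle eq_sym h0 dnorm_pos.
have V0 : 0 <= (nH h)^-1 by rewrite invr_ge0 ltW.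
rewrite -ler_pdivrMr // mulrC; apply: ub_le_sup; first by have [] := opnorm_has_sup bT.
exists (((nH h)^-1)%:C *: h) => /=.
  by rewrite /hnorm dnormZ Re_norm_real ger0_norm // mulVf.
by rewrite (opZ _ _ bT) /hnorm dnormZ Re_norm_real ger0_norm.
Qed.

Lemma opnorm_le T (c : R) : 0 <= c -> (forall h, nH (T h) <= c * nH h) -> opnorm T <= c.
Proof.
move=> c0 hc; apply: ge_sup.
  by exists (nH (T 0)), 0 => //=; rewrite hnorm0 ler01.
by move=> _ [x /= x1 <-]; apply: le_trans (hc x) _; rewrite ler_piMr.
Qed.

Lemma sumnorm1 (x : 'I_1 -> H) : sumnorm x = nH (x 0).
Proof. by rewrite /sumnorm big_ord1 sqrtr_sqr ger0_norm // dnorm_pos. Qed.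

Lemma opmx_norm1 T : bounded_op T -> opmx_norm (const_mx T : 'M_1) = opnorm T.
Proof.
move=> bT; have bA : bounded_mx (const_mx T : 'M_1) by move=> i j; rewrite mxE.
have app x : mxapp (const_mx T : 'M_1) x 0 = T (x 0) by rewrite /mxapp big_ord1 mxE.
apply/le_anti/andP; split.
  by apply: opmx_norm_le; [exact: opnorm_ge0 | move=> x; rewrite !sumnorm1 app; exact: opnormP].
apply: opnorm_le; first exact: opmx_norm_ge0.
by move=> h; have := opmx_normP (fun=> h) bA; rewrite !sumnorm1 app.
Qed.

Lemma bounded_op_comb (a : R[i]) S T : bounded_op S -> bounded_op T ->
  bounded_op (fun x => a *: S x + T x).
Proof.
move=> bS bT; split=> [b x y|].
  by rewrite bS.1 bT.1 scalerDr addrACA !scalerDr !scalerA (mulrC a b).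
exists (complex.Re `|a| * opnorm S + opnorm T) => x.
apply: le_trans (dnormD _ _ _) _; rewrite mulrDl dnormZ -mulrA; apply: lerD.
  by rewrite ler_wpM2l ?opnormP ?Re_norm_ge0.
exact: opnormP.
Qed.

Lemma bounded_op_comp S T : bounded_op S -> bounded_op T -> bounded_op (S \o T).
Proof.
move=> bS bT; split=> [b x y|]; first by rewrite /= bT.1 bS.1.
exists (opnorm S * opnorm T) => x /=; apply: le_trans (opnormP _ bS) _.
by rewrite -mulrA ler_wpM2l ?opnorm_ge0 ?opnormP.
Qed.

Lemma iter_bounded T n : bounded_op T -> bounded_op (iter n T).
Proof.
move=> bT; elim: n => [|n IHn] /=; last exact: bounded_op_comp.
by split=> //; exists 1 => x; rewrite mul1r.
Qed.

Lemma bounded_op0 : bounded_op (fun=> 0 : H).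
Proof.
split=> [a x y|]; first by rewrite scaler0 addr0.
by exists 0 => x; rewrite mul0r hnorm0.
Qed.

Lemma bounded_opB S T : bounded_op S -> bounded_op T -> bounded_op (S \- T).
Proof.
move=> bS bT; rewrite (_ : S \- T = fun x => (-1) *: T x + S x).
  exact: bounded_op_comb.
by apply/funext => x /=; rewrite scaleN1r addrC.
Qed.

Lemma bounded_op_sum n (F : 'I_n -> H -> H) : (forall k, bounded_op (F k)) ->
  bounded_op (fun x => \sum_(k < n) F k x).
Proof.
move=> bF; split=> [a x y|].
  by rewrite scaler_sumr -big_split; apply: eq_bigr => k _; rewrite (bF k).1.
exists (\sum_k opnorm (F k)) => x; apply: le_trans (hnorm_sum _ _ _) _.
by rewrite mulr_suml; apply: ler_sum => k _; exact: opnormP.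
Qed.

Lemma opmx_norm_lip n (A B : 'M[H -> H]_n) : bounded_mx A -> bounded_mx B ->
  opmx_norm A <= opmx_norm B + \sum_i \sum_j opnorm (A i j \- B i j).
Proof.
move=> bA bB; have bd i j : bounded_op (A i j \- B i j) by exact: bounded_opB.
have S0 : 0 <= \sum_i \sum_j opnorm (A i j \- B i j).
  by do 2![apply: sumr_ge0 => ? _]; exact: opnorm_ge0.
apply: opmx_norm_le; first by rewrite addr_ge0 ?opmx_norm_ge0.
move=> x; have -> : mxapp A x = mxapp B x + (fun i => \sum_j (A i j \- B i j) (x j)).
  apply/funext => i; rewrite /mxapp !fctE -big_split; apply: eq_bigr => j _ /=.
  by rewrite addrC subrK.
apply: le_trans (sumnormD _ _) _; rewrite mulrDl; apply: lerD; first exact: opmx_normP.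
apply: le_trans (sumnorm_le_sum _) _; rewrite mulr_suml; apply: ler_sum => i _.
apply: le_trans (hnorm_sum _ _ _) _; rewrite mulr_suml; apply: ler_sum => j _.
apply: le_trans (opnormP _ (bd i j)) _.
by rewrite ler_wpM2l ?opnorm_ge0 // sumnorm_coord.
Qed.

End Opnorm.

Section PsdSums.
Variables (R : realType) (V : lmodType R[i]) (b : V -> V -> R).
Hypothesis bP : psd_form b.

Lemma psd_suml (I : Type) (r : seq I) (P : pred I) (F : I -> V) z :
  b (\sum_(i <- r | P i) F i) z = \sum_(i <- r | P i) b (F i) z.
Proof. by apply: (big_morph (b^~ z)) => [x y|]; [exact: psdDl | exact: psd0l]. Qed.

Lemma psd_sumr (I : Type) (r : seq I) (P : pred I) (F : I -> V) z :
  b z (\sum_(i <- r | P i) F i) = \sum_(i <- r | P i) b z (F i).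
Proof.
have [_ s _] := bP; rewrite s psd_suml; apply: eq_bigr => i _; exact: s.
Qed.

End PsdSums.

(** * Matrices over [C] normed by a faithful representation *)

Section MatrixReps.
Variables (R : realType) (C : cstarType R) (n : nat).
Implicit Types (M : 'M[C]_n).

Definition mxstar M : 'M[C]_n := map_mx star M^T.

Lemma mxstarE M i j : mxstar M i j = star (M j i). Proof. by rewrite !mxE. Qed.

Lemma mxstarK : involutive mxstar.
Proof. by move=> M; apply/matrixP => i j; rewrite !mxstarE starK. Qed.

Lemma mxstarD M1 M2 : mxstar (M1 + M2) = mxstar M1 + mxstar M2.
Proof. by apply/matrixP => i j; rewrite !mxE starD. Qed.

Lemma star_sum (I : Type) (r : seq I) (P : pred I) (F : I -> C) :
  star (\sum_(i <- r | P i) F i) = \sum_(i <- r | P i) star (F i).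
Proof. by apply: (big_morph star) => [x y|]; [exact: starD | exact: star0]. Qed.

Lemma mxstarM M1 M2 : mxstar (M1 * M2) = mxstar M2 * mxstar M1.
Proof.
apply/matrixP => i j; rewrite mxstarE !mxE star_sum; apply: eq_bigr => k _.
by rewrite !mxE starM.
Qed.

Section OneRep.
Variables (H : hilbertType R) (rho : C -> H -> H).
Hypothesis rho_rep : star_rep rho.

Lemma rep_bounded (x : C) : bounded_op (rho x). Proof. by case: rho_rep.1. Qed.

Lemma rep_sum (I : Type) (r : seq I) (P : pred I) (F : I -> C) h :
  rho (\sum_(i <- r | P i) F i) h = \sum_(i <- r | P i) rho (F i) h.
Proof.
by apply: (big_morph (fun x => rho x h)) => [x y|];
  [exact: (repD rho_rep) | exact: (rep0 rho_rep)].
Qed.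

Lemma map_rep_bounded M : bounded_mx (map_mx rho M).
Proof. by move=> i j; rewrite mxE; exact: rep_bounded. Qed.

Lemma mxapp_repD M1 M2 x :
  mxapp (map_mx rho (M1 + M2)) x = mxapp (map_mx rho M1) x + mxapp (map_mx rho M2) x.
Proof.
apply/funext => i; rewrite /mxapp !fctE -big_split; apply: eq_bigr => j _.
by rewrite !mxE (repD rho_rep).
Qed.

Lemma mxapp_repM M1 M2 x :
  mxapp (map_mx rho (M1 * M2)) x = mxapp (map_mx rho M1) (mxapp (map_mx rho M2) x).
Proof.
apply/funext => i; rewrite /mxapp.
rewrite (eq_bigr (fun j => \sum_k rho (M1 i k) (rho (M2 k j) (x j)))); last first.
  by move=> j _; rewrite !mxE rep_sum; apply: eq_bigr => k _; rewrite (repM rho_rep).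
rewrite exchange_big; apply: eq_bigr => k _; rewrite mxE (op_sum _ _ _ (rep_bounded _)).
by apply: eq_bigr => j _; rewrite mxE.
Qed.

Lemma mxapp_repZ (a : R[i]) M x :
  mxapp (map_mx rho (map_mx ( *:%R a) M)) x = a *: mxapp (map_mx rho M) x.
Proof.
apply/funext => i; rewrite /mxapp !fctE scaler_sumr; apply: eq_bigr => j _.
by rewrite !mxE (repZ rho_rep).
Qed.

Lemma mxapp_adj (b : H -> H -> R) : psd_form b ->
  (forall x h k, b (rho (star x) h) k = b h (rho x k)) ->
  forall M x y, \sum_i b (mxapp (map_mx rho (mxstar M)) x i) (y i) =
                \sum_i b (x i) (mxapp (map_mx rho M) y i).
Proof.
move=> bP badj M x y.
under eq_bigr do rewrite /mxapp (psd_suml bP).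
under [RHS]eq_bigr do rewrite /mxapp (psd_sumr bP).
rewrite exchange_big; apply: eq_bigr => i _; apply: eq_bigr => j _.
by rewrite !mxE badj.
Qed.

End OneRep.

Variables (H0 : hilbertType R) (pi : C -> H0 -> H0).
Hypotheses (pi_rep : star_rep pi) (pi_inj : injective pi).
Local Notation N := (fun M : 'M[C]_n => opmx_norm (map_mx pi M)).

Let piP M x := opmx_normP x (map_rep_bounded pi_rep M).
Let N_ge0 M : 0 <= N M. Proof. exact: opmx_norm_ge0 (map_rep_bounded pi_rep M). Qed.

(** Vectors supported at [j] bound the operator [pi (M i j)], and faithfulness turns this into a
    bound in [C]. Together with [mxnorm_le_entries] it makes the norm equivalent to the entrywise
    one, whence completeness. *)
Lemma mxnorm_entry M i j : cnorm (M i j) <= N M.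
Proof.
apply: (faithful_isometric pi_rep pi_inj) => // h.
pose x : 'I_n -> H0 := fun k => if k == j then h else 0.
have sx : sumnorm x = hnorm h.
  apply/eqP; rewrite -(@eqrXn2 _ 2) ?sumnorm_ge0 ?dnorm_pos // sumnorm2 (bigD1 j) //=.
  rewrite /x eqxx big1 ?addr0 // => k kj.
  by rewrite (negPf kj) hnorm0 expr0n.
rewrite -sx; apply: le_trans (piP M x); apply: le_trans (sumnorm_coord _ i).
rewrite /mxapp (bigD1 j) //= big1 ?addr0; first by rewrite mxE /x eqxx.
by move=> k kj; rewrite mxE /x (negPf kj) (op0 (rep_bounded pi_rep _)).
Qed.

Lemma mxnorm_le_entries M : N M <= \sum_i \sum_j cnorm (M i j).
Proof.
apply: opmx_norm_le => [|x].
  by do 2![apply: sumr_ge0 => ? _]; exact: cnorm_ge0.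
apply: le_trans (sumnorm_le_sum _) _; rewrite mulr_suml; apply: ler_sum => i _.
apply: le_trans (hnorm_sum _ _ _) _; rewrite mulr_suml; apply: ler_sum => j _.
rewrite mxE; apply: le_trans (rep_contractive pi_rep _ _) _.
by rewrite ler_wpM2l ?cnorm_ge0 ?sumnorm_coord.
Qed.

Lemma mxnormD M1 M2 : N (M1 + M2) <= N M1 + N M2.
Proof.
apply: opmx_norm_le => [|x]; first by rewrite addr_ge0.
rewrite (mxapp_repD pi_rep) mulrDl; apply: le_trans (sumnormD _ _) _.
by apply: lerD; exact: piP.
Qed.

Lemma mxnormZ_le (a : R[i]) M : N (map_mx ( *:%R a) M) <= complex.Re `|a| * N M.
Proof.
have a0 : 0 <= complex.Re `|a| by exact: Re_norm_ge0.
apply: opmx_norm_le => [|x]; first by rewrite mulr_ge0.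
by rewrite (mxapp_repZ pi_rep) sumnormZ -mulrA ler_wpM2l.
Qed.

Lemma mxnormN_le M : N (- M) <= N M.
Proof.
have -> : - M = map_mx ( *:%R (-1)) M by apply/matrixP => i j; rewrite !mxE scaleN1r.
by apply: le_trans (mxnormZ_le _ _) _; rewrite normrN normr1 mul1r.
Qed.

Lemma mxnorm_seminorm : seminorm N.
Proof.
split=> [|M]; first exact: mxnormD.
by apply/le_anti; rewrite mxnormN_le -{1}(opprK M) mxnormN_le.
Qed.

Lemma mxnormM M1 M2 : N (M1 * M2) <= N M1 * N M2.
Proof.
apply: opmx_norm_le => [|x]; first by rewrite mulr_ge0.
rewrite (mxapp_repM pi_rep); apply: le_trans (piP _ _) _.
by rewrite -mulrA ler_wpM2l //; exact: piP.
Qed.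

Lemma mxnorm_star M : N (mxstar M) <= N M.
Proof.
apply: opmx_norm_le => // x; set y := mxapp _ x.
have [y0|yn] := eqVneq (sumnorm y) 0; first by rewrite y0 mulr_ge0 ?sumnorm_ge0.
have yp : 0 < sumnorm y by rewrite lt_neqAle eq_sym yn sumnorm_ge0.
rewrite -(ler_pM2r yp) -expr2 sumnorm2.
have -> : \sum_i hnorm (y i) ^+ 2 = \sum_i re_inner (x i) (mxapp (map_mx pi M) y i).
  rewrite -(mxapp_adj (re_inner_psd H0)); last first.
    by move=> u h k; rewrite /re_inner (rep_adj pi_rep) starK.
  by apply: eq_bigr => i _; rewrite hnorm2.
have -> : \sum_i re_inner (x i) (mxapp (map_mx pi M) y i) =
    complex.Re (sum_dot H0 n x (mxapp (map_mx pi M) y)) by rewrite raddf_sum.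
apply: le_trans (ler_norm _) _; apply: le_trans (Re_form_CS _ _ _) _.
rewrite -!sumnormE mulrC mulrAC; apply: ler_wpM2r; first exact: sumnorm_ge0.
exact: piP.
Qed.

Lemma mxnorm_eq0 M : N M = 0 -> M = 0.
Proof.
move=> M0; apply/matrixP => i j; rewrite mxE; apply/cnorm_eq0/le_anti.
by rewrite cnorm_ge0 andbT -M0 mxnorm_entry.
Qed.

Lemma mxnorm_complete : ncomplete N.
Proof.
move=> u uC.
have /choice[L uL] : forall ij : 'I_n * 'I_n, exists l,
    ncvg (@cnorm R C) (fun k => u k ij.1 ij.2) l.
  move=> [i j]; apply: cnorm_complete => e /uC[n0 hn0]; exists n0 => a b a0 b0.
  apply: le_lt_trans (hn0 _ _ a0 b0); have := mxnorm_entry (u a - u b) i j.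
  by rewrite !mxE.
exists (\matrix_(i, j) L (i, j)) => e e0.
have d0 : 0 < e / (n * n).+1%:R by rewrite divr_gt0.
have /choice[K hK] : forall ij : 'I_n * 'I_n, exists k0 : nat, forall k, (k0 <= k)%N ->
    cnorm (u k ij.1 ij.2 - L ij) < e / (n * n).+1%:R.
  by move=> ij; exact: uL.
exists (\max_(ij : 'I_n * 'I_n) K ij) => k kK.
apply: le_lt_trans (mxnorm_le_entries _) _.
apply: (@le_lt_trans _ _ (\sum_(i < n) \sum_(j < n) e / (n * n).+1%:R)).
  apply: ler_sum => i _; apply: ler_sum => j _; rewrite !mxE; apply: ltW.
  apply: (hK (i, j)); apply: leq_trans kK; exact: (leq_bigmax (i, j)).
rewrite !sumr_const !card_ord -mulrnA -[_ *+ (n * n)]mulr_natr mulrAC ltr_pdivrMr //.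
by rewrite ltr_pM2l // ltr_nat.
Qed.

Let g : 'M[C]_n := ((2^-1 : R)%:C%:A)%:M.

Let gE M : g * M = map_mx ( *:%R (2^-1 : R)%:C) M.
Proof.
by rewrite -[LHS]/(g *m M) mul_scalar_mx; apply/matrixP => i j; rewrite !mxE mulr_algl.
Qed.

Lemma mx_half_double M :
  map_mx ( *:%R (2^-1 : R)%:C) M + map_mx ( *:%R (2^-1 : R)%:C) M = M.
Proof. by apply/matrixP => i j; rewrite !mxE half_double. Qed.

(** Under this norm the matrices form a Banach algebra with continuous involution, which is all that
    the square root of the ring version requires. *)
Lemma mx_positive_functional (phi : 'M[C]_n -> R) :
  (forall M1 M2, phi (M1 + M2) = phi M1 + phi M2) ->
  (forall M, 0 <= phi (mxstar M * M)) ->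
  forall M, N M <= 1 -> phi (mxstar M * M) <= phi 1.
Proof.
move=> phiD phi0 M NM.
apply: (@positive_functional_le R _ N g _ _ _ _ _ _ _ mxstar 1) => //.
- exact: mxnorm_seminorm.
- exact: mxnorm_eq0.
- exact: mxnormM.
- exact: mxnorm_complete.
- by rewrite -[LHS](mulr1) mulrDl gE mx_half_double.
- move=> A; rewrite gE; apply/matrixP => i j.
  rewrite -[A * g]/(A *m g) !mxE (bigD1 j) //= big1 ?addr0.
    by rewrite mxE eqxx mulr1n mulr_algr.
  by move=> k kj; rewrite mxE (negPf kj) mulr0n mulr0.
- move=> A; apply/le_anti/andP; split.
    rewrite gE; apply: le_trans (mxnormZ_le _ _) _.
    by rewrite Re_norm_real ger0_norm ?invr_ge0 // mulrC.
  rewrite -{1}(mx_half_double A) -gE.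
  by have := mxnormD (g * A) (g * A); lra.
- exact: mxstarK.
- exact: mxstarD.
- exact: mxstarM.
- apply/matrixP => i j; rewrite mxstarE !mxE eq_sym.
  by case: eqP => _; rewrite ?mulr1n ?mulr0n ?star0 // starZR star1.
- by move=> A; rewrite mul1r mxnorm_star.
apply: le_trans (mxnormM _ _) _; rewrite mulr_ile1 //.
exact: le_trans (mxnorm_star _) _.
Qed.

(** The functional B ↦ Σ_i b((Bx)_i, x_i) is positive on matrices. In this way the single
    representation [pi] controls every other [rho] at all matrix sizes, and with respect to every
    form that [rho] respects. *)
Lemma mx_rep_form_le (H : hilbertType R) (rho : C -> H -> H) (b : H -> H -> R) :
  star_rep rho -> psd_form b ->
  (forall x h k, b (rho (star x) h) k = b h (rho x k)) ->
  forall M (c : R) x, N M <= c ->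
    \sum_i b (mxapp (map_mx rho M) x i) (mxapp (map_mx rho M) x i) <=
    c ^+ 2 * \sum_i b (rho 1 (x i)) (rho 1 (x i)).
Proof.
move=> rho_rep bP badj M c x NM.
have key A : N A <= 1 ->
    \sum_i b (mxapp (map_mx rho A) x i) (mxapp (map_mx rho A) x i) <=
    \sum_i b (rho 1 (x i)) (rho 1 (x i)).
  move=> NA.
  pose phi B := \sum_i b (mxapp (map_mx rho B) x i) (x i).
  have phiE B : phi (mxstar B * B) =
      \sum_i b (mxapp (map_mx rho B) x i) (mxapp (map_mx rho B) x i).
    by rewrite /phi (mxapp_repM rho_rep) (mxapp_adj bP badj).
  have <- : phi 1 = \sum_i b (rho 1 (x i)) (rho 1 (x i)).
    apply: eq_bigr => i _; rewrite -badj star1 (rep1 rho_rep).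
    congr (b _ _); rewrite /mxapp (bigD1 i) //= big1 ?addr0 => [|j ji].
      by rewrite !mxE eqxx.
    by rewrite !mxE eq_sym (negPf ji) (rep0 rho_rep).
  rewrite -phiE; apply: mx_positive_functional => //.
    move=> B1 B2; rewrite /phi (mxapp_repD rho_rep) -big_split; apply: eq_bigr => i _.
    by rewrite !fctE (psdDl bP).
  by move=> B; rewrite phiE sumr_ge0 // => i _; case: bP.
have c0 : 0 <= c := le_trans (N_ge0 M) NM.
have [cz|cn] := eqVneq c 0.
  have -> : M = 0 by apply/mxnorm_eq0/le_anti; rewrite N_ge0 -cz NM.
  rewrite cz expr0n mul0r big1 // => i _; rewrite /mxapp big1 ?(psd0l bP) // => j _.
  by rewrite !mxE (rep0 rho_rep).
have cp : 0 < c by rewrite lt_neqAle eq_sym cn.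
have := key (map_mx ( *:%R (c^-1)%:C) M).
have -> : \sum_i b (mxapp (map_mx rho (map_mx ( *:%R (c^-1)%:C) M)) x i)
   (mxapp (map_mx rho (map_mx ( *:%R (c^-1)%:C) M)) x i) =
   c ^- 2 * \sum_i b (mxapp (map_mx rho M) x i) (mxapp (map_mx rho M) x i).
  rewrite mulr_sumr; apply: eq_bigr => i _; rewrite (mxapp_repZ rho_rep) !fctE.
  by rewrite (psdZ bP) exprVn.
rewrite mulrC ler_pdivrMr ?exprn_gt0 // mulrC; apply.
apply: le_trans (mxnormZ_le _ _) _.
by rewrite Re_norm_real ger0_norm ?invr_ge0 // mulrC ler_pdivrMr // mul1r.
Qed.

End MatrixReps.

(** * The regular representation *)

Section L2ZNorm.
Variables (R : realType) (H0 : hilbertType R).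
Implicit Types (f g : l2Z H0).
Local Notation nrm := (@hnorm R H0).

Lemma l2Z_ext f g : (forall m, f m = g m) -> f = g.
Proof. by move=> fg; apply/val_inj/funext. Qed.

Lemma l2ZP (a : R[i]) f g m : (a *: f + g) m = a *: f m + g m.
Proof. by []. Qed.

Lemma hnorm_l2Z f : hnorm f ^+ 2 = limn (series (sqnorms f)).
Proof. exact: (@dnorm_l2Z R H0 f). Qed.

Lemma l2Z_partial_le f k : series (sqnorms f) k <= hnorm f ^+ 2.
Proof. by rewrite hnorm_l2Z l2Z_partial. Qed.

Lemma l2Z_norm_le f (c : R) : 0 <= c ->
  (forall k, series (sqnorms f) k <= c ^+ 2) -> hnorm f <= c.
Proof.
move=> c0 fc; rewrite -ler_sqr ?nnegrE ?dnorm_pos // hnorm_l2Z.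
by apply: limr_le; [exact: l2Z_cvg | apply: nearW => k; exact: fc].
Qed.

Lemma seriesS (u : nat -> R) k : series u k.+1 = series u k + u k.
Proof. by rewrite /series /= big_nat_recr. Qed.

Lemma series0 (u : nat -> R) : series u 0%N = 0.
Proof. by rewrite /series /= big_geq. Qed.

Lemma l2Z_window f k : \sum_(p < k) nrm (f (- p%:Z)) ^+ 2 <= hnorm f ^+ 2.
Proof.
apply: le_trans (l2Z_partial_le f k); elim: k => [|k IHk]; first by rewrite big_ord0 series0.
(* Term j of [sqnorms] pairs the positions j and -j-1, so [series] up to j misses position 0 when j
   = 0. The extra summand at position j corrects this offset. *)
have key j : \sum_(p < j.+1) nrm (f (- p%:Z)) ^+ 2 <=
    series (sqnorms f) j + nrm (f j%:Z) ^+ 2.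
  elim: j => [|j IHj]; first by rewrite big_ord_recr big_ord0 /= oppr0 series0.
  rewrite big_ord_recr seriesS {2}/sqnorms -[(- j.+1%:Z)]NegzE /=.
  by have := sqr_ge0 (nrm (f j.+1%:Z)); lra.
apply: le_trans (key k) _; rewrite seriesS lerD2l /sqnorms lerDl; exact: sqr_ge0.
Qed.

(** Entry [p] sits at position -p, so that U^n brings entry p + n to entry p, just as T^n acts on a
    sequence (T^p h)_p. *)
Definition window_fun k (x : 'I_k -> H0) : int -> H0 :=
  fun m => if m <= 0 then oapp x 0 (insub `|m|%N) else 0.

Lemma window_partial k (x : 'I_k -> H0) j :
  series (sqnorms (window_fun x)) j <= \sum_(p < k) nrm (x p) ^+ 2.
Proof.
have key i : series (sqnorms (window_fun x)) i.+1 =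
    \sum_(q < i.+2) nrm (oapp x 0 (insub (q : nat))) ^+ 2.
  elim: i => [|i IHi].
    rewrite seriesS series0 add0r !big_ord_recr big_ord0 /= add0r /sqnorms.
    by rewrite /window_fun.
  rewrite seriesS IHi [RHS]big_ord_recr /=; congr (_ + _).
  by rewrite /sqnorms /window_fun /= hnorm0 expr0n add0r.
apply: (@le_trans _ _ (series (sqnorms (window_fun x)) j.+1)).
  by rewrite seriesS lerDl sqnorms_ge0.
rewrite key.
have le i : \sum_(q < i) nrm (oapp x 0 (insub (q : nat))) ^+ 2 <= \sum_(p < k) nrm (x p) ^+ 2.
  pose F (q : nat) := nrm (oapp x 0 (insub q)) ^+ 2.
  have -> : \sum_(p < k) nrm (x p) ^+ 2 = \sum_(p < k) F p.
    by apply: eq_bigr => p _; rewrite /F valK.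
  rewrite -/F -(big_mkord xpredT F) -(big_mkord xpredT F).
  have [ik|ki] := leqP i k.
    by rewrite (big_cat_nat (leq0n i) ik) //= lerDl sumr_ge0 // => *; exact: sqr_ge0.
  rewrite (big_cat_nat (leq0n k) (ltnW ki)) //= [X in _ + X]big_nat_cond [X in _ + X]big1 ?addr0 //.
  move=> q; rewrite andbT => /andP[kq _]; rewrite /F insubF /= ?hnorm0 ?expr0n //.
  by rewrite ltnNge kq.
exact: le.
Qed.

Lemma window_summable k (x : 'I_k -> H0) : window_fun x \in square_summable (H0 := H0).
Proof.
apply/square_summableP; apply: nondecreasing_is_cvgn.
  by apply: nondecreasing_series => i _ _; exact: sqnorms_ge0.
by exists (\sum_(p < k) nrm (x p) ^+ 2) => _ [j _ <-]; exact: window_partial.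
Qed.

Definition window k (x : 'I_k -> H0) : l2Z H0 := L2Z (window_summable x).

Lemma window_norm k (x : 'I_k -> H0) : hnorm (window x) <= sumnorm x.
Proof.
apply: l2Z_norm_le => [|j]; first exact: sumnorm_ge0.
by rewrite sumnorm2 window_partial.
Qed.

End L2ZNorm.

(** * The bilateral shift is unitary *)

Section ShiftTheory.
Variables (R : realType) (H0 : hilbertType R).
Implicit Types (f g : l2Z H0).
Local Notation nrm := (@hnorm R H0).

(** The partial sum covers the positions -n, ..., n-1; the shift brings in position -n-1 and pushes
    out position n-1. *)
Lemma bishift_partial f n : series (sqnorms (bishift f)) n + nrm (f (n%:Z - 1)) ^+ 2 =
  series (sqnorms f) n + nrm (f (Negz n)) ^+ 2.
Proof.
elim: n => [|n IHn]; first by rewrite !series0.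
rewrite !seriesS [sqnorms f n]/sqnorms [sqnorms _ n]/sqnorms /=.
rewrite (_ : n.+1%:Z - 1 = n%:Z); last by lia.
by rewrite (_ : Negz n - 1 = Negz n.+1); [move: IHn; rewrite /=; lra | lia].
Qed.

Lemma bishift_inv_partial f n :
  series (sqnorms (bishift_inv f)) n + nrm (f (- n%:Z)) ^+ 2 =
  series (sqnorms f) n + nrm (f n%:Z) ^+ 2.
Proof.
elim: n => [|n IHn]; first by rewrite !series0.
rewrite !seriesS [sqnorms f n]/sqnorms [sqnorms _ n]/sqnorms /=.
rewrite (_ : n%:Z + 1 = n.+1%:Z); last by lia.
rewrite (_ : - n.+1%:Z = Negz n) ?NegzE //.
by rewrite (_ : - n.+1%:Z + 1 = - n%:Z); [move: IHn; rewrite /=; lra | lia].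
Qed.

Lemma bishift_le f : hnorm (bishift f) <= hnorm f.
Proof.
apply: l2Z_norm_le => [|k]; first exact: dnorm_pos.
apply: le_trans (l2Z_partial_le f k.+1); have := bishift_partial f k.
by rewrite seriesS /sqnorms; have := sqr_ge0 (nrm (f (k%:Z - 1)));
   have := sqr_ge0 (nrm (f k%:Z)); lra.
Qed.

Lemma bishift_inv_le f : hnorm (bishift_inv f) <= hnorm f.
Proof.
apply: l2Z_norm_le => [|k]; first exact: dnorm_pos.
apply: le_trans (l2Z_partial_le f k.+1); have := bishift_inv_partial f k.
by rewrite seriesS /sqnorms; have := sqr_ge0 (nrm (f (- k%:Z)));
   have := sqr_ge0 (nrm (f (Negz k))); lra.
Qed.

Lemma bishift_norm f : hnorm (bishift f) = hnorm f.
Proof. by apply/le_anti; rewrite bishift_le -{1}(bishiftK f) bishift_inv_le. Qed.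

Lemma bishift_linear (a : R[i]) f g :
  bishift (a *: f + g) = a *: bishift f + bishift g.
Proof. by apply/val_inj/funext. Qed.

Lemma bishift_inv_linear (a : R[i]) f g :
  bishift_inv (a *: f + g) = a *: bishift_inv f + bishift_inv g.
Proof. by apply/val_inj/funext. Qed.

Lemma bishift_bounded : bounded_op (@bishift R H0).
Proof.
by split; [exact: bishift_linear | exists 1 => f; rewrite mul1r bishift_le].
Qed.

Lemma bishift_inv_bounded : bounded_op (@bishift_inv R H0).
Proof.
by split; [exact: bishift_inv_linear | exists 1 => f; rewrite mul1r bishift_inv_le].
Qed.

Lemma bishiftX_bounded n : bounded_op (@bishiftX R H0 n).
Proof.
by case: n => k; apply: iter_bounded; [exact: bishift_bounded | exact: bishift_inv_bounded].
Qed.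

Lemma iter_bishiftE k f m : iter k (@bishift R H0) f m = f (m - k%:Z).
Proof.
elim: k m => [|k IHk] m /=; first by rewrite subr0.
by rewrite IHk; congr (f _); lia.
Qed.

Lemma iter_bishift_invE k f m : iter k (@bishift_inv R H0) f m = f (m + k%:Z).
Proof.
elim: k m => [|k IHk] m /=; first by rewrite addr0.
by rewrite IHk; congr (f _); lia.
Qed.

Lemma bishiftXE n f m : bishiftX n f m = f (m - n).
Proof.
by case: n => k; rewrite /bishiftX ?iter_bishiftE ?iter_bishift_invE //;
   congr (f _); lia.
Qed.

Lemma bishiftXD n k f : bishiftX n (bishiftX k f) = bishiftX (n + k) f.
Proof. by apply/val_inj/funext => m; rewrite /= !bishiftXE; congr (f _); lia. Qed.

Lemma bishiftX_norm n f : hnorm (bishiftX n f) = hnorm f.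
Proof.
case: n => k; first by elim: k => //= k IHk; rewrite bishift_norm.
rewrite /bishiftX; elim: k.+1 => //= j IHj.
by rewrite -[in RHS]IHj -[in RHS](bishift_invK (iter j _ f)) bishift_norm.
Qed.

Lemma bishiftX_adj n f g : inner (bishiftX n f) g = inner f (bishiftX (- n) g).
Proof.
have {1}-> : g = bishiftX n (bishiftX (- n) g).
  by apply/val_inj/funext => m; rewrite /= !bishiftXE; congr (g _); lia.
apply: (@dnorm_isometry_form R (l2Z H0) (l2Z H0) inner inner (@bishiftX R H0 n) (fun=> True)) => //.
  by have [] := bishiftX_bounded n.
by move=> x _; exact: bishiftX_norm.
Qed.

End ShiftTheory.

(** * Limits and adjoints of operators *)

Section OperatorLimits.
Variables (R : realType) (H : hilbertType R).
Implicit Types (S T : H -> H).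
Local Notation nH := (@hnorm R H).

(** [opnorm] is a [sup], which is informative only once boundedness is known; this pointwise form
    composes without such side conditions and agrees with it on bounded operators. *)
Definition op_close (e : R) S T : Prop := forall h, nH (S h - T h) <= e * nH h.

Lemma op_close_sym e S T : op_close e S T -> op_close e T S.
Proof. by move=> st h; rewrite /hnorm (seminormC (dnorm_seminorm inner)); exact: st. Qed.

Lemma op_close_trans e d S T W : op_close e S T -> op_close d T W -> op_close (e + d) S W.
Proof.
move=> st tw h; have := seminorm_dist (dnorm_seminorm inner) (S h) (T h) (W h).
have := st h; have := tw h; rewrite /hnorm; lra.
Qed.

Lemma op_close_opnorm e S T : bounded_op S -> bounded_op T -> 0 <= e ->
  op_close e S T <-> opnorm (S \- T) <= e.
Proof.
move=> bS bT e0; split=> [st|le h]; first exact: opnorm_le.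
apply: le_trans (opnormP h (bounded_opB bS bT)) _.
by rewrite ler_wpM2r ?dnorm_pos.
Qed.

Lemma op_close_bounded S T c h : op_close c S T -> nH (S h) <= nH (T h) + c * nH h.
Proof.
move=> st; have := seminorm_le_dist (dnorm_seminorm inner) (S h) (T h).
by have := st h; rewrite /hnorm; lra.
Qed.

Lemma op_limit (T : nat -> H -> H) : (forall n, bounded_op (T n)) ->
  (forall e, 0 < e -> exists n0 : nat, forall m n, (n0 <= m)%N -> (n0 <= n)%N ->
    op_close e (T m) (T n)) ->
  exists2 L, bounded_op L &
    forall e, 0 < e -> exists n0 : nat, forall n, (n0 <= n)%N -> op_close e (T n) L.
Proof.
move=> bT TC; have sn := dnorm_seminorm (@inner R H).
have /choice[L TL] : forall h, exists l, ncvg nH (fun n => T n h) l.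
  move=> h; apply: hilbert_complete => e e0.
  have d0 : 0 < e / (nH h + 1) by rewrite divr_gt0 // ltr_wpDl ?dnorm_pos.
  have [n0 hn0] := TC _ d0; exists n0 => m n m0 n0'.
  apply: le_lt_trans (hn0 m n m0 n0' h) _.
  rewrite mulrAC ltr_pdivrMr; last by rewrite ltr_wpDl ?dnorm_pos.
  by rewrite ltr_pM2l // ltrDl.
have close e : 0 < e -> exists n0 : nat, forall n, (n0 <= n)%N -> op_close e (T n) L.
  move=> e0; have [n0 hn0] := TC _ e0; exists n0 => n hn h.
  by apply: (ncvg_dist_le sn (TL h)); exists n0 => m hm; exact: hn0.
exists L => //; split=> [a x y|].
  apply: (ncvg_unique sn (@dnorm_eq0P _ _ _) (TL _)).
  rewrite (_ : (fun n => _) = fun n => a *: T n x + T n y); last first.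
    by apply/funext => n; have [h _] := bT n; rewrite h.
  apply: ncvgD => //; apply: (ncvg_lip (F := fun z => a *: z) (c := complex.Re `|a|) _ _ (TL x)).
    exact: Re_norm_ge0.
  by move=> u v; rewrite -scalerBr dnormZ.
have [n0 hn0] := close 1 ltr01.
exists (opnorm (T n0) + 1) => x; rewrite mulrDl.
apply: le_trans (op_close_bounded _ (op_close_sym (hn0 _ (leqnn _)))) _.
by rewrite lerD2r opnormP.
Qed.

Lemma adjoint_unique S1 S2 T : adjoint S1 T -> adjoint S2 T -> S1 = S2.
Proof.
move=> a1 a2; apply/funext => h; apply/subr0_eq/(dnorm_eq0P (form := inner)).
apply/eqP; rewrite -sqrf_eq0 dnorm2 linearBr /= -a1 -a2 subrr //.
Qed.

Lemma adjoint_sym S T : adjoint S T -> adjoint T S.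
Proof. by move=> a x y; rewrite form_herm -a -form_herm. Qed.

Lemma adjointD S1 S2 T1 T2 : adjoint S1 T1 -> adjoint S2 T2 ->
  adjoint (fun h => S1 h + S2 h) (fun h => T1 h + T2 h).
Proof. by move=> a1 a2 x y; rewrite linearDl linearDr /= a1 a2. Qed.

Lemma adjoint_comb (a : R[i]) S1 S2 T1 T2 : adjoint S1 T1 -> adjoint S2 T2 ->
  adjoint (fun h => Num.conj a *: S1 h + S2 h) (fun h => a *: T1 h + T2 h).
Proof.
move=> a1 a2 x y.
by rewrite linearPl /= linearDr /= linearZr_LR /= a1 a2 conjCK.
Qed.

Lemma adjointB S1 S2 T1 T2 : adjoint S1 T1 -> adjoint S2 T2 ->
  adjoint (S1 \- S2) (T1 \- T2).
Proof. by move=> a1 a2 x y; rewrite /= linearBl linearBr /= a1 a2. Qed.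

Lemma adjoint0 : adjoint (fun=> 0 : H) (fun=> 0 : H).
Proof. by move=> x y; rewrite linear0l linear0r. Qed.

Lemma adjoint_le S T (c : R) : 0 <= c -> adjoint S T -> (forall h, nH (T h) <= c * nH h) ->
  forall h, nH (S h) <= c * nH h.
Proof.
move=> c0 a Tc h; have [->|n0] := eqVneq (nH (S h)) 0; first by rewrite mulr_ge0 ?dnorm_pos.
have np : 0 < nH (S h) by rewrite lt_neqAle eq_sym n0 dnorm_pos.
rewrite -(ler_pM2r np) -expr2 /hnorm dnorm2 -a.
apply: le_trans (ler_norm _) _; apply: le_trans (Re_form_CS _ _ _) _.
by rewrite mulrAC ler_wpM2r ?dnorm_pos //; exact: Tc.
Qed.

(** The difference <T'x, y> - <x, S'y> is split through index n into two terms; the constant [c]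
    makes each of them at most e/2. *)
Lemma adjoint_limit (S T : nat -> H -> H) S' T' :
  (forall e, 0 < e -> exists n0 : nat, forall n, (n0 <= n)%N -> op_close e (T n) T') ->
  (forall e, 0 < e -> exists n0 : nat, forall n, (n0 <= n)%N -> op_close e (S n) S') ->
  (forall n, adjoint (S n) (T n)) -> adjoint S' T'.
Proof.
move=> TT SS a x y; apply/subr0_eq.
suff small : forall e, 0 < e ->
    `|complex.Re (inner (T' x) y - inner x (S' y))| <= e /\
    `|complex.Im (inner (T' x) y - inner x (S' y))| <= e.
  case: (_ - _) small => p q /= small.
  have p0 : p = 0.
    by apply/eqP; rewrite -normr_le0; apply/ler_addgt0Pr => e /small[]; rewrite add0r.
  have q0 : q = 0.
    by apply/eqP; rewrite -normr_le0; apply/ler_addgt0Pr => e /small[]; rewrite add0r.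
  by rewrite p0 q0.
move=> e e0; pose c := 2 * (nH x * nH y + 1).
have c0 : 0 < c by rewrite mulr_gt0 // ltr_wpDl // mulr_ge0 ?dnorm_pos.
have d0 : 0 < e / c by rewrite divr_gt0.
have [n1 h1] := TT _ d0; have [n2 h2] := SS _ d0.
have {}h1 := h1 _ (leq_maxl n1 n2) x; have {}h2 := h2 _ (leq_maxr n1 n2) y.
set n := maxn n1 n2 in h1 h2.
have -> : inner (T' x) y - inner x (S' y) =
    inner x (S n y - S' y) - inner (T n x - T' x) y.
  have -> : inner x (S n y - S' y) = inner x (S n y) - inner x (S' y) by rewrite linearBr.
  have -> : inner (T n x - T' x) y = inner (T n x) y - inner (T' x) y by rewrite linearBl.
  by rewrite (a n x y) opprB [RHS]addrC addrA subrK.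
have k1 : nH x * nH (S n y - S' y) <= e / c * (nH x * nH y).
  by rewrite mulrCA ler_wpM2l ?dnorm_pos.
have k2 : nH (T n x - T' x) * nH y <= e / c * (nH x * nH y).
  by rewrite mulrA ler_wpM2r ?dnorm_pos.
have k3 : e / c * (nH x * nH y) <= e / 2.
  have Kc : nH x * nH y <= c / 2 by rewrite /c; lra.
  by apply: le_trans (ler_wpM2l (ltW d0) Kc) _; rewrite mulrA divfK ?gt_eqF.
split; rewrite raddfB /=; apply: le_trans (ler_normB _ _) _.
  have := Re_form_CS inner x (S n y - S' y); have := Re_form_CS inner (T n x - T' x) y.
  rewrite /hnorm in k1 k2 k3; lra.
have := Im_form_CS inner x (S n y - S' y); have := Im_form_CS inner (T n x - T' x) y.
rewrite /hnorm in k1 k2 k3; lra.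
Qed.

Lemma eq_of_small (h x y : H) :
  (forall e, 0 < e -> nH (x - y) <= 2 * (e * nH h)) -> x = y.
Proof.
move=> le; apply/subr0_eq/(dnorm_eq0P (form := inner))/le_anti; rewrite dnorm_pos andbT.
apply/ler_addgt0Pr => e e0; rewrite add0r.
have n0 : 0 <= nH h := dnorm_pos inner h.
have h1 : 0 < 2 * (nH h + 1) by rewrite mulr_gt0 // ltr_wpDl.
have d0 : 0 < e / (2 * (nH h + 1)) by rewrite divr_gt0.
apply: le_trans (le _ d0) _.
have := @divfK R (2 * (nH h + 1)) (lt0r_neq0 h1) e.
by set d := e / _ in d0 *; lra.
Qed.

Lemma op_close_eq S1 S2 :
  (forall e, 0 < e -> exists T, op_close e S1 T /\ op_close e S2 T) -> S1 = S2.
Proof.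
move=> appr; apply/funext => h; apply: (eq_of_small (h := h)) => e e0.
have [T [c1 c2]] := appr e e0.
by apply: le_trans (op_close_trans c1 (op_close_sym c2) h) _; rewrite mulrDl; lra.
Qed.

(** The unit of the crossed product may be a proper projection, so the unit law is checked on
    Laurent polynomials and passed to limits with this lemma. *)
Lemma op_close_unit E T : bounded_op E -> (forall h, nH (E h) <= nH h) ->
  (forall e, 0 < e -> exists L, [/\ op_close e T L, E \o L = L & L \o E = L]) ->
  E \o T = T /\ T \o E = T.
Proof.
move=> bE E_le appr; have sn := dnorm_seminorm (@inner R H).
split; apply/funext => h /=; apply: (eq_of_small (h := h)) => e e0;
  have [L [cl EL LE]] := appr e e0.
- have EL' : E (L h) = L h by rewrite -[in RHS]EL.
  have c1 := cl h; have := E_le (T h - L h); rewrite (opB _ _ bE) EL'.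
  have := seminorm_dist sn (E (T h)) (L h) (T h); rewrite (seminormC sn (L h)).
  by move: c1; rewrite /hnorm; lra.
have LE' : L (E h) = L h by rewrite -[in RHS]LE.
have c1 := cl h; have c2 := cl (E h); rewrite LE' in c2.
have := seminorm_dist sn (T (E h)) (L h) (T h); rewrite (seminormC sn (L h)).
by have := ler_wpM2l (ltW e0) (E_le h); move: c1 c2; rewrite /hnorm; lra.
Qed.

End OperatorLimits.

(** * Integer powers of [alpha] *)

Section AlphaPowers.
Variables (R : realType) (C : cstarType R) (alpha : C -> C).
Hypothesis alpha_aut : star_automorphism alpha.
Implicit Types (x y : C) (m : int).

Definition star_hom (f : C -> C) : Prop :=
  [/\ (forall (a : R[i]) x y, f (a *: x + y) = a *: f x + f y),
      (forall x y, f (x * y) = f x * f y) & forall x, f (star x) = star (f x)].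

Lemma alpha_invK x : alpha_inv alpha (alpha x) = x.
Proof.
have [bij _ _ _] := alpha_aut; apply: (bij_inj bij).
by rewrite /alpha_inv; case: xgetP => [z _ //|/(_ x)]; case.
Qed.

Lemma alphaK x : alpha (alpha_inv alpha x) = x.
Proof.
have [[f fK Kf] _ _ _] := alpha_aut.
by rewrite /alpha_inv; case: xgetP => [z _ //|/(_ (f x))]; case; rewrite /= Kf.
Qed.

Lemma alpha_hom : star_hom alpha. Proof. by case: alpha_aut. Qed.

Lemma alpha_inv_hom : star_hom (alpha_inv alpha).
Proof.
have [bij lin mul st] := alpha_aut.
split=> *; apply: (bij_inj bij); by rewrite ?lin ?mul ?st !alphaK.
Qed.

Lemma star_hom_iter f k : star_hom f -> star_hom (iter k f).
Proof.
move=> [fl fm fs]; elim: k => [|k [IHl IHm IHs]] //.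
by split=> * /=; rewrite ?IHl ?IHm ?IHs ?fl ?fm ?fs.
Qed.

Lemma alphaX_hom m : star_hom (alphaX alpha m).
Proof. by case: m => k; apply: star_hom_iter; [exact: alpha_hom | exact: alpha_inv_hom]. Qed.

Lemma alphaXS m x : alphaX alpha (m + 1) x = alphaX alpha m (alpha x).
Proof.
case: m => [k|[|k]].
- by rewrite (_ : k%:Z + 1 = k.+1%:Z); [rewrite /alphaX iterSr | lia].
- by rewrite (_ : Negz 0 + 1 = 0%N%:Z) //= alpha_invK.
rewrite (_ : Negz k.+1 + 1 = Negz k); last by lia.
by rewrite /alphaX [in RHS]iterSr alpha_invK.
Qed.

Lemma alphaXP m x : alphaX alpha (m - 1) x = alphaX alpha m (alpha_inv alpha x).
Proof. by rewrite -{1}(alphaK x) -alphaXS subrK. Qed.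

Lemma alphaXD m k x : alphaX alpha (m + k) x = alphaX alpha m (alphaX alpha k x).
Proof.
case: k => k.
  elim: k x => [|k IHk] x; first by rewrite addr0.
  rewrite (_ : m + k.+1%:Z = m + k%:Z + 1); last by lia.
  by rewrite alphaXS IHk /= -iterSr.
elim: k x => [|k IHk] x; first by rewrite (_ : m + Negz 0 = m - 1) ?alphaXP //; lia.
rewrite (_ : m + Negz k.+1 = m + Negz k - 1); last by lia.
by rewrite alphaXP IHk /alphaX -iterSr.
Qed.

Lemma alphaX_iter n x : alphaX alpha n%:Z x = iter n alpha x. Proof. by []. Qed.

Section HomTheory.
Variable f : C -> C.
Hypothesis f_hom : star_hom f.

Lemma star_hom0 : f 0 = 0.
Proof. by case: f_hom => l _ _; have := l (-1) 0 0; rewrite !scaleN1r !addNr. Qed.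

End HomTheory.

(** Multiplicativity and surjectivity force the image of 1 to be a unit, hence 1. *)
Lemma alphaX1 m : alphaX alpha m 1 = 1.
Proof.
have [_ mul _] := alphaX_hom m.
have surj y : alphaX alpha m (alphaX alpha (- m) y) = y by rewrite -alphaXD subrr.
by rewrite -[LHS]mulr1 -{2}(surj 1) -mul mul1r surj.
Qed.

Lemma rep_comp_hom (H : hilbertType R) (rho : C -> H -> H) f :
  star_rep rho -> star_hom f -> star_rep (fun x => rho (f x)).
Proof.
move=> [[rb rl rm] rs] [fl fm fs]; split; first split=> [x|a x y h|x y].
- exact: rb.
- by rewrite fl rl.
- by rewrite fm rm.
by move=> x; rewrite fs; exact: rs.
Qed.

End AlphaPowers.

(** * The reduced crossed product is an operator C*-algebra *)

Section CrossedProduct.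
Variables (R : realType) (C : cstarType R) (alpha : C -> C).
Hypothesis alpha_aut : star_automorphism alpha.
Variables (H0 : hilbertType R) (pi : C -> H0 -> H0).
Hypothesis pi_rep : star_rep pi.
Implicit Types (x y : C) (f g : l2Z H0) (m n : int).
Local Notation aX := (alphaX alpha).
Local Notation ph := (pihat alpha pi).
Local Notation U := (@bishiftX R H0).

Let pi_aX m : star_rep (fun x => pi (aX m x)) :=
  rep_comp_hom pi_rep (alphaX_hom alpha_aut m).

Lemma pihat_sqnorms x f k : sqnorms (fun m => pi (aX m x) (f m)) k <=
  cnorm x ^+ 2 * sqnorms f k.
Proof.
rewrite /sqnorms mulrDr -!exprMn.
by apply: lerD; rewrite ler_sqr ?nnegrE ?mulr_ge0 ?dnorm_pos ?cnorm_ge0 //;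
   exact: (rep_contractive (pi_aX _)).
Qed.

Lemma pihat_summable x f : (fun m => pi (aX m x) (f m)) \in square_summable (H0 := H0).
Proof.
apply/square_summableP.
have cv : cvgn (series (cnorm x ^+ 2 *: sqnorms f)).
  by apply: is_cvg_seriesZ; exact: l2Z_cvg.
apply: series_le_cvg cv => k; first exact: sqnorms_ge0.
  by rewrite mulr_ge0 ?sqr_ge0 ?sqnorms_ge0.
exact: pihat_sqnorms.
Qed.

Lemma pihatE x f m : ph x f m = pi (aX m x) (f m).
Proof.
have E := insubdK (0 : l2Z H0) (pihat_summable x f).
by rewrite -[LHS]/(val (ph x f) m) /pihat E.
Qed.

Local Opaque pihat.

Lemma pihat_le x f : hnorm (ph x f) <= cnorm x * hnorm f.
Proof.
apply: l2Z_norm_le => [|k]; first by rewrite mulr_ge0 ?cnorm_ge0 ?dnorm_pos.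
apply: (@le_trans _ _ (cnorm x ^+ 2 * series (sqnorms f) k)).
  rewrite /series /= mulr_sumr; apply: ler_sum => i _; apply: le_trans (pihat_sqnorms _ _ _).
  by rewrite /sqnorms !pihatE.
by rewrite exprMn ler_wpM2l ?sqr_ge0 ?l2Z_partial_le.
Qed.

Lemma pihat_star_rep : star_rep ph.
Proof.
split; first split=> [x|a x y f|x y].
- split=> [a f g|]; last by exists (cnorm x) => f; exact: pihat_le.
  apply: l2Z_ext => m; rewrite l2ZP; apply: etrans (pihatE _ _ _) _; rewrite l2ZP.
  apply: etrans (rep_linear (pi_aX m) x a (f m) (g m)) _.
  by congr (_ *: _ + _); apply: esym; exact: pihatE.
- apply: l2Z_ext => m; rewrite l2ZP; apply: etrans (pihatE _ _ _) _.
  apply: etrans (repP (pi_aX m) a x y (f m)) _.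
  by congr (_ *: _ + _); apply: esym; exact: pihatE.
- apply/funext => f; apply: l2Z_ext => m; apply: etrans (pihatE _ _ _) _.
  apply: etrans (repM (pi_aX m) x y (f m)) _.
  apply: esym; apply: etrans (pihatE _ _ _) _.
  by congr (pi _ _); exact: pihatE.
move=> x f g; rewrite -[LHS]/(l2Z_inner _ _) -[RHS]/(l2Z_inner _ _).
have E m : inner (ph x f m) (g m) = inner (f m) (ph (star x) g m).
  apply: etrans (congr1 (fun u => inner u (g m)) (pihatE x f m)) _.
  apply: etrans (rep_adj (pi_aX m) x (f m) (g m)) _.
  by congr (inner _ _); apply: esym; exact: pihatE.
by rewrite /l2Z_inner /l2Z_form; congr csum; apply/funext => k; rewrite !E.
Qed.

Lemma pihat_shift x n f : ph x (U n f) = U n (ph (aX n x) f).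
Proof.
apply/val_inj/funext => m; rewrite /= pihatE !bishiftXE pihatE.
by rewrite -(alphaXD alpha_aut) subrK.
Qed.

(** A Laurent polynomial is a list of pairs (degree, coefficient) in which degrees may repeat: sums
    are then concatenations and products range over pairs, with no collection of terms. *)
Definition laurent (s : seq (int * C)) f : l2Z H0 :=
  \sum_(p <- s) U p.1 (ph p.2 f).

Lemma laurent_bounded s : bounded_op (laurent s).
Proof.
elim: s => [|p s IHs].
  rewrite (_ : laurent [::] = fun=> 0); first exact: bounded_op0.
  by apply/funext => f; rewrite /laurent big_nil.
rewrite (_ : laurent _ = fun f => 1 *: (U p.1 \o ph p.2) f + laurent s f).
  apply: bounded_op_comb => //; apply: bounded_op_comp; first exact: bishiftX_bounded.
  exact: rep_bounded pihat_star_rep _.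
by apply/funext => f; rewrite /laurent big_cons scale1r.
Qed.

Lemma laurent_cat s t f : laurent (s ++ t) f = laurent s f + laurent t f.
Proof. by rewrite /laurent big_cat. Qed.

Lemma laurentZ (a : R[i]) s f :
  laurent [seq (p.1, a *: p.2) | p <- s] f = a *: laurent s f.
Proof.
rewrite /laurent big_map scaler_sumr; apply: eq_bigr => p _ /=.
by rewrite (repZ pihat_star_rep) (opZ _ _ (bishiftX_bounded _ _)).
Qed.

Lemma laurentM s t f :
  laurent [seq (p.1 + q.1, aX q.1 p.2 * q.2) | p <- s, q <- t] f =
  laurent s (laurent t f).
Proof.
rewrite /laurent big_allpairs_dep; apply: eq_bigr => p _ /=.
rewrite (op_sum _ _ _ (rep_bounded pihat_star_rep _)) (op_sum _ _ _ (bishiftX_bounded _ _)).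
by apply: eq_bigr => q _; rewrite pihat_shift bishiftXD (repM pihat_star_rep).
Qed.

(** The adjoint of U^n π̂(x) is π̂(star x) U^(-n) = U^(-n) π̂(α^(-n)(star x)). *)
Definition laurent_star (s : seq (int * C)) :=
  [seq (- p.1, aX (- p.1) (star p.2)) | p <- s].

Lemma laurent_adj s : adjoint (laurent (laurent_star s)) (laurent s).
Proof.
elim: s => [|p s IHs].
  rewrite /laurent_star /= (_ : laurent [::] = fun=> 0); first exact: adjoint0.
  by apply/funext => f; rewrite /laurent big_nil.
have E q t : laurent (q :: t) = fun f => U q.1 (ph q.2 f) + laurent t f.
  by apply/funext => f; rewrite /laurent big_cons.
rewrite [laurent_star _]/= !E /=; apply: adjointD => // f g.
by rewrite bishiftX_adj (rep_adj pihat_star_rep) pihat_shift.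
Qed.

Local Notation B := (reduced_crossed_product alpha pi).

(** Scalars are absorbed in the coefficients, so a linear combination of generators becomes one
    Laurent polynomial. *)
Lemma crossedP T : B T <-> bounded_op T /\
  forall e, 0 < e -> exists s, op_close e T (laurent s).
Proof.
split=> [[bT appr]|[bT appr]]; split=> // e e0.
  have [n [a [S [/choice[k Sk] lt]]]] := appr e e0.
  have /choice[x Sx] := Sk.
  pose s := [seq (k i, a i *: x i) | i <- enum 'I_n].
  exists s; apply/(op_close_opnorm bT (laurent_bounded s) (ltW e0)); apply: ltW.
  rewrite (_ : T \- laurent s = fun h => T h - \sum_(k < n) a k *: S k h) //.
  apply/funext => f /=; congr (_ - _); rewrite /laurent big_map big_enum.
  apply: eq_bigr => i _; rewrite Sx /= (repZ pihat_star_rep).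
  by rewrite (opZ _ _ (bishiftX_bounded _ _)).
have e2 : 0 < e / 2 by lra.
have [s cl] := appr _ e2.
exists (size s), (fun=> 1), (fun k => U (nth (0, 0) s k).1 \o ph (nth (0, 0) s k).2).
split; first by move=> k; exists (nth (0, 0) s k).1, (nth (0, 0) s k).2.
rewrite (_ : (fun h : l2Z H0 => _) = T \- laurent s).
  move/(op_close_opnorm bT (laurent_bounded s) (ltW e2)): cl; lra.
apply/funext => f /=; congr (_ - _); rewrite /laurent (big_nth (0, 0)) big_mkord.
by apply: eq_bigr => i _; rewrite scale1r.
Qed.

Lemma crossed_laurent s : B (laurent s).
Proof.
apply/crossedP; split; first exact: laurent_bounded.
by move=> e e0; exists s => f; rewrite subrr hnorm0 mulr_ge0 ?dnorm_pos ?ltW.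
Qed.

Lemma crossed_closed T : bounded_op T ->
  (forall e, 0 < e -> exists2 S, B S & op_close e T S) -> B T.
Proof.
move=> bT appr; apply/crossedP; split=> // e e0; have e2 : 0 < e / 2 by lra.
have [S /crossedP[_ /(_ _ e2)[s ss]] TS] := appr _ e2.
by exists s; rewrite (splitr e); exact: op_close_trans TS ss.
Qed.

Lemma crossed_approx T : B T -> exists s : nat -> seq (int * C),
  forall e, 0 < e -> exists n0 : nat, forall k, (n0 <= k)%N -> op_close e (laurent (s k)) T.
Proof.
move=> /crossedP[bT appr].
have /choice[s hs] : forall k : nat, exists s, op_close (k.+1%:R^-1) T (laurent s).
  by move=> k; apply: appr; rewrite invr_gt0.
exists s => e /harmonic_small[n0 h0]; exists n0 => k hk.
apply: op_close_sym => f; apply: le_trans (hs k f) _.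
by rewrite ler_wpM2r ?dnorm_pos ?h0.
Qed.

Lemma crossed_cstar : is_operator_cstar B.
Proof.
split.
- by move=> T /crossedP[].
- split.
    rewrite (_ : (fun=> 0) = laurent [::]); first exact: crossed_laurent.
    by apply/funext => f; rewrite /laurent big_nil.
  move=> a S T BS BT; have [bS _] := (crossedP S).1 BS; have [bT _] := (crossedP T).1 BT.
  apply: crossed_closed; first exact: bounded_op_comb.
  move=> e e0; pose c := complex.Re `|a| + 1.
  have a0 : 0 <= complex.Re `|a| by exact: Re_norm_ge0.
  have c0 : 0 < c by rewrite ltr_wpDl.
  have e2 : 0 < e / 2 by lra.
  have d0 : 0 < e / 2 / c by rewrite divr_gt0.
  have [_ /(_ _ d0)[s ss]] := (crossedP S).1 BS.
  have [_ /(_ _ e2)[t tt]] := (crossedP T).1 BT.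
  exists (laurent ([seq (p.1, a *: p.2) | p <- s] ++ t)); first exact: crossed_laurent.
  move=> f; rewrite laurent_cat laurentZ opprD addrACA -scalerBr.
  apply: le_trans (dnormD _ _ _) _; rewrite dnormZ (splitr e) mulrDl; apply: lerD; last exact: tt.
  apply: (@le_trans _ _ (c * (e / 2 / c * hnorm f))); last first.
    by rewrite mulrA [c * _]mulrC divfK ?gt_eqF.
  apply: (@le_trans _ _ (c * hnorm (S f - laurent s f))).
    by rewrite ler_wpM2r ?dnorm_pos // /c lerDl.
  by rewrite ler_wpM2l // ltW.
- move=> S T BS BT; have [bS _] := (crossedP S).1 BS; have [bT _] := (crossedP T).1 BT.
  apply: crossed_closed; first exact: bounded_op_comp.
  move=> e e0.
  (* If [s] and [t] are within d ≤ 1 of [S] and [T], the products differ by at most d ‖S‖ + d (‖T‖ +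
     1). *)
  pose c := opnorm S + opnorm T + 2.
  have S0 := opnorm_ge0 bS; have T0 := opnorm_ge0 bT.
  have c0 : 0 < c by rewrite /c; lra.
  pose d := Num.min 1 (e / c); have d0 : 0 < d by rewrite lt_min ltr01 divr_gt0.
  have d1 : d <= 1 by rewrite ge_min lexx.
  have dc : d * c <= e by rewrite -ler_pdivlMr // ge_min lexx orbT.
  have [_ /(_ _ d0)[s ss]] := (crossedP S).1 BS.
  have [_ /(_ _ d0)[t tt]] := (crossedP T).1 BT.
  exists (laurent [seq (p.1 + q.1, aX q.1 p.2 * q.2) | p <- s, q <- t]).
    exact: crossed_laurent.
  move=> f; rewrite laurentM /=.
  have hX := seminorm_dist (dnorm_seminorm inner) (S (T f)) (S (laurent t f))
    (laurent s (laurent t f)).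
  rewrite -(opB _ _ bS) in hX; have hS := opnormP (T f - laurent t f) bS.
  have hs := ss (laurent t f); have ht := tt f.
  have hc := op_close_bounded f (op_close_sym tt); have hT := opnormP f bT.
  have nf0 : 0 <= hnorm f by exact: dnorm_pos.
  apply: (le_trans hX); apply: (@le_trans _ _ (d * c * hnorm f)); last first.
    by rewrite ler_wpM2r.
  apply: (@le_trans _ _ (opnorm S * (d * hnorm f) +
      d * (opnorm T * hnorm f + 1 * hnorm f))).
    apply: lerD; first by apply: le_trans hS _; rewrite ler_wpM2l.
    apply: (le_trans hs); rewrite ler_wpM2l ?(ltW d0) //; apply: (le_trans hc).
    by apply: lerD => //; rewrite ler_wpM2r.
  have df0 : 0 <= d * hnorm f by rewrite mulr_ge0 ?(ltW d0).
  rewrite /c; move: df0; move: (opnorm S) (opnorm T) (hnorm f) => oS oT nf.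
  by clear; lra.
(* The adjoint of [T] is constructed as the limit of the explicit adjoints of Laurent approximants,
   a Cauchy sequence since bounds pass to adjoints. *)
- move=> T BT; have [s hs] := crossed_approx BT.
  have clS e : 0 < e -> exists n0 : nat, forall i k, (n0 <= i)%N -> (n0 <= k)%N ->
      op_close e (laurent (laurent_star (s i))) (laurent (laurent_star (s k))).
    move=> e0; have e2 : 0 < e / 2 by lra.
    have [n0 hn0] := hs _ e2; exists n0 => i k hi hk.
    have adj : adjoint (laurent (laurent_star (s i)) \- laurent (laurent_star (s k)))
        (laurent (s i) \- laurent (s k)).
      by apply: adjointB; exact: laurent_adj.
    apply: (adjoint_le (ltW e0) adj) => h; rewrite (splitr e).
    exact: op_close_trans (hn0 i hi) (op_close_sym (hn0 k hk)) h.
  have [S bS SS] := op_limit (fun k => laurent_bounded _) clS.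
  exists S; last by apply: (adjoint_limit hs SS) => k; exact: laurent_adj.
  apply: crossed_closed => // e /SS[n0 /(_ n0 (leqnn _)) h].
  by exists (laurent (laurent_star (s n0))); [exact: crossed_laurent | exact: op_close_sym].
move=> T bT appr; apply: crossed_closed => // e /appr[S BS lt]; exists S => //.
have [bS _] := (crossedP S).1 BS.
have e0 : 0 <= e by apply: le_trans (ltW lt); exact: opnorm_ge0 (bounded_opB bT bS).
by apply/(op_close_opnorm bT bS e0); exact: ltW.
Qed.

End CrossedProduct.

(** * Covariant pairs *)

(** The substitution l = k + n: it turns row k of a truncated Toeplitz matrix into a sum over the
    coefficients of a polynomial. *)
Lemma sum_shift_window (V : nmodType) (G : nat -> V) (k K L : nat) :
  (forall n, (L <= n)%N -> G n = 0) ->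
  \sum_(l < K) (if (k <= l)%N then G (l - k)%N else 0) =
  \sum_(n < L) (if (k + n < K)%N then G n else 0).
Proof.
move=> GL; rewrite -!(big_mkord xpredT (fun n => if (k + n < K)%N then G n else 0)).
rewrite -(big_mkord xpredT (fun l => if (k <= l)%N then G (l - k)%N else 0)).
rewrite -!big_mkcond /=.
transitivity (\sum_(0 <= n < K - k) G n).
  have [kK|Kk] := leqP k K; last first.
    rewrite [RHS]big_geq; last by lia.
    by rewrite big_nat_cond big1 // => l; lia.
  rewrite (big_cat_nat (leq0n k) kK) /= big_nat_cond big1 ?add0r => [|l]; last by lia.
  rewrite -{1}(add0n k) big_addn /= big_nat_cond [RHS]big_nat_cond.
  by apply: eq_big => l; [lia | rewrite addnK].
rewrite (@big_nat_widen _ _ _ 0 (K - k) (L + K)) /=; last by lia.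
rewrite [RHS](@big_nat_widen _ _ _ 0 L (L + K)) /=; last by lia.
rewrite [LHS]big_mkcond [RHS]big_mkcond; apply: eq_bigr => n _.
have [Ln|nL] := leqP L n; first by rewrite GL // !if_same.
by rewrite andbT (_ : (n < K - k)%N = (k + n < K)%N) //; lia.
Qed.

(** Writing 1/r = 1 + t, Bernoulli makes r^n d smaller than any given [e]. *)
Lemma le_of_geometric (R : realType) (a b d r : R) : 0 <= r < 1 -> 0 <= d ->
  (forall n, a <= b + r ^+ n * d) -> a <= b.
Proof.
move=> /andP[r0 r1] d0 h; apply/ler_addgt0Pr => e e0.
have [rz|rn] := eqVneq r 0.
  by have := h 1%N; rewrite rz expr1 mul0r addr0; lra.
have rp : 0 < r by rewrite lt_neqAle eq_sym rn.
pose t := r^-1 - 1; have t0 : 0 < t by rewrite subr_gt0 invf_gt1.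
have rE : r^-1 = 1 + t by rewrite /t addrC subrK.
pose n := Num.bound (d / (e * t)).
have hn : d / (e * t) < n%:R.
  by apply: archi_boundP; rewrite divr_ge0 // mulr_ge0 ?ltW.
apply: le_trans (h n) _; rewrite lerD2l.
have rn0 : 0 < r ^+ n by rewrite exprn_gt0.
rewrite -[r]invrK exprVn mulrC ler_pdivrMr ?exprn_gt0 ?invr_gt0 //.
have et : 0 < e * t by rewrite mulr_gt0.
rewrite ltr_pdivrMr // in hn.
by rewrite rE; have := ler_wpM2l (ltW e0) (bernoulli n (ltW t0)); lra.
Qed.

Section FiniteSupport.
Variables (R : realType) (C : cstarType R).
Implicit Types (F G : nat -> C).

Definition fin_supp (L : nat) F : Prop := forall n, (L <= n)%N -> F n = 0.

Lemma fin_supp_l1 L F : fin_supp L F -> l1 F.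
Proof.
move=> FL; rewrite /l1 /=; apply/cvg_ex; exists (series (fun n => cnorm (F n)) L).
apply: cvg_near_cst; exists L => // n /= Ln.
rewrite /series /= (big_cat_nat (leq0n L) Ln) /=.
rewrite [X in _ + X]big_nat_cond [X in _ + X]big1 ?addr0 //.
by move=> i /andP[/andP[Li _] _]; rewrite FL // cnorm0.
Qed.

Lemma delta_supp n (x : C) : fin_supp n.+1 (delta n x).
Proof. by move=> k nk; rewrite /delta gtn_eqF. Qed.

Section Reps.
Variables (H : hilbertType R) (rho : C -> H -> H) (T : H -> H).
Hypothesis rho_rep : star_rep rho.

Definition fin_rep L F (h : H) : H := \sum_(n < L) iter n T (rho (F n) h).

(** The partial sums are stationary from [L] on, and uniqueness of limits forces [xget] to return
    the finite sum. *)
Lemma covariant_rep_fin L F : bounded_op T -> fin_supp L F ->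
  covariant_rep rho T F = fin_rep L F.
Proof.
move=> bT FL; apply/funext => h; rewrite /covariant_rep.
have T0 n : iter n T 0 = 0 by elim: n => //= n ->; exact: op0.
have lim : ncvg (@hnorm R H) (fun k => \sum_(n < k) iter n T (rho (F n) h)) (fin_rep L F h).
  move=> e e0; exists L => n Ln; rewrite /fin_rep.
  rewrite -!(big_mkord xpredT (fun n => iter n T (rho (F n) h))).
  rewrite (big_cat_nat (leq0n L) Ln) /= [X in _ + X - _]big_nat_cond.
  rewrite [X in _ + X - _]big1 ?addr0 ?subrr ?hnorm0 //.
  by move=> i /andP[/andP[Li _] _]; rewrite FL // (rep0 rho_rep) T0.
case: xgetP => [l _ /= hl|/(_ _ lim)//].
exact: (ncvg_unique (dnorm_seminorm inner) (@dnorm_eq0P _ _ _) hl lim).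
Qed.

Lemma fin_rep_bounded L F : bounded_op T -> bounded_op (fin_rep L F).
Proof.
move=> bT; apply: bounded_op_sum => n; apply: (bounded_op_comp (iter_bounded _ bT)).
exact: rep_bounded rho_rep _.
Qed.

Lemma iter_contraction n (h : H) : (forall h, hnorm (T h) <= hnorm h) ->
  hnorm (iter n T h) <= hnorm h.
Proof. by move=> cT; elim: n => //= n; apply: le_trans (cT _). Qed.

Lemma covariant_rep_le F (c : R) (h : H) : Defs.contraction T -> 0 <= c ->
  (forall k, series (fun n => cnorm (F n)) k <= c) ->
  hnorm (covariant_rep rho T F h) <= c * hnorm h.
Proof.
move=> [bT cT] c0 Fc; rewrite /covariant_rep; case: xgetP => [l _ /= hl|_]; last first.
  by rewrite hnorm0 mulr_ge0 ?dnorm_pos.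
apply: (ncvg_le (dnorm_seminorm inner) hl) => k; apply: le_trans (hnorm_sum _ _ _) _.
apply: (@le_trans _ _ (series (fun n => cnorm (F n)) k * hnorm h)); last first.
  by rewrite ler_wpM2r ?dnorm_pos.
rewrite /series /= big_mkord mulr_suml; apply: ler_sum => n _.
exact: le_trans (iter_contraction _ _ cT) (rep_contractive rho_rep _ _).
Qed.

End Reps.
End FiniteSupport.

Arguments fin_supp_l1 {R C L F} _ t _.

(** * The regular representation dominates all covariant pairs *)

Section Domination.
Variables (R : realType) (C : cstarType R) (alpha : C -> C).
Hypothesis alpha_aut : star_automorphism alpha.
Variables (H0 : hilbertType R) (pi : C -> H0 -> H0).
Hypotheses (pi_rep : star_rep pi) (pi_inj : injective pi).
Variables (N L : nat) (F : 'I_N -> 'I_N -> nat -> C).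
Hypothesis F_fin : forall i j, fin_supp L (F i j).
Local Notation aX := (alphaX alpha).
Local Notation ph := (pihat alpha pi).
Local Notation J := (\matrix_(i, j) fin_rep ph (@bishift R H0) L (F i j)).

Let bJ : bounded_mx J.
Proof.
move=> i j; rewrite mxE.
exact: (fin_rep_bounded (pihat_star_rep alpha_aut pi_rep) _ _ (bishift_bounded H0)).
Qed.

(* The compression of the matrix [J] to the positions [0, -1, ..., 1 - K]. *)
Definition toeplitz_entry K (p q : 'I_N * 'I_K) : C :=
  if (p.2 <= q.2)%N then aX (- (q.2 : nat)%:Z) (F p.1 q.1 (q.2 - p.2)%N) else 0.

(** Pairs (row of [F], position in the window) are enumerated so that the result is a square matrix
    over [C] to which [mx_rep_form_le] applies. *)
Definition toeplitz K : 'M[C]_#|{: 'I_N * 'I_K}| :=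
  \matrix_(p, q) toeplitz_entry (enum_val p) (enum_val q).

(** Serves twice: with [rho = pi] and [Z] the coordinates of vectors in l²(Z; H0), and with an
    arbitrary [rho] and Z j l = S^l (v j). *)
Lemma toeplitzE K (H : hilbertType R) (rho : C -> H -> H) (Z : 'I_N -> nat -> H) p :
  star_rep rho ->
  mxapp (map_mx rho (toeplitz K)) (fun q => Z (enum_val q).1 (enum_val q).2) p =
  \sum_j \sum_(n < L) (if ((enum_val p).2 + n < K)%N then
     rho (aX (- ((enum_val p).2 + n)%N%:Z) (F (enum_val p).1 j n)) (Z j ((enum_val p).2 + n)%N)
     else 0).
Proof.
move=> rho_rep; rewrite /mxapp; case pE : (enum_val p) => [i k].
transitivity (\sum_(q : 'I_N * 'I_K) rho (toeplitz_entry (i, k) q) (Z q.1 q.2)).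
  rewrite (big_enum_val (fun q : 'I_N * 'I_K => rho (toeplitz_entry (i, k) q) (Z q.1 q.2))).
  by apply: eq_bigr => q _; rewrite !mxE pE.
rewrite -(pair_bigA _ (fun j l => rho (toeplitz_entry (i, k) (j, l)) (Z j l))) /=.
apply: eq_bigr => j _.
pose G n := rho (aX (- (k + n)%N%:Z) (F i j n)) (Z j (k + n)%N).
rewrite -(@sum_shift_window _ G k K L); last first.
  move=> n Ln; rewrite /G F_fin // (star_hom0 (alphaX_hom alpha_aut _)).
  exact: (rep0 rho_rep).
apply: eq_bigr => l _; rewrite /toeplitz_entry /=; case: leqP => kl.
  by rewrite /G subnKC.
exact: (rep0 rho_rep).
Qed.

Lemma window_val k (x : 'I_k -> H0) (p : nat) :
  window x (- p%:Z) = oapp x 0 (insub p).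
Proof. by rewrite /= /window_fun oppr_le0 /= abszN absz_nat. Qed.

Lemma l2Z_sum (I : Type) (r : seq I) (P : pred I) (G : I -> l2Z H0) m :
  (\sum_(i <- r | P i) G i) m = \sum_(i <- r | P i) G i m.
Proof. exact: (big_morph (fun f : l2Z H0 => f m) (fun f g => l2ZD f g m) erefl). Qed.

Lemma fin_rep_pihat G (f : l2Z H0) m :
  fin_rep ph (@bishift R H0) L G f m =
  \sum_(n < L) pi (aX (m - n%:Z) (G n)) (f (m - n%:Z)).
Proof.
rewrite /fin_rep l2Z_sum; apply: eq_bigr => n _.
rewrite iter_bishiftE; exact: (pihatE alpha_aut pi_rep).
Qed.

Lemma sum_pairs K (g : 'I_N -> 'I_K -> R) :
  \sum_(p < #|{: 'I_N * 'I_K}|) g (enum_val p).1 (enum_val p).2 = \sum_i \sum_k g i k.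
Proof.
by rewrite pair_bigA -(big_enum_val (fun q : 'I_N * 'I_K => g q.1 q.2)).
Qed.

(** Extend the entries of [y] by zero to vectors [w] in l²(Z; H0). The Toeplitz matrix applied to
    [y] is [J] applied to [w], read off in the window; neither extension nor restriction increases
    norms. *)
Lemma toeplitz_norm K : opmx_norm (map_mx pi (toeplitz K)) <= opmx_norm J.
Proof.
have c0 := opmx_norm_ge0 bJ.
apply: opmx_norm_le => // y.
pose w : 'I_N -> l2Z H0 := fun j => window (fun l => y (enum_rank (j, l))).
pose Z j (l : nat) := w j (- l%:Z).
have yE : y = fun q => Z (enum_val q).1 (enum_val q).2.
  apply/funext => q; rewrite /Z /w window_val valK /=.
  by rewrite -surjective_pairing enum_valK.
have app p : mxapp (map_mx pi (toeplitz K)) y p =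
    mxapp J w (enum_val p).1 (- ((enum_val p).2 : nat)%:Z).
  rewrite {1}yE toeplitzE // /mxapp l2Z_sum; apply: eq_bigr => j _.
  rewrite mxE fin_rep_pihat; apply: eq_bigr => n _.
  (* Positions outside the window carry 0 in [w], which matches the truncation at [K]. *)
  rewrite -opprD -PoszD; case: leqP => // Kk.
  by rewrite /w window_val insubF ?(op0 (rep_bounded pi_rep _)) // ltnNge Kk.
rewrite -ler_sqr ?nnegrE ?mulr_ge0 ?sumnorm_ge0 // exprMn.
rewrite !sumnorm2; under eq_bigr do rewrite app.
rewrite (@sum_pairs K (fun i k => hnorm (mxapp J w i (- (k : nat)%:Z)) ^+ 2)).
apply: (@le_trans _ _ (sumnorm (mxapp J w) ^+ 2)).
  by rewrite sumnorm2; apply: ler_sum => i _; exact: l2Z_window.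
apply: (@le_trans _ _ ((opmx_norm J * sumnorm w) ^+ 2)).
  by rewrite ler_sqr ?nnegrE ?mulr_ge0 ?sumnorm_ge0 // opmx_normP.
rewrite exprMn ler_wpM2l ?sqr_ge0 // sumnorm2.
have -> : \sum_p hnorm (y p) ^+ 2 =
    \sum_i \sum_(k < K) hnorm (y (enum_rank (i, k))) ^+ 2.
  rewrite -sum_pairs; apply: eq_bigr => p _.
  by rewrite -surjective_pairing enum_valK.
apply: ler_sum => j _; rewrite -sumnorm2.
by rewrite ler_sqr ?nnegrE ?sumnorm_ge0 ?dnorm_pos // window_norm.
Qed.

Section OnePair.
Variables (H : hilbertType R) (rho : C -> H -> H).
Hypothesis rho_rep : star_rep rho.
Local Notation nH := (@hnorm R H).

(** Used later also with a power of [alpha] in place of [alpha], for the operator of [u ^+ k]. *)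
Definition covariant (S : H -> H) : Prop :=
  [/\ bounded_op S, (forall h, nH (S h) <= nH h) &
      forall x h, rho x (S h) = S (rho (alpha x) h)].

Lemma covariant_iter S n x h : covariant S ->
  iter n S (rho x h) = rho (aX (- n%:Z) x) (iter n S h).
Proof.
move=> [_ _ cS]; elim: n x => [|n IHn] x; first by rewrite oppr0.
have E : aX (- n%:Z) x = alpha (aX (- n.+1%:Z) x).
  by rewrite -[RHS]/(aX 1 _) -(alphaXD alpha_aut); congr (aX _ x); lia.
by rewrite iterS IHn E -cS.
Qed.

(* [S] is an isometry up to a defect, so the semi-inner product measuring this
   defect turns [h |-> (S^k h)_k] into an isometry with values in sequences. *)
Definition defect (S : H -> H) (h k : H) : R := re_inner h k - re_inner (S h) (S k).

Lemma defect_psd S : covariant S -> psd_form (defect S).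
Proof.
move=> [bS cS _]; have P := re_inner_psd H; split=> [r x y z|x y|x].
- have [l _ _] := P; rewrite /defect bS.1 !l; ring.
- by have [_ s _] := P; rewrite /defect s [X in _ - X]s.
- by rewrite subr_ge0 -!hnorm2 ler_sqr ?nnegrE ?dnorm_pos.
Qed.

(** In operator terms, 1 - S*S commutes with the range of [rho]. Surjectivity of [alpha] enters:
    only elements of the form α(y) can be moved across [S] from the right. *)
Lemma defect_adj S x h k : covariant S ->
  defect S (rho (star x) h) k = defect S h (rho x k).
Proof.
move=> [_ _ cS]; have adj u v y : re_inner (rho (star y) u) v = re_inner u (rho y v).
  by rewrite /re_inner (rep_adj rho_rep) starK.
rewrite /defect adj; congr (_ - _); rewrite -(alphaK alpha_aut x).
by have [_ _ st] := alpha_hom alpha_aut; rewrite -st -!cS adj.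
Qed.

Lemma defect_sum S (v : H) K : \sum_(k < K) defect S (iter k S v) (iter k S v) =
  nH v ^+ 2 - nH (iter K S v) ^+ 2.
Proof.
elim: K => [|K IHK]; first by rewrite big_ord0 subrr.
by rewrite big_ord_recr IHK /= /defect -!hnorm2 addrA subrK.
Qed.

Local Notation rmx S := (\matrix_(i, j) fin_rep rho S L (F i j)).

(** [mx_rep_form_le] is applied with the defect form to the sequences (S^k v_j)_k. By telescoping,
    the right side is at most c² ‖x‖², while the left side is at least (1 - r^P) ‖w‖² for w the
    image of x; then P tends to infinity. *)
Lemma strict_pair_le S (r : R) x : covariant S -> 0 <= r < 1 ->
  (forall h, nH (S h) <= r * nH h) ->
  sumnorm (mxapp (rmx S) x) <= opmx_norm J * sumnorm x.
Proof.
move=> cS r01 Sr; have [bS S1 covS] := cS.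
have [r0 _] := andP r01.
set c := opmx_norm J; have c0 : 0 <= c := opmx_norm_ge0 bJ.
pose w := mxapp (rmx S) x.
(* [rho] may be degenerate; replacing [x] by [v] leaves [w] unchanged and makes [rho 1] act as the
   identity on all S^k (v j). *)
pose v j := rho 1 (x j).
have vx j : nH (v j) <= nH (x j) by exact: (rep1_le rho_rep).
have wE i : w i = \sum_j \sum_(n < L) iter n S (rho (F i j n) (v j)).
  rewrite /w /mxapp; apply: eq_bigr => j _; rewrite mxE; apply: eq_bigr => n _.
  by rewrite /v (rep1 rho_rep).
have iterr n h : nH (iter n S h) <= r ^+ n * nH h.
  elim: n => [|n IHn] /=; first by rewrite expr0 mul1r.
  by apply: le_trans (Sr _) _; rewrite exprS -mulrA ler_wpM2l.
have main P : sumnorm w ^+ 2 <= (c * sumnorm x) ^+ 2 + r ^+ P * sumnorm w ^+ 2.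
  (* With [L] spare positions the rows k < P lose nothing to the truncation, and row k returns S^k
     (w i) exactly. *)
  pose K := (P + L)%N.
  pose Z j l := iter l S (v j).
  have bP := defect_psd cS.
  have le := mx_rep_form_le pi_rep pi_inj rho_rep bP (fun x h k => defect_adj x h k cS)
    (fun q : 'I_#|{: 'I_N * 'I_K}| => Z (enum_val q).1 (enum_val q).2) (toeplitz_norm K).
  have rhs : \sum_(q < #|{: 'I_N * 'I_K}|) defect S (rho 1 (Z (enum_val q).1 (enum_val q).2))
       (rho 1 (Z (enum_val q).1 (enum_val q).2)) <= sumnorm x ^+ 2 :> R.
    rewrite (@sum_pairs K (fun i k => defect S (rho 1 (Z i k)) (rho 1 (Z i k)))) sumnorm2.
    apply: ler_sum => j _.
    have E (k : nat) : rho 1 (Z j k) = Z j k.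
      have := covariant_iter k 1 (v j) cS; rewrite (alphaX1 alpha_aut) => <-.
      by rewrite /Z /v (rep1 rho_rep).
    under eq_bigr do rewrite E.
    rewrite defect_sum; apply: (@le_trans _ _ (nH (v j) ^+ 2)).
      by rewrite gerBl sqr_ge0.
    by rewrite ler_sqr ?nnegrE ?dnorm_pos.
  have lhs : (1 - r ^+ P) * sumnorm w ^+ 2 <= \sum_(q < #|{: 'I_N * 'I_K}|)
      defect S (mxapp (map_mx rho (toeplitz K)) (fun q => Z (enum_val q).1 (enum_val q).2) q)
       (mxapp (map_mx rho (toeplitz K)) (fun q => Z (enum_val q).1 (enum_val q).2) q).
    have E i (k : 'I_K) : (k < P)%N ->
        \sum_j \sum_(n < L) (if (k + n < K)%N then
          rho (aX (- (k + n)%N%:Z) (F i j n)) (Z j (k + n)%N) else 0) = iter k S (w i).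
      move=> kP; rewrite wE (op_sum _ _ _ (iter_bounded k bS)); apply: eq_bigr => j _.
      rewrite (op_sum _ _ _ (iter_bounded k bS)); apply: eq_bigr => n _.
      have -> : (k + n < K)%N by rewrite -addnS; exact: leq_add (ltnW kP) (ltn_ord n).
      by rewrite -iterD (covariant_iter _ _ _ cS).
    under eq_bigr do rewrite toeplitzE //.
    pose g i (k : 'I_K) := \sum_j \sum_(n < L) (if (k + n < K)%N then
          rho (aX (- (k + n)%N%:Z) (F i j n)) (Z j (k + n)%N) else 0).
    rewrite (@sum_pairs K (fun i k => defect S (g i k) (g i k))) sumnorm2 mulr_sumr.
    apply: ler_sum => i _.
    (* Rows k ≥ P contribute nonnegative amounts and are dropped; the first [P] rows telescope. *)
    apply: (@le_trans _ _ (\sum_(k < P) defect S (iter k S (w i)) (iter k S (w i)))).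
      rewrite defect_sum mulrBl mul1r lerD2l lerN2.
      apply: (@le_trans _ _ ((r ^+ P * nH (w i)) ^+ 2)).
        by rewrite ler_sqr ?nnegrE ?mulr_ge0 ?exprn_ge0 ?dnorm_pos.
      rewrite exprMn ler_wpM2r ?sqr_ge0 // expr2 ler_piMr ?exprn_ge0 //.
      by rewrite exprn_ile1 // ltW //; case/andP: r01.
    have PK : (P <= K)%N by rewrite leq_addr.
    rewrite [leRHS](bigID (fun k : 'I_K => (k < P)%N)) /=.
    rewrite (big_ord_widen_cond K xpredT (fun k => defect S (iter k S (w i)) (iter k S (w i))) PK).
    rewrite (eq_bigr (fun k : 'I_K => defect S (iter k S (w i)) (iter k S (w i)))); last first.
      by move=> k kP; rewrite /g E.
    by rewrite lerDl sumr_ge0 // => k _; have [_ _] := bP; apply.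
  rewrite exprMn; move: lhs (ler_wpM2l (sqr_ge0 c) rhs) le.
  by rewrite /c; move=> l1 l2 l3; have := le_trans l1 (le_trans l3 l2); lra.
rewrite -ler_sqr ?nnegrE ?mulr_ge0 ?sumnorm_ge0 //.
exact: (le_of_geometric r01 (sqr_ge0 (sumnorm w)) main).
Qed.

(** The strict case holds for rT; on the fixed vector [x] the finitely many terms of the polynomial
    converge as r tends to 1. *)
Lemma covariant_pair_le T : covariant T -> opmx_norm (rmx T) <= opmx_norm J.
Proof.
move=> cT; have [bT T1 covT] := cT.
set c := opmx_norm J; have c0 : 0 <= c := opmx_norm_ge0 bJ.
apply: opmx_norm_le => // x.
pose S (r : R) h := r%:C *: T h.
have iS r n h : iter n (S r) h = (r ^+ n)%:C *: iter n T h.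
  elim: n => [|n IHn]; first by rewrite expr0 scale1r.
  by rewrite !iterS IHn /S (opZ _ _ bT) scalerA -rmorphM exprS.
have cS r : 0 <= r < 1 -> covariant (S r) /\ forall h, nH (S r h) <= r * nH h.
  move=> /andP[r0 r1].
  have le h : nH (S r h) <= r * nH h.
    by rewrite /S /hnorm dnormZ Re_norm_real ger0_norm // ler_wpM2l //; exact: T1.
  split=> //; split.
  - split=> [a u v|]; last by exists r.
    by rewrite /S bT.1 scalerDr !scalerA mulrC.
  - by move=> h; apply: le_trans (le h) _; rewrite ler_piMl ?dnorm_pos // ltW.
  - by move=> y h; rewrite /S (opZ _ _ (rep_bounded rho_rep _)) covT.
pose D n i j := nH (iter n T (rho (F i j n) (x j))).
(* The weight n comes from 1 - r^n ≤ n (1 - r), so passing from T to rT with r = 1 - d costs at most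
   d M. *)
pose M := \sum_i \sum_j \sum_(n < L) n%:R * D n i j.
have M0 : 0 <= M.
  by do 3![apply: sumr_ge0 => ? _]; rewrite mulr_ge0 ?dnorm_pos.
apply/ler_addgt0Pr => e e0.
pose d := Num.min (1 / 2) (e / (M + 1)).
have M1 : 0 < M + 1 by rewrite ltr_wpDl.
have d0 : 0 < d by rewrite lt_min !divr_gt0.
have d1 : d <= 1 / 2 by rewrite ge_min lexx.
have dM : d * (M + 1) <= e by rewrite -ler_pdivlMr // ge_min lexx orbT.
pose r := 1 - d; have r01 : 0 <= r < 1 by rewrite /r; apply/andP; split; lra.
have [r0 r1] := andP r01.
have [cSr Sr] := cS r r01.
have le := strict_pair_le x cSr r01 Sr.
have pow n : 0 <= 1 - r ^+ n <= n%:R * d.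
  apply/andP; split; first by rewrite subr_ge0 exprn_ile1 // ltW.
  elim: n => [|n IHn]; first by rewrite expr0 subrr mul0r.
  rewrite exprS -natr1.
  have : r ^+ n <= 1 by rewrite exprn_ile1 // ltW.
  rewrite (_ : r * r ^+ n = r ^+ n - d * r ^+ n); last by rewrite {1}/r mulrBl mul1r.
  by move=> /(ler_wpM2l (ltW d0)); lra.
have -> : mxapp (rmx T) x = mxapp (rmx (S r)) x + (mxapp (rmx T) x - mxapp (rmx (S r)) x).
  by rewrite addrC subrK.
apply: le_trans (sumnormD _ _) _; apply: lerD => //.
apply: (@le_trans _ _ (d * M)); last by lra.
apply: le_trans (sumnorm_le_sum _) _; rewrite mulr_sumr; apply: ler_sum => i _.
rewrite /mxapp !fctE -sumrB; apply: le_trans (hnorm_sum _ _ _) _.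
rewrite mulr_sumr; apply: ler_sum => j _.
rewrite !mxE /fin_rep -sumrB; apply: le_trans (hnorm_sum _ _ _) _.
rewrite mulr_sumr; apply: ler_sum => n _.
rewrite iS -{1}[iter n T _]scale1r -scalerBl.
rewrite (_ : 1 - (r ^+ n)%:C = (1 - r ^+ n)%:C); last by rewrite rmorphB rmorph1.
rewrite /hnorm dnormZ Re_norm_real ger0_norm; last by case/andP: (pow n).
rewrite mulrA [d * _]mulrC ler_wpM2r ?dnorm_pos //.
by case/andP: (pow n).
Qed.

End OnePair.
End Domination.

(** * Extending a bounded relation from a dense subalgebra *)

Section DenseExtension.
Variables (R : realType) (A : algType R[i]) (NA : A -> R) (K : hilbertType R).
Hypotheses (snA : seminorm NA) (NA0 : NA 0 = 0).
Hypothesis NAZ : forall (c : R[i]) x, NA (c *: x) <= complex.Re `|c| * NA x.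
Hypothesis NAM : forall x y, NA (x * y) <= NA x * NA y.
Variable Q : A -> (K -> K) -> Prop.
Hypothesis Q_bounded : forall a T, Q a T ->
  bounded_op T /\ forall h, hnorm (T h) <= NA a * hnorm h.
Hypothesis Q_lin : forall (c : R[i]) a b S T, Q a S -> Q b T ->
  Q (c *: a + b) (fun h => c *: S h + T h).
Hypothesis Q_mul : forall a b S T, Q a S -> Q b T -> Q (a * b) (S \o T).
Hypothesis Q_dense : forall a e, 0 < e -> exists a' T, Q a' T /\ NA (a - a') <= e.

Let NA_ge0 := seminorm_ge0 snA.

(** [Q] is a relation, since in its main use several data describe one element of the algebra. That
    it is single-valued is a consequence of the norm bound and need not be shown in advance. *)
Definition closure_pair (a : A) (L : K -> K) : Prop := bounded_op L /\
  forall e, 0 < e -> exists a' T, [/\ Q a' T, NA (a - a') <= e & op_close e L T].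

Lemma closure_pair_Q a T : Q a T -> closure_pair a T.
Proof.
move=> QT; split; first by have [] := Q_bounded QT.
move=> e e0; exists a, T; split=> //; first by rewrite subrr NA0 ltW.
by move=> h; rewrite subrr hnorm0 mulr_ge0 ?dnorm_pos ?ltW.
Qed.

Lemma closure_pair_le a L h : closure_pair a L -> hnorm (L h) <= NA a * hnorm h.
Proof.
move=> [bL appr]; apply/ler_addgt0Pr => e e0.
pose d := e / (2 * (hnorm h + 1)).
have h1 : 0 < 2 * (hnorm h + 1) by rewrite mulr_gt0 // ltr_wpDl ?dnorm_pos.
have d0 : 0 < d by rewrite divr_gt0.
have [a' [T [QT Na cl]]] := appr _ d0.
have [_ Th] := Q_bounded QT.
have Na' : NA a' <= NA a + d.
  by apply: le_trans (seminorm_le_dist snA a' a) _; rewrite (seminormC snA) lerD2l.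
have n0 := dnorm_pos inner h.
have dh : 2 * d * hnorm h <= e.
  apply: (@le_trans _ _ (d * (2 * (hnorm h + 1)))); last by rewrite divfK ?gt_eqF.
  by rewrite [2 * d]mulrC -mulrA ler_wpM2l ?(ltW d0) // ler_wpM2l // lerDl.
apply: le_trans (op_close_bounded h cl) _.
have := ler_wpM2r n0 Na'; have := Th h; rewrite -[dnorm _ _]/(hnorm h); lra.
Qed.

Lemma closure_pair_lin (c : R[i]) a b S T : closure_pair a S -> closure_pair b T ->
  closure_pair (c *: a + b) (fun h => c *: S h + T h).
Proof.
move=> [bS aS] [bT aT]; split; first exact: bounded_op_comb.
move=> e e0; pose m := complex.Re `|c| + 1.
have c0 : 0 <= complex.Re `|c| by exact: Re_norm_ge0.
have m0 : 0 < m by rewrite ltr_wpDl.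
have d0 : 0 < e / 2 / m by rewrite !divr_gt0.
have e2 : 0 < e / 2 by rewrite divr_gt0.
have cd : complex.Re `|c| * (e / 2 / m) <= e / 2.
  by rewrite mulrCA ler_piMr ?(ltW e2) // ler_pdivrMr // mul1r lerDl.
have [a' [S' [QS Na clS]]] := aS _ d0; have [b' [T' [QT Nb clT]]] := aT _ e2.
exists (c *: a' + b'), (fun h => c *: S' h + T' h); split; first exact: Q_lin.
  rewrite opprD addrACA -scalerBr; apply: le_trans (snA.1 _ _) _.
  by rewrite (splitr e); apply: lerD => //; apply: le_trans (NAZ _ _) _;
     apply: le_trans (ler_wpM2l c0 Na) _.
move=> h; rewrite opprD addrACA -scalerBr; apply: le_trans (dnormD _ _ _) _.
rewrite (splitr e) mulrDl; apply: lerD; last exact: clT.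
rewrite dnormZ; apply: le_trans (ler_wpM2l c0 (clS h)) _.
by rewrite mulrA ler_wpM2r ?dnorm_pos.
Qed.

Lemma closure_pair_mul a b S T : closure_pair a S -> closure_pair b T ->
  closure_pair (a * b) (S \o T).
Proof.
move=> cS cT; have [bS aS] := cS; have [bT aT] := cT.
split; first exact: bounded_op_comp.
move=> e e0; pose m := NA a + NA b + 1.
have a0 := NA_ge0 a; have b0 := NA_ge0 b.
have m0 : 0 < m by rewrite /m; lra.
pose d := Num.min 1 (e / m); have d0 : 0 < d by rewrite lt_min ltr01 divr_gt0.
have d1 : d <= 1 by rewrite ge_min lexx.
have dm : d * m <= e by rewrite -ler_pdivlMr // ge_min lexx orbT.
have [a' [S' [QS Na clS]]] := aS _ d0; have [b' [T' [QT Nb clT]]] := aT _ d0.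
have Na' : NA a' <= NA a + 1.
  apply: le_trans (seminorm_le_dist snA a' a) _.
  by rewrite (seminormC snA) lerD2l (le_trans Na).
have Nb' : NA b' <= NA b + 1.
  apply: le_trans (seminorm_le_dist snA b' b) _.
  by rewrite (seminormC snA) lerD2l (le_trans Nb).
exists (a' * b'), (S' \o T'); split; first exact: Q_mul.
  have -> : a * b - a' * b' = (a - a') * b + a' * (b - b').
    by rewrite mulrBl mulrBr addrA subrK.
  apply: le_trans (snA.1 _ _) _; apply: (@le_trans _ _ (d * NA b + (NA a + 1) * d)).
    apply: lerD; apply: le_trans (NAM _ _) _; first by rewrite ler_wpM2r.
    by apply: ler_pM.
  by move: dm; rewrite /m; lra.
move=> h /=; have n0 : 0 <= hnorm h := dnorm_pos inner h.
apply: le_trans (seminorm_dist (dnorm_seminorm inner) _ (S (T' h)) _) _.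
apply: (@le_trans _ _ (NA a * (d * hnorm h) + d * ((NA b + 1) * hnorm h))); last first.
  rewrite mulrCA -mulrDr -mulrDl mulrA addrA; exact: ler_wpM2r.
apply: lerD.
  rewrite -(opB _ _ bS); apply: le_trans (closure_pair_le _ cS) _.
  by rewrite ler_wpM2l //; exact: clT.
apply: le_trans (clS _) _; rewrite ler_wpM2l ?(ltW d0) //.
have [_ Th] := Q_bounded QT; apply: le_trans (Th h) _; exact: ler_wpM2r.
Qed.

(** The difference of two values is a value at 0, hence has norm at most [NA 0 = 0]. *)
Lemma closure_pair_unique a S T : closure_pair a S -> closure_pair a T -> S = T.
Proof.
move=> cS cT; apply/funext => h; apply/subr0_eq/(dnorm_eq0P (form := inner)).
have := closure_pair_le h (closure_pair_lin (-1) cT cS).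
rewrite !scaleN1r addNr NA0 mul0r addrC => le.
by apply/le_anti; rewrite le dnorm_pos.
Qed.

Lemma closure_pair_exists a : exists L, closure_pair a L.
Proof.
have /choice[s hs] : forall n : nat, exists p : A * (K -> K),
    Q p.1 p.2 /\ NA (a - p.1) <= n.+1%:R^-1.
  move=> n; have n0 : 0 < (n.+1%:R : R)^-1 by rewrite invr_gt0.
  by have [a' [T [QT h]]] := Q_dense a n0; exists (a', T).
have bs n : bounded_op (s n).2 by have [] := Q_bounded (hs n).1.
have close m n : op_close (NA ((s m).1 - (s n).1)) (s m).2 (s n).2.
  move=> h; have [_ le] := Q_bounded (Q_lin (-1) (hs n).1 (hs m).1).
  by have := le h; rewrite !scaleN1r ![- _ + _]addrC.
have cau e : 0 < e -> exists n0 : nat, forall m n, (n0 <= m)%N -> (n0 <= n)%N ->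
    op_close e (s m).2 (s n).2.
  move=> e0; have e2 : 0 < e / 2 by rewrite divr_gt0.
  have [n0 hn0] := harmonic_small e2; exists n0 => m n hm hn h.
  apply: le_trans (close m n h) _; rewrite ler_wpM2r ?dnorm_pos //.
  apply: le_trans (seminorm_dist snA _ a _) _; rewrite (seminormC snA _ a) (splitr e).
  by apply: lerD; [apply: le_trans (hs m).2 _ | apply: le_trans (hs n).2 _]; exact: hn0.
have [L bL LL] := op_limit bs cau; exists L; split=> // e e0.
have [n1 hn1] := LL _ e0; have [n2 hn2] := harmonic_small e0.
pose n := maxn n1 n2; exists (s n).1, (s n).2; split; first by have [] := hs n.
  by apply: le_trans (hs n).2 _; apply: hn2; exact: leq_maxr.
by apply: op_close_sym; apply: hn1; exact: leq_maxl.
Qed.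

Lemma dense_extension : exists rho : A -> K -> K,
  [/\ alg_rep rho, (forall a T, Q a T -> rho a = T),
      (forall a h, hnorm (rho a h) <= NA a * hnorm h) &
      forall a, closure_pair a (rho a)].
Proof.
have /choice[rho rhoP] := closure_pair_exists; exists rho; split=> //.
- split=> [a|c a b h|a b].
  + by have [] := rhoP a.
  + have := closure_pair_unique (rhoP (c *: a + b)) (closure_pair_lin c (rhoP a) (rhoP b)).
    by move=> ->.
  + exact: closure_pair_unique (rhoP _) (closure_pair_mul (rhoP a) (rhoP b)).
- by move=> a T /closure_pair_Q; exact: closure_pair_unique.
- by move=> a h; exact: closure_pair_le (rhoP a).
Qed.

End DenseExtension.

(** * Density in a generated C*-algebra *)

Section GeneratedDense.
Variables (R : realType) (D : cstarType R) (NA : D -> R).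
Hypothesis snA : seminorm NA.
Hypothesis NAZ : forall (c : R[i]) x, NA (c *: x) <= complex.Re `|c| * NA x.
Hypothesis NAM : forall x y, NA (x * y) <= NA x * NA y.
Hypothesis NA_star : forall x, NA (star x) <= NA x.
Hypothesis NA_le : forall x, NA x <= cnorm x.
Variable P : D -> Prop.
Hypothesis P_lin : forall (a : R[i]) x y, P x -> P y -> P (a *: x + y).
Hypothesis P_mul : forall x y, P x -> P y -> P (x * y).
Hypothesis P_star : forall x, P x -> P (star x).

(** The elements approximable from [P] form a *-subalgebra containing [E]. It is closed for [cnorm]
    because [NA] is dominated by [cnorm], although approximation is measured by the weaker [NA]. *)
Lemma cstar_generated_dense (E : set D) :
  (forall x, E x -> forall e, 0 < e -> exists x', P x' /\ NA (x - x') <= e) ->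
  cstar_generated E -> forall d e, 0 < e -> exists d', P d' /\ NA (d - d') <= e.
Proof.
move=> EP E_gen d; pose F : set D := [set d | forall e, 0 < e ->
  exists d', P d' /\ NA (d - d') <= e].
suff FT : F = setT by have Fd : F d by [rewrite FT]; exact: Fd.
have NA0 := seminorm_ge0 snA.
apply: E_gen => //.
- move=> a x y Fx Fy e e0; pose m := complex.Re `|a| + 1.
  have a0 : 0 <= complex.Re `|a| by exact: Re_norm_ge0.
  have m0 : 0 < m by rewrite ltr_wpDl.
  have d0 : 0 < e / 2 / m by rewrite !divr_gt0.
  have e2 : 0 < e / 2 by rewrite divr_gt0.
  have ad : complex.Re `|a| * (e / 2 / m) <= e / 2.
    by rewrite mulrCA ler_piMr ?(ltW e2) // ler_pdivrMr // mul1r lerDl.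
  have [x' [Px Nx]] := Fx _ d0; have [y' [Py Ny]] := Fy _ e2.
  exists (a *: x' + y'); split; first exact: P_lin.
  rewrite opprD addrACA -scalerBr; apply: le_trans (snA.1 _ _) _.
  rewrite (splitr e); apply: lerD => //; apply: le_trans (NAZ _ _) _.
  exact: le_trans (ler_wpM2l a0 Nx) _.
- move=> x y Fx Fy e e0; pose m := NA x + NA y + 1.
  have m0 : 0 < m by rewrite ltr_wpDl // addr_ge0.
  pose t := Num.min 1 (e / m); have t0 : 0 < t by rewrite lt_min ltr01 divr_gt0.
  have t1 : t <= 1 by rewrite ge_min lexx.
  have tm : t * m <= e by rewrite -ler_pdivlMr // ge_min lexx orbT.
  have [x' [Px Nx]] := Fx _ t0; have [y' [Py Ny]] := Fy _ t0.
  exists (x' * y'); split; first exact: P_mul.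
  have Nx' : NA x' <= NA x + 1.
    apply: le_trans (seminorm_le_dist snA x' x) _.
    by rewrite (seminormC snA) lerD2l (le_trans Nx).
  have -> : x * y - x' * y' = (x - x') * y + x' * (y - y').
    by rewrite mulrBl mulrBr addrA subrK.
  apply: le_trans (snA.1 _ _) _; apply: (@le_trans _ _ (t * NA y + (NA x + 1) * t)).
    apply: lerD; apply: le_trans (NAM _ _) _; first by rewrite ler_wpM2r.
    by apply: ler_pM.
  by move: tm; rewrite /m; lra.
- move=> x Fx e /Fx[x' [Px Nx]]; exists (star x'); split; first exact: P_star.
  by rewrite -starB; apply: le_trans (NA_star _) _.
move=> v l Fv vl e e0; have e2 : 0 < e / 2 by rewrite divr_gt0.
have [n0 /(_ n0 (leqnn _)) h] := vl _ e2.
have [x' [Px Nx]] := Fv n0 _ e2; exists x'; split=> //.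
apply: le_trans (seminorm_dist snA _ (v n0) _) _; rewrite (splitr e); apply: lerD => //.
by rewrite (seminormC snA); apply: le_trans (NA_le _) (ltW h).
Qed.

End GeneratedDense.

(** * Norms of an operator algebra *)

Section OperatorAlgebraTheory.
Variables (R : realType) (X : opAlgType R).
Implicit Types (x y : X).

Lemma operator_repP : exists (H : hilbertType R) (rho : X -> H -> H),
  [/\ alg_rep rho, (forall x, bounded_op (rho x)),
      (forall x, oanorm x = opnorm (rho x)), injective rho &
      forall n (M : 'M[X]_n), mxnorm M = opmx_norm (map_mx rho M)].
Proof.
have [H [rho [ra _ ri rn]]] := @operator_rep R X; exists H, rho.
have rb x : bounded_op (rho x) by case: ra.
by split=> // x; rewrite /oanorm rn map_const_mx opmx_norm1.
Qed.

Lemma oanorm_seminorm : seminorm (@oanorm R X).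
Proof.
have [H [rho [[_ rl _] rb rn _ _]]] := operator_repP.
have rD x y h : rho (x + y) h = rho x h + rho y h.
  by have := rl 1 x y h; rewrite !scale1r.
have r0 h : rho 0 h = 0 by apply: (addrI (rho 0 h)); rewrite -rD !addr0.
have rN x h : rho (- x) h = - rho x h.
  by apply: (addrI (rho x h)); rewrite -rD !subrr r0.
split=> [x y|x]; rewrite !rn; last first.
  have le z : opnorm (rho (- z)) <= opnorm (rho z).
    apply: opnorm_le => [|h]; first exact: opnorm_ge0.
    by rewrite rN /hnorm dnormN; exact: opnormP.
  by apply/le_anti; rewrite le -{1}(opprK x) le.
apply: opnorm_le => [|h]; first by rewrite addr_ge0 ?opnorm_ge0.
by rewrite rD mulrDl; apply: le_trans (dnormD _ _ _) _; apply: lerD; exact: opnormP.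
Qed.

Lemma oanormZ (a : R[i]) x : oanorm (a *: x) <= complex.Re `|a| * oanorm x.
Proof.
have [H [rho [[_ rl _] rb rn _ _]]] := operator_repP.
have r0 h : rho 0 h = 0.
  by have := rl (-1) 0 0 h; rewrite !scaleN1r !addNr.
have a0 : 0 <= complex.Re `|a| by exact: Re_norm_ge0.
rewrite !rn; apply: opnorm_le => [|h]; first by rewrite mulr_ge0 ?opnorm_ge0.
have -> : rho (a *: x) h = a *: rho x h by have := rl a x 0 h; rewrite r0 !addr0.
by rewrite /hnorm dnormZ -mulrA ler_wpM2l //; exact: opnormP.
Qed.

Lemma oanormM x y : oanorm (x * y) <= oanorm x * oanorm y.
Proof.
have [H [rho [[_ _ rm] rb rn _ _]]] := operator_repP.
rewrite !rn; apply: opnorm_le => [|h]; first by rewrite mulr_ge0 ?opnorm_ge0.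
rewrite rm /= -mulrA; apply: le_trans (opnormP _ (rb x)) _.
by rewrite ler_wpM2l ?opnorm_ge0 //; exact: opnormP.
Qed.

Lemma oanorm0 : oanorm (0 : X) = 0.
Proof.
apply/le_anti; rewrite (seminorm_ge0 oanorm_seminorm) andbT.
by have := oanormZ 0 0; rewrite scale0r normr0 mul0r.
Qed.

Lemma mxnorm_lip n (M M' : 'M[X]_n) :
  mxnorm M <= mxnorm M' + \sum_i \sum_j oanorm (M i j - M' i j).
Proof.
have [H [rho [[_ rl _] rb rn _ rmx]]] := operator_repP.
have bmx (A : 'M[X]_n) : bounded_mx (map_mx rho A) by move=> i j; rewrite mxE.
rewrite !rmx; apply: le_trans (opmx_norm_lip (bmx M) (bmx M')) _; rewrite lerD2l.
apply: ler_sum => i _; apply: ler_sum => j _; rewrite rn !mxE le_eqVlt; apply/orP; left.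
apply/eqP; congr opnorm; apply/funext => h /=.
by have := rl (-1) (M' i j) (M i j) h; rewrite !scaleN1r ![- _ + _]addrC.
Qed.

End OperatorAlgebraTheory.

Lemma sum_I2 (V : nmodType) (F : 'I_2 -> V) : \sum_i F i = F 0 + F 1.
Proof. by rewrite big_ord_recl big_ord1; congr (_ + F _); exact: val_inj. Qed.

Lemma sqrt_mul_le (R : realType) (a b c q : R) : 0 <= q -> 0 <= a -> 0 <= b -> b <= c ->
  a ^+ 2 <= q * b ^+ 2 -> a <= Num.sqrt q * c.
Proof.
move=> q0 a0 b0 bc ab; have c0 : 0 <= c := le_trans b0 bc.
rewrite -ler_sqr ?nnegrE ?mulr_ge0 ?sqrtr_ge0 // exprMn sqr_sqrtr //.
by apply: (le_trans ab); rewrite ler_wpM2l // ler_sqr.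
Qed.



(** * The C*-envelope *)

Section RepNorm.
Variables (R : realType) (D : cstarType R) (K : hilbertType R).
Implicit Types (d x y : D).

(* By Gelfand-Naimark this is the norm of [D]; working with the supremum over
   the representations avoids that theorem. *)
Definition repnorm d : R := cstar_mxnorm (const_mx d : 'M[D]_1).

Lemma cstar_mxnorm_bound n (A : 'M[D]_n) (H : hilbertType R) (rho : D -> H -> H) :
  star_rep rho -> opmx_norm (map_mx rho A) <= \sum_i \sum_j cnorm (A i j).
Proof.
move=> rr; apply: opmx_norm_le => [|x].
  by apply: sumr_ge0 => i _; apply: sumr_ge0 => j _; exact: cnorm_ge0.
apply: le_trans (sumnorm_le_sum _) _; rewrite mulr_suml; apply: ler_sum => i _.
apply: le_trans (hnorm_sum _ _ _) _; rewrite mulr_suml; apply: ler_sum => j _.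
rewrite mxE; apply: le_trans (rep_contractive rr _ _) _.
by rewrite ler_wpM2l ?cnorm_ge0 ?sumnorm_coord.
Qed.

Lemma cstar_mxnorm_ge n (A : 'M[D]_n) (H : hilbertType R) (rho : D -> H -> H) :
  star_rep rho -> opmx_norm (map_mx rho A) <= cstar_mxnorm A.
Proof.
move=> rr; apply: ub_le_sup; last by exists H, rho.
by exists (\sum_i \sum_j cnorm (A i j)) => _ [H' [rho' [rr' ->]]]; exact: cstar_mxnorm_bound.
Qed.

(** Makes the set of which [cstar_mxnorm] is the supremum nonempty, so that upper bounds of the set
    bound the supremum. *)
Lemma zero_rep : star_rep (fun (_ : D) (_ : K) => 0 : K).
Proof.
split; first split=> // [x|a x y h]; first exact: bounded_op0.
  by rewrite scaler0 addr0.
by move=> x; exact: adjoint0.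
Qed.

Lemma cstar_mxnorm_le n (A : 'M[D]_n) (c : R) : 0 <= c ->
  (forall (H : hilbertType R) (rho : D -> H -> H), star_rep rho ->
     forall z, sumnorm (mxapp (map_mx rho A) z) <= c * sumnorm z) ->
  cstar_mxnorm A <= c.
Proof.
move=> c0 hc; apply: ge_sup.
  by eexists; exists K, (fun _ _ => 0); split; [exact: zero_rep|].
by move=> _ [H [rho [rr ->]]]; apply: opmx_norm_le => // x; exact: hc.
Qed.

Lemma repnormP d (H : hilbertType R) (rho : D -> H -> H) h :
  star_rep rho -> hnorm (rho d h) <= repnorm d * hnorm h.
Proof.
move=> rr; have bd := rep_bounded rr d; apply: le_trans (opnormP h bd) _.
rewrite ler_wpM2r ?dnorm_pos // -opmx_norm1 // -map_const_mx.
exact: cstar_mxnorm_ge.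
Qed.

Lemma repnorm_le d (c : R) : 0 <= c ->
  (forall (H : hilbertType R) (rho : D -> H -> H), star_rep rho ->
     forall h, hnorm (rho d h) <= c * hnorm h) -> repnorm d <= c.
Proof.
move=> c0 hc; apply: cstar_mxnorm_le => // H rho rr x.
by rewrite !sumnorm1 /mxapp big_ord1 !mxE; exact: hc.
Qed.

Lemma repnorm_ge0 d : 0 <= repnorm d.
Proof.
apply: le_trans (cstar_mxnorm_ge _ zero_rep); apply: opmx_norm_ge0.
exact: (map_rep_bounded zero_rep).
Qed.

Lemma repnorm_cnorm d : repnorm d <= cnorm d.
Proof. by apply: repnorm_le => [|H rho rr h]; [exact: cnorm_ge0 | exact: rep_contractive]. Qed.

Lemma repnorm_seminorm : seminorm repnorm.
Proof.
have le x : repnorm (- x) <= repnorm x.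
  apply: repnorm_le => [|H rho rr h]; first exact: repnorm_ge0.
  by rewrite (repN rr) /hnorm dnormN; exact: repnormP.
split=> [x y|x]; last by apply/le_anti; rewrite le -{1}(opprK x) le.
apply: repnorm_le => [|H rho rr h]; first by rewrite addr_ge0 ?repnorm_ge0.
rewrite (repD rr) mulrDl; apply: le_trans (dnormD _ _ _) _.
by apply: lerD; exact: repnormP.
Qed.

Lemma repnorm0 : repnorm 0 = 0.
Proof.
apply/le_anti; rewrite repnorm_ge0 andbT; apply: repnorm_le => // H rho rr h.
by rewrite (rep0 rr) hnorm0 mul0r.
Qed.

Lemma repnormZ (a : R[i]) d : repnorm (a *: d) <= complex.Re `|a| * repnorm d.
Proof.
have a0 : 0 <= complex.Re `|a| by exact: Re_norm_ge0.
apply: repnorm_le => [|H rho rr h]; first by rewrite mulr_ge0 ?repnorm_ge0.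
by rewrite (repZ rr) /hnorm dnormZ -mulrA ler_wpM2l //; exact: repnormP.
Qed.

Lemma repnormM x y : repnorm (x * y) <= repnorm x * repnorm y.
Proof.
apply: repnorm_le => [|H rho rr h]; first by rewrite mulr_ge0 ?repnorm_ge0.
rewrite (repM rr) -mulrA; apply: le_trans (repnormP _ _ rr) _.
by rewrite ler_wpM2l ?repnorm_ge0 //; exact: repnormP.
Qed.

Lemma repnorm_star d : repnorm (star d) <= repnorm d.
Proof.
apply: repnorm_le => [|H rho rr h]; first exact: repnorm_ge0.
apply: (adjoint_le (repnorm_ge0 d) (rr.2 d)) => g; exact: repnormP.
Qed.

End RepNorm.

(** Choose [d n] with images converging to [T] fast, replace each difference d(n+1) - d(n) by an
    element of comparable norm with the same image, and sum: the partial sums have the images of the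
    [d n] and now converge in [D]. *)
Lemma star_rep_range_closed (R : realType) (D : cstarType R) (K : hilbertType R)
    (rho : D -> K -> K) (T : K -> K) : star_rep rho ->
  (forall e : R, 0 < e -> exists d, op_close e T (rho d)) -> exists d, T = rho d.
Proof.
move=> rr appr; have snD := cnorm_seminorm D.
have p0 (n : nat) : 0 < 2^-1 ^+ n :> R by rewrite exprn_gt0 ?invr_gt0.
have /choice[d hd] : forall n : nat, exists d, op_close (2^-1 ^+ n) T (rho d).
  by move=> n; exact: appr.
have /choice[y hy] : forall n : nat, exists y,
    (forall h, rho y h = rho (d n.+1 - d n) h) /\ cnorm y <= 8 * 2^-1 ^+ n.
  (* Successive images differ by at most 2^(-n-1) + 2^(-n), below [s], and [lift_bounded] costs a
     factor 4. *)
  move=> n; pose s : R := 2 * 2^-1 ^+ n.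
  have s0 : 0 < s by rewrite mulr_gt0.
  have le h : hnorm (rho (d n.+1 - d n) h) <= s * hnorm h.
    rewrite (repB rr); have := op_close_trans (op_close_sym (hd n.+1)) (hd n) h.
    move=> /le_trans; apply; rewrite ler_wpM2r ?dnorm_pos // /s exprS.
    by have := p0 n; lra.
  have le' := adjoint_le (ltW s0) (rr.2 (d n.+1 - d n)) le.
  have [y [ry Ny]] := lift_bounded rr s0 le le'.
  by exists y; split=> //; apply: le_trans Ny _; rewrite /s; lra.
pose x n := d 0%N + \sum_(i < n) y i.
have xS n : x n.+1 = x n + y n by rewrite /x big_ord_recr addrA.
have rx n h : rho (x n) h = rho (d n) h.
  elim: n => [|n IHn]; first by rewrite /x big_ord0 addr0.
  by rewrite xS (repD rr) IHn (hy n).1 (repB rr) addrC subrK.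
have dist n k : cnorm (x (n + k)%N - x n) <= 16 * 2^-1 ^+ n - 16 * 2^-1 ^+ (n + k).
  elim: k => [|k IHk]; first by rewrite addn0 !subrr cnorm0.
  rewrite addnS xS addrAC; apply: le_trans (cnormD _ _) _.
  have := (hy (n + k)%N).2; rewrite (exprS _ (n + k)%N); lra.
have xC : ncauchy (@cnorm R D) x.
  (* The tails of Σ 8 · 2^(-n) are 16 · 2^(-n), and two of them are compared. *)
  move=> e e0; have [n hn] : exists n, 2^-1 ^+ n * 32 < e.
    have e3 : 0 < e / 32 by lra.
    have [n0 h0] := harmonic_small e3; exists n0.+1.
    rewrite -ltr_pdivlMr //; apply: lt_le_trans (h0 n0 (leqnn _)).
    have : 2^-1 ^+ n0.+1 < (n0.+1%:R)^-1 :> R.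
      rewrite exprVn ltf_pV2 ?posrE ?exprn_gt0 //.
      by rewrite -natrX ltr_nat ltn_expl.
    by [].
  exists n => a b na nb; have := dist n (a - n)%N; have := dist n (b - n)%N.
  rewrite !subnKC //; have := p0 a; have := p0 b.
  have := seminorm_dist snD (x a) (x n) (x b); rewrite (seminormC snD (x n)); lra.
have [l xl] := @cnorm_complete R D _ xC; exists l; apply/funext => h.
have sn := dnorm_seminorm (@inner R K).
apply: (ncvg_unique sn (@dnorm_eq0P _ _ _) (u := fun n => rho (x n) h)).
  move=> e e0; have e1 : 0 < e / (hnorm h + 1) by rewrite divr_gt0 // ltr_wpDl ?dnorm_pos.
  have [n0 h0] := harmonic_small e1; exists n0 => n n0n; rewrite rx.
  have h1 : 0 < hnorm h + 1 by rewrite ltr_wpDl ?dnorm_pos.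
  apply: le_lt_trans (op_close_sym (hd n) h) _.
  apply: (@le_lt_trans _ _ (e / (hnorm h + 1) * hnorm h)).
    rewrite ler_wpM2r ?dnorm_pos //; apply: le_trans (h0 n n0n).
    by rewrite exprVn lef_pV2 ?posrE ?exprn_gt0 // -natrX ler_nat ltn_expl.
  by rewrite mulrAC ltr_pdivrMr // ltr_pM2l // ltrDl.
apply: (ncvg_lip (F := fun z => rho z h) (dnorm_pos inner h) _ xl) => u v.
by rewrite -(repB rr) mulrC; exact: rep_contractive.
Qed.

(** * Embedding the semicrossed product in the crossed product *)

Section Embedding.
Variables (R : realType) (C : cstarType R) (alpha : C -> C).
Hypothesis alpha_aut : star_automorphism alpha.
Variables (H0 : hilbertType R) (pi : C -> H0 -> H0).
Hypotheses (pi_rep : star_rep pi) (pi_inj : injective pi).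
Variables (X : opAlgType R) (kappa : (nat -> C) -> X).
Hypothesis X_sc : is_semicrossed_product alpha kappa.
Local Notation ph := (pihat alpha pi).
Local Notation U := (@bishift R H0).
Local Notation B := (reduced_crossed_product alpha pi).
Implicit Types (s t : seq (nat * C)) (F G : nat -> C).

Let ph_rep : star_rep ph := pihat_star_rep alpha_aut pi_rep.

Lemma pihat_covariant : left_covariant_pair alpha ph U.
Proof.
split; first exact: ph_rep.
  by split; [exact: bishift_bounded | exact: bishift_le].
move=> x; apply/funext => f; have := pihat_shift alpha_aut pi_rep x 1 f.
by rewrite (alphaX_iter alpha 1).
Qed.

Lemma l1_delta n (x : C) : l1 (delta n x).
Proof. exact: (fin_supp_l1 (@delta_supp R C n x)). Qed.

Lemma kappaP (a : R[i]) F G : l1 F -> l1 G -> kappa (a *: F + G) = a *: kappa F + kappa G.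
Proof. by case: X_sc => h _ _ _ _; exact: h. Qed.

Lemma l1_0 : l1 (0 : nat -> C).
Proof. by apply: (@fin_supp_l1 R C 0%N). Qed.

Lemma kappa0 : kappa 0 = 0.
Proof. by have := kappaP (-1) l1_0 l1_0; rewrite !scaleN1r !addNr. Qed.

Lemma kappaD F G : l1 F -> l1 G -> kappa (F + G) = kappa F + kappa G.
Proof. by move=> lF lG; have := kappaP 1 lF lG; rewrite !scale1r. Qed.

Lemma kappa_deltaM n m (x y : C) :
  kappa (delta n x) * kappa (delta m y) = kappa (delta (n + m) (iter m alpha x * y)).
Proof.
case: X_sc => _ kM _ _ _; rewrite -kM; try exact: l1_delta; congr kappa.
apply/funext => k; rewrite /lmul /delta.
have a0 i : iter i alpha 0 = 0 by exact: (star_hom0 (star_hom_iter i (alpha_hom alpha_aut))).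
have [->|kn] := eqVneq k (n + m)%N.
  have mk : (m < (n + m).+1)%N by lia.
  rewrite (bigD1 (Ordinal mk)) //= addnK !eqxx big1 ?addr0 // => i ni.
  have [im|_] := eqVneq (i : nat) m; last by rewrite mulr0.
  by case/eqP: ni; apply/val_inj.
rewrite big1 // => i _; have [im|_] := eqVneq (i : nat) m; last by rewrite mulr0.
have [kin|_] := eqVneq (k - i)%N n; last by rewrite a0 mul0r.
by case/eqP: kn; have := ltn_ord i; lia.
Qed.

(** One list of pairs (degree, coefficient) is read in X by [kpoly], on l²(Z; H0) by [bpoly] and in
    l1 by [coef], so identities of lists carry over from one side to the other. *)
Definition kpoly s : X := \sum_(p <- s) kappa (delta p.1 p.2).
Definition bpoly s : l2Z H0 -> l2Z H0 := laurent alpha pi [seq (p.1%:Z, p.2) | p <- s].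

Lemma kpoly_cat s t : kpoly (s ++ t) = kpoly s + kpoly t.
Proof. by rewrite /kpoly big_cat. Qed.

Lemma deltaZ n (a : R[i]) (x : C) : delta n (a *: x) = a *: delta n x + 0 :> (nat -> C).
Proof. by apply/funext => k; rewrite !fctE /delta addr0; case: eqP => // _; rewrite scaler0. Qed.

Lemma kpolyZ (a : R[i]) s : kpoly [seq (p.1, a *: p.2) | p <- s] = a *: kpoly s.
Proof.
rewrite /kpoly big_map scaler_sumr; apply: eq_bigr => p _ /=.
by rewrite deltaZ kappaP ?kappa0 ?addr0 //; [exact: l1_delta | exact: l1_0].
Qed.

Definition poly_mul s t : seq (nat * C) :=
  [seq ((p.1 + q.1)%N, iter q.1 alpha p.2 * q.2) | p <- s, q <- t].

Lemma kpolyM s t : kpoly (poly_mul s t) = kpoly s * kpoly t.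
Proof.
rewrite /kpoly big_allpairs_dep mulr_suml; apply: eq_bigr => p _ /=.
by rewrite mulr_sumr; apply: eq_bigr => q _; rewrite kappa_deltaM.
Qed.

Lemma bpolyM s t f : bpoly (poly_mul s t) f = bpoly s (bpoly t f).
Proof.
rewrite /bpoly -(laurentM alpha_aut pi_rep); congr (laurent _ _ _ f).
by rewrite /poly_mul allpairs_mapl allpairs_mapr map_allpairs.
Qed.

Lemma bpoly_lin (a : R[i]) s t f :
  bpoly ([seq (p.1, a *: p.2) | p <- s] ++ t) f = a *: bpoly s f + bpoly t f.
Proof.
rewrite /bpoly map_cat laurent_cat -(laurentZ alpha_aut pi_rep) -!map_comp.
by congr (laurent _ _ _ _ + _).
Qed.

Lemma bpoly_bounded s : bounded_op (bpoly s).
Proof. exact: laurent_bounded. Qed.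

Definition coef s : nat -> C := \sum_(p <- s) delta p.1 p.2.

Lemma coef_cons p s : coef (p :: s) = delta p.1 p.2 + coef s.
Proof. by rewrite /coef big_cons. Qed.

Lemma coef_supp s : exists L0, forall L, (L0 <= L)%N -> fin_supp L (coef s).
Proof.
elim: s => [|p s [L0 hL0]].
  by exists 0%N => L _ n _; rewrite /coef big_nil.
exists (maxn p.1.+1 L0) => L; rewrite geq_max => /andP[pL L0L] n Ln.
rewrite coef_cons -[LHS]/(delta _ _ _ + coef s n) (hL0 L) // addr0; apply: (@delta_supp _ _ p.1).
exact: leq_trans pL Ln.
Qed.

Lemma coef_l1 s : l1 (coef s).
Proof. by have [L0 h] := coef_supp s; exact: fin_supp_l1 (h _ (leqnn _)). Qed.

Lemma kappa_coef s : kappa (coef s) = kpoly s.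
Proof.
elim: s => [|p s IHs]; first by rewrite /coef /kpoly !big_nil kappa0.
rewrite coef_cons kappaD; [|exact: l1_delta|exact: coef_l1].
by rewrite IHs /kpoly big_cons.
Qed.

Lemma fin_repD (H : hilbertType R) (rho : C -> H -> H) (T : H -> H) L F G h :
  star_rep rho -> bounded_op T ->
  fin_rep rho T L (F + G) h = fin_rep rho T L F h + fin_rep rho T L G h.
Proof.
move=> rr bT; rewrite /fin_rep -big_split; apply: eq_bigr => n _ /=.
by rewrite fctE (repD rr) (opD _ _ (iter_bounded _ bT)).
Qed.

Lemma fin_rep_delta (H : hilbertType R) (rho : C -> H -> H) (T : H -> H) L n (x : C) h :
  star_rep rho -> bounded_op T -> (n < L)%N ->
  fin_rep rho T L (delta n x) h = iter n T (rho x h).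
Proof.
move=> rr bT nL; rewrite /fin_rep (bigD1 (Ordinal nL)) //= /delta eqxx big1 ?addr0 //.
move=> i; rewrite -val_eqE /= => /negPf ->.
by rewrite (rep0 rr) (op0 (iter_bounded _ bT)).
Qed.

(** Stated for all large [L], so that a common [L] serves all entries of a matrix. *)
Lemma fin_rep_coef s : exists L0, forall L, (L0 <= L)%N ->
  fin_supp L (coef s) /\ fin_rep ph U L (coef s) = bpoly s.
Proof.
have bU := bishift_bounded H0.
elim: s => [|p s [L0 hL0]].
  exists 0%N => L _; split; first by move=> n _; rewrite /coef big_nil.
  apply/funext => f; rewrite /bpoly /laurent /coef !big_nil /fin_rep big1 // => n _.
  by rewrite (rep0 ph_rep) (op0 (iter_bounded _ bU)).
exists (maxn p.1.+1 L0) => L; rewrite geq_max => /andP[pL L0L].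
have [supp E] := hL0 L L0L; split.
  move=> n Ln; rewrite coef_cons -[LHS]/(delta _ _ _ + coef s n) supp // addr0.
  apply: (@delta_supp _ _ p.1).
  exact: leq_trans pL Ln.
apply/funext => f; rewrite coef_cons (fin_repD _ _ _ _ ph_rep bU).
rewrite (fin_rep_delta _ _ ph_rep bU pL) E.
by rewrite /bpoly /laurent big_cons.
Qed.

Lemma left_covariantP (H : hilbertType R) (rho : C -> H -> H) (T : H -> H) :
  left_covariant_pair alpha rho T -> star_rep rho /\ covariant alpha rho T.
Proof.
move=> [rr [bT cT] cov]; split=> //; split=> // x h.
by have := congr1 (fun S => S h) (cov x).
Qed.

(** The supremum defining the semicrossed norm is attained: [covariant_pair_le] bounds it by the
    pair (π̂, U), which is itself a covariant pair. *)
Lemma mxnorm_kpoly n (S : 'I_n -> 'I_n -> seq (nat * C)) :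
  mxnorm (\matrix_(i, j) kpoly (S i j)) = opmx_norm (\matrix_(i, j) bpoly (S i j)).
Proof.
have /choice[L0 hL0] : forall ij : 'I_n * 'I_n, exists L0, forall L, (L0 <= L)%N ->
    fin_supp L (coef (S ij.1 ij.2)) /\ fin_rep ph U L (coef (S ij.1 ij.2)) = bpoly (S ij.1 ij.2).
  by move=> ij; exact: fin_rep_coef.
pose L := (\max_(ij : 'I_n * 'I_n) L0 ij)%N.
have hL i j : fin_supp L (coef (S i j)) /\ fin_rep ph U L (coef (S i j)) = bpoly (S i j).
  by apply: (hL0 (i, j)); exact: (leq_bigmax (i, j)).
pose F := \matrix_(i, j) coef (S i j) : 'M[nat -> C]_n.
have -> : \matrix_(i, j) kpoly (S i j) = map_mx kappa F.
  by apply/matrixP => i j; rewrite !mxE kappa_coef.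
have [_ _ _ nrm _] := X_sc; rewrite nrm; last by move=> i j; rewrite mxE; exact: coef_l1.
have repE (H : hilbertType R) (rho : C -> H -> H) (T : H -> H) :
    star_rep rho -> bounded_op T ->
    map_mx (covariant_rep rho T) F = \matrix_(i, j) fin_rep rho T L (coef (S i j)).
  move=> rr bT; apply/matrixP => i j; rewrite !mxE (covariant_rep_fin rr bT (hL i j).1) //.
have JE : \matrix_(i, j) fin_rep ph U L (coef (S i j)) = \matrix_(i, j) bpoly (S i j).
  by apply/matrixP => i j; rewrite !mxE (hL i j).2.
have ub r : (exists (H : hilbertType R) (rho : C -> H -> H) (T : H -> H),
    left_covariant_pair alpha rho T /\ r = opmx_norm (map_mx (covariant_rep rho T) F)) ->
    r <= opmx_norm (\matrix_(i, j) bpoly (S i j)).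
  move=> [H [rho [T [/left_covariantP[rr cov] ->]]]]; have [bT _ _] := cov.
  rewrite repE // -JE.
  exact: (covariant_pair_le alpha_aut pi_rep pi_inj (fun i j => (hL i j).1) rr cov).
have in_set : exists (H : hilbertType R) (rho : C -> H -> H) (T : H -> H),
    left_covariant_pair alpha rho T /\
    opmx_norm (\matrix_(i, j) bpoly (S i j)) = opmx_norm (map_mx (covariant_rep rho T) F).
  exists (l2Z H0), ph, U; split; first exact: pihat_covariant.
  by rewrite repE ?JE //; exact: bishift_bounded.
apply/le_anti/andP; split.
  by apply: ge_sup; [eexists; exact: in_set | move=> r; exact: ub].
by apply: ub_le_sup; [exists (opmx_norm (\matrix_(i, j) bpoly (S i j))) => r; exact: ub |].
Qed.

Lemma oanorm_kpoly s : oanorm (kpoly s) = opnorm (bpoly s).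
Proof.
have := @mxnorm_kpoly 1 (fun _ _ => s).
have -> : \matrix_(i, j) kpoly s = const_mx (kpoly s) :> 'M[X]_1.
  by apply/matrixP => i j; rewrite !mxE.
have -> : \matrix_(i, j) bpoly s = const_mx (bpoly s) :> 'M_1 by apply/matrixP => i j; rewrite !mxE.
by rewrite opmx_norm1 //; exact: bpoly_bounded.
Qed.

Lemma oanorm_kappa_le F (c : R) : l1 F -> 0 <= c ->
  (forall k, series (fun n => cnorm (F n)) k <= c) -> oanorm (kappa F) <= c.
Proof.
move=> lF c0 Fc; rewrite /oanorm -map_const_mx.
have [_ _ _ nrm _] := X_sc; rewrite nrm; last by move=> i j; rewrite mxE.
apply: ge_sup; first by eexists; exists (l2Z H0), ph, U; split; [exact: pihat_covariant|].
move=> r [H [rho [T [[rr cT _] ->]]]]; apply: opmx_norm_le => // x.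
rewrite !sumnorm1 /mxapp big_ord1 !mxE; exact: covariant_rep_le.
Qed.

(** Half of [e] is spent on approximating by l1, the other half on cutting off the tail of the l1
    series, whose seminorm [oanorm_kappa_le] controls. *)
Lemma kpoly_dense x (e : R) : 0 < e -> exists s, oanorm (x - kpoly s) <= e.
Proof.
move=> e0; have e2 : 0 < e / 2 by rewrite divr_gt0.
have snX := oanorm_seminorm X.
have [_ _ _ _ dense] := X_sc; have [_ [F lF <-] xF] := dense x _ e2.
have mono (L k : nat) : (L <= k)%N ->
    series (fun n => cnorm (F n)) L <= series (fun n => cnorm (F n)) k.
  move=> Lk; rewrite /series /= (big_cat_nat (leq0n L) Lk) /= lerDl.
  by rewrite sumr_ge0 // => i _; exact: cnorm_ge0.
have bound k : series (fun n => cnorm (F n)) k <= limn (series (fun n => cnorm (F n))).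
  by apply: nondecreasing_cvgn_le; [move=> L k' Lk; exact: mono | exact: lF].
have [L hL] : exists L, limn (series (fun n => cnorm (F n))) - e / 2 <=
    series (fun n => cnorm (F n)) L.
  have /cvgrPdist_lt/(_ _ e2)[L _ /(_ L (leqnn L)) /=] := lF.
  by rewrite ltr_norml => /andP[_ h]; exists L; lra.
pose s := [seq (n, F n) | n <- iota 0 L].
have sE n : coef s n = if (n < L)%N then F n else 0.
  rewrite /coef fct_sumE big_map.
  have [nL|Ln] := ltnP n L.
    rewrite (bigD1_seq n) ?mem_iota ?iota_uniq //= /delta eqxx big1 ?addr0 //.
    by move=> i ni; rewrite eq_sym (negPf ni).
  rewrite big_seq big1 // => i; rewrite mem_iota add0n => /= iL.
  by rewrite /delta gtn_eqF // (leq_trans iL).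
exists s; apply: le_trans (seminorm_dist snX x (kappa F) _) _.
rewrite (splitr e); apply: lerD; first exact: ltW.
have -> : kappa F - kpoly s = kappa ((-1) *: coef s + F).
  by rewrite kappaP ?kappa_coef ?scaleN1r 1?addrC //; exact: coef_l1.
have DE n : ((-1) *: coef s + F) n = if (n < L)%N then 0 else F n.
  by rewrite !fctE sE scaleN1r; case: ifP; rewrite ?addNr ?oppr0 ?add0r.
have ser k : series (fun n => cnorm (((-1) *: coef s + F) n)) k <= e / 2.
  have -> : series (fun n => cnorm (((-1) *: coef s + F) n)) k =
      series (fun n => cnorm (F n)) k - series (fun n => cnorm (F n)) (minn L k).
    rewrite /series /=; have mk : (minn L k <= k)%N by lia.
    rewrite [X in _ = X - _](big_cat_nat (leq0n _) mk) /= [RHS]addrC addrA addNr add0r.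
    rewrite (big_cat_nat (leq0n _) mk) /= big_nat_cond big1 ?add0r => [|i]; last first.
      move=> /andP[/andP[_ ik] _]; rewrite DE (_ : (i < L)%N) ?cnorm0 //; lia.
    rewrite big_nat_cond [RHS]big_nat_cond; apply: eq_bigr => i /andP[/andP[ki ik] _].
    by rewrite DE ifF //; lia.
  have [Lk|kL] := leqP L k; last first.
    by rewrite subrr ltW.
  by have := bound k; lra.
apply: oanorm_kappa_le => //; last exact: ltW.
rewrite /l1 /=; apply: nondecreasing_is_cvgn.
  by apply: nondecreasing_series => k _ _; exact: cnorm_ge0.
by exists (e / 2) => _ [k _ <-]; exact: ser.
Qed.

Let snX := oanorm_seminorm X.

(** The relation [kpoly s] to [bpoly s] is isometric by [oanorm_kpoly], so it extends from its dense
    domain. *)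
Lemma embedding_exists : exists j : X -> l2Z H0 -> l2Z H0,
  [/\ alg_rep j, (forall s, j (kpoly s) = bpoly s) &
      forall x h, hnorm (j x h) <= oanorm x * hnorm h].
Proof.
pose Q (a : X) (T : l2Z H0 -> l2Z H0) := exists s, a = kpoly s /\ T = bpoly s.
have [||||||j [ja jQ jle _]] := @dense_extension R X (@oanorm R X) (l2Z H0) snX
    (oanorm0 X) _ _ Q.
- exact: oanormZ.
- exact: oanormM.
- move=> _ _ [s [-> ->]]; split; first exact: bpoly_bounded.
  move=> h; rewrite oanorm_kpoly.
  by apply: opnormP; exact: bpoly_bounded.
- move=> c _ _ _ _ [s [-> ->]] [t [-> ->]].
  exists ([seq (p.1, c *: p.2) | p <- s] ++ t); split.
    by rewrite kpoly_cat kpolyZ.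
  by apply/funext => f; rewrite bpoly_lin.
- move=> _ _ _ _ [s [-> ->]] [t [-> ->]].
  exists (poly_mul s t); split; first by rewrite kpolyM.
  by apply/funext => f; rewrite bpolyM.
- move=> a e e0; have [s hs] := kpoly_dense a e0.
  by exists (kpoly s), (bpoly s); split=> //; exists s.
exists j; split=> // s; apply: jQ; by exists s.
Qed.

Variable j : X -> l2Z H0 -> l2Z H0.
Hypotheses (j_alg : alg_rep j) (j_kpoly : forall s, j (kpoly s) = bpoly s).
Hypothesis j_le : forall x h, hnorm (j x h) <= oanorm x * hnorm h.

Lemma embedding_bounded x : bounded_op (j x). Proof. by case: j_alg. Qed.

Lemma embeddingB x y h : j (x - y) h = j x h - j y h.
Proof.
case: j_alg => _ l _; have := l (-1) y x h.
by rewrite !scaleN1r ![- _ + _]addrC.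
Qed.

Lemma embedding_close x y (e : R) : oanorm (x - y) <= e -> op_close e (j x) (j y).
Proof.
move=> xy h; rewrite -embeddingB; apply: le_trans (j_le _ _) _.
by rewrite ler_wpM2r ?dnorm_pos.
Qed.

Lemma embedding_crossed x : B (j x).
Proof.
apply: crossed_closed => //; first exact: embedding_bounded.
move=> e e0; have [s hs] := kpoly_dense x e0.
exists (bpoly s); first exact: crossed_laurent.
by rewrite -j_kpoly; exact: embedding_close.
Qed.

Lemma embedding_delta n (x : C) : j (kappa (delta n x)) = bishiftX (Posz n) \o ph x.
Proof.
have -> : kappa (delta n x) = kpoly [:: (n, x)] by rewrite /kpoly big_seq1.
rewrite j_kpoly; apply/funext => f; by rewrite /bpoly /laurent /= big_seq1.
Qed.

Lemma embedding1 : j 1 = ph 1.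
Proof.
have [_ _ <- _ _] := X_sc; rewrite embedding_delta.
exact/funext.
Qed.

(** [pi] may be degenerate, so the unit is π̂(1); it commutes with U because [alpha] fixes 1. *)
Lemma crossed_unit T : B T -> j 1 \o T = T /\ T \o j 1 = T.
Proof.
move=> BT; have [bT appr] := (crossedP alpha_aut pi_rep T).1 BT.
have E_le h : hnorm (ph 1 h) <= hnorm h := rep1_le ph_rep h.
have bE := rep_bounded ph_rep 1.
have El (s : seq (int * C)) h : ph 1 (laurent alpha pi s h) = laurent alpha pi s h.
  rewrite /laurent (op_sum _ _ _ bE); apply: eq_bigr => p _.
  by rewrite (pihat_shift alpha_aut pi_rep) (alphaX1 alpha_aut) -(repM ph_rep) mul1r.
have lE (s : seq (int * C)) h : laurent alpha pi s (ph 1 h) = laurent alpha pi s h.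
  by rewrite /laurent; apply: eq_bigr => p _; rewrite (rep1 ph_rep).
rewrite embedding1; apply: op_close_unit => // e /appr[s cl].
exists (laurent alpha pi s); split=> //; apply/funext => h; [exact: El | exact: lE].
Qed.

Lemma embedding_mxnorm n (M : 'M[X]_n) : opmx_norm (map_mx j M) = mxnorm M.
Proof.
have bj : bounded_mx (map_mx j M) by move=> i k; rewrite mxE; exact: embedding_bounded.
have close (e : R) : 0 < e -> exists S : 'I_n -> 'I_n -> seq (nat * C),
    \sum_i \sum_k oanorm (M i k - kpoly (S i k)) <= e.
  move=> e0; pose d := e / (n * n).+1%:R; have d0 : 0 < d by rewrite divr_gt0.
  have /choice[S hS] : forall ik : 'I_n * 'I_n, exists s,
      oanorm (M ik.1 ik.2 - kpoly s) <= d.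
    by move=> ik; exact: kpoly_dense.
  exists (fun i k => S (i, k)).
  apply: (@le_trans _ _ (\sum_(i < n) \sum_(k < n) d)).
    by apply: ler_sum => i _; apply: ler_sum => k _; exact: (hS (i, k)).
  rewrite !sumr_const !card_ord -mulrnA -[_ *+ (n * n)]mulr_natr /d mulrAC ler_pdivrMr //.
  by rewrite ler_pM2l // ler_nat.
have bb (S : 'I_n -> 'I_n -> seq (nat * C)) : bounded_mx (\matrix_(i, k) bpoly (S i k)).
  by move=> i k; rewrite mxE; exact: bpoly_bounded.
have opd x y : opnorm (j x \- j y) <= oanorm (x - y).
  apply: opnorm_le => [|h]; first exact: (seminorm_ge0 snX).
  by rewrite /= -embeddingB; exact: j_le.
apply/le_anti/andP; split; apply/ler_addgt0Pr => e e0;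
  have e2 : 0 < e / 2 by rewrite divr_gt0.
all: have [S hS] := close _ e2; have nE := mxnorm_kpoly S.
all: have sumle (P : 'I_n -> 'I_n -> R) :
    (forall i k, P i k <= oanorm (M i k - kpoly (S i k))) -> \sum_i \sum_k P i k <= e / 2.
  1,3: by move=> h; apply: le_trans hS; apply: ler_sum => i _; apply: ler_sum.
- apply: le_trans (opmx_norm_lip bj (bb S)) _; rewrite -nE (splitr e) addrA.
  apply: lerD; last by apply: sumle => i k; rewrite !mxE -j_kpoly opd.
  apply: le_trans (mxnorm_lip _ M) _; rewrite lerD2l.
  by apply: sumle => i k; rewrite !mxE (seminormC snX).
apply: le_trans (mxnorm_lip M (\matrix_(i, k) kpoly (S i k))) _.
rewrite nE (splitr e) addrA; apply: lerD; last by apply: sumle => i k; rewrite !mxE.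
apply: le_trans (opmx_norm_lip (bb S) bj) _; rewrite lerD2l.
by apply: sumle => i k; rewrite !mxE -j_kpoly (seminormC snX) opd.
Qed.

(** Nonnegative powers of U lie in the range of [j]; the negative ones are adjoints of such
    elements. *)
Lemma crossed_minimal (E : set (l2Z H0 -> l2Z H0)) :
  is_operator_cstar E -> range j `<=` E -> B `<=` E.
Proof.
move=> [_ [E0 Elin] Emul Eadj Ecl] jE T BT.
have Egen m (x : C) : E (bishiftX m \o ph x).
  case: m => n; first by rewrite -embedding_delta; apply: jE; exists (kappa (delta n x)).
  (* The coefficient is chosen so that the adjoint of this operator is U^(-n-1) π̂(x). *)
  have Ed : E (bishiftX n.+1%:Z \o ph (alphaX alpha n.+1%:Z (star x))).
    by rewrite -[bishiftX _]/(bishiftX (Posz n.+1)) -embedding_delta; apply: jE;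
       exists (kappa (delta n.+1 (alphaX alpha n.+1%:Z (star x)))).
  have [S ES adjS] := Eadj _ Ed.
  rewrite (_ : bishiftX (Negz n) \o ph x = S) //.
  apply: (adjoint_unique _ adjS) => f g.
  rewrite /comp bishiftX_adj (rep_adj ph_rep); congr (inner f _).
  rewrite (pihat_shift alpha_aut pi_rep); congr (bishiftX _ (ph _ g)).
  have [_ _ st] := alphaX_hom alpha_aut n.+1%:Z.
  by rewrite st starK -(alphaXD alpha_aut) addNr.
have Elaurent (s : seq (int * C)) : E (laurent alpha pi s).
  elim: s => [|p s IHs].
    rewrite (_ : laurent _ _ _ = fun=> 0) //.
    by apply/funext => f; rewrite /laurent big_nil.
  rewrite (_ : laurent _ _ _ = fun f => 1 *: (bishiftX p.1 \o ph p.2) f + laurent alpha pi s f).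
    exact: Elin.
  by apply/funext => f; rewrite /laurent big_cons scale1r.
have [bT appr] := (crossedP alpha_aut pi_rep T).1 BT.
apply: Ecl => // e e0; have e2 : 0 < e / 2 by rewrite divr_gt0.
have [s cl] := appr _ e2; exists (laurent alpha pi s) => //.
have := (op_close_opnorm bT (laurent_bounded alpha_aut pi_rep s) (ltW e2)).1 cl; lra.
Qed.

(** * A C*-algebra containing a completely isometric copy of X *)

Variables (D : cstarType R) (iota : X -> D).
Hypothesis iota_ci : unital_hom_ci iota.
Local Notation K := (l2Z H0).
Local Notation rn := (@repnorm R D).
Implicit Types (d : D).

(** Representations send this element to contractions, which in general are not unitary. *)
Definition gen_u : D := iota (kappa (delta 1 1)).
Definition gen_c (x : C) : D := iota (kappa (delta 0 x)).
Local Notation u := gen_u.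

Lemma iotaP (a : R[i]) (x y : X) : iota (a *: x + y) = a *: iota x + iota y.
Proof. by case: iota_ci. Qed.

Lemma iotaM (x y : X) : iota (x * y) = iota x * iota y.
Proof. by case: iota_ci. Qed.

Lemma iota1 : iota 1 = 1. Proof. by case: iota_ci. Qed.

Lemma iota0 : iota 0 = 0.
Proof. by have := iotaP (-1) 0 0; rewrite !scaleN1r !addNr. Qed.

Lemma iotaD (x y : X) : iota (x + y) = iota x + iota y.
Proof. by have := iotaP 1 x y; rewrite !scale1r. Qed.

Lemma iotaB (x y : X) : iota (x - y) = iota x - iota y.
Proof. by have := iotaP (-1) y x; rewrite !scaleN1r ![- _ + _]addrC. Qed.

Lemma iota_norm (x : X) : rn (iota x) = oanorm x.
Proof. by case: iota_ci => _ _ _ h; rewrite /repnorm -map_const_mx h. Qed.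

Lemma gen_c1 : gen_c 1 = 1.
Proof. by rewrite /gen_c; case: X_sc => _ _ -> _ _; exact: iota1. Qed.

Lemma gen_cM (x y : C) : gen_c (x * y) = gen_c x * gen_c y.
Proof. by rewrite /gen_c -iotaM kappa_deltaM. Qed.

Lemma gen_cP (a : R[i]) (x y : C) : gen_c (a *: x + y) = a *: gen_c x + gen_c y.
Proof.
rewrite /gen_c -iotaP -kappaP; try exact: l1_delta; congr (iota (kappa _)).
by apply/funext => k; rewrite !fctE /delta; case: eqP => // _; rewrite scaler0 addr0.
Qed.

Lemma iota_delta n (x : C) : iota (kappa (delta n x)) = u ^+ n * gen_c x.
Proof.
elim: n => [|n IHn]; first by rewrite expr0 mul1r.
rewrite exprS -mulrA -IHn -iotaM kappa_deltaM add1n.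
by rewrite -(alphaX_iter alpha) (alphaX1 alpha_aut) mul1r.
Qed.

Lemma iota_kpoly s : iota (kpoly s) = \sum_(p <- s) u ^+ p.1 * gen_c p.2.
Proof.
elim: s => [|p s IHs]; first by rewrite /kpoly !big_nil iota0.
by rewrite /kpoly !big_cons iotaD iota_delta -IHs.
Qed.

Lemma gen_cov (x : C) : gen_c x * u = u * gen_c (alpha x).
Proof. by rewrite /gen_c -!iotaM !kappa_deltaM /= mulr1 mul1r. Qed.

Lemma gen_covX n (x : C) : gen_c x * u ^+ n = u ^+ n * gen_c (iter n alpha x).
Proof.
elim: n x => [|n IHn] x; first by rewrite !expr0 mulr1 mul1r.
by rewrite exprS mulrA gen_cov -mulrA IHn mulrA -iterSr.
Qed.

Lemma oanorm_delta n (x : C) : oanorm (kappa (delta n x)) <= cnorm x.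
Proof.
have -> : kappa (delta n x) = kpoly [:: (n, x)] by rewrite /kpoly big_seq1.
rewrite oanorm_kpoly.
apply: opnorm_le => [|f]; first exact: cnorm_ge0.
rewrite /bpoly /laurent big_seq1 bishiftX_norm; exact: pihat_le.
Qed.

Lemma repnorm_u : rn u <= 1.
Proof. rewrite iota_norm; exact: le_trans (oanorm_delta _ _) (cnorm1_le C). Qed.

Section OneRep.
Variables (H : hilbertType R) (rho : D -> H -> H).
Hypothesis rr : star_rep rho.
Local Notation nH := (@hnorm R H).

Lemma rep_u_le h : nH (rho u h) <= nH h.
Proof.
apply: le_trans (repnormP _ _ rr) _; rewrite ler_piMl ?dnorm_pos ?repnorm_u //.
Qed.

Lemma rep_uX_le k h : rho 1 h = h -> nH (rho (u ^+ k) h) <= nH h.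
Proof.
move=> h1; elim: k => [|k IHk]; first by rewrite expr0 h1.
by rewrite exprS (repM rr); apply: le_trans (rep_u_le _) _.
Qed.

(** [iota] is only a homomorphism; compatibility with the involution on the copy of [C] is automatic
    by contractivity. *)
Lemma rep_gen_c_star : star_rep (fun x => rho (gen_c x)).
Proof.
apply: contractive_rep_star.
- split=> [x|a x y h|x y]; first exact: rep_bounded.
    by rewrite gen_cP (repP rr).
  by apply/funext => h; rewrite gen_cM /= (repM rr).
- move=> x h; apply: le_trans (repnormP _ _ rr) _; rewrite ler_wpM2r ?dnorm_pos //.
  by rewrite iota_norm oanorm_delta.
- by move=> h k; rewrite gen_c1 (rep_adj rr) star1.
Qed.

(** The loss of squared norm under u^k; on vectors fixed by [rho 1] it is nonnegative and increases
    with k. *)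
Definition gap k h : R := nH h ^+ 2 - nH (rho (u ^+ k) h) ^+ 2.

Lemma gap_mono k k' h : (k <= k')%N -> rho 1 h = h -> gap k h <= gap k' h.
Proof.
move=> kk h1; rewrite /gap lerD2l lerN2 ler_sqr ?nnegrE ?dnorm_pos //.
rewrite -(subnK kk) exprD (repM rr); apply: rep_uX_le.
by rewrite -(repM rr) mul1r.
Qed.

Lemma gap_u k h : rho 1 h = h -> gap k (rho u h) <= gap k.+1 h.
Proof.
move=> h1; rewrite /gap (exprSr u k) (repM rr) lerD2r ler_sqr ?nnegrE ?dnorm_pos //.
exact: rep_u_le.
Qed.

(** The gap is the defect form of u^k, which is covariant for α^k, so [rep_form_le] applies.
    Precomposing with [rho 1] makes u^k contractive on the whole space. *)
Lemma gap_gen_c k (y : C) h : rho 1 h = h ->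
  gap k (rho (gen_c y) h) <= cnorm y ^+ 2 * gap k h.
Proof.
move=> h1; pose S := rho (u ^+ k).
have aut : star_automorphism (iter k alpha).
  have [l m st] := star_hom_iter k (alpha_hom alpha_aut); split=> //.
  have [bij _ _ _] := alpha_aut.
  by elim: (k) => [|i IHi]; [exists id | exact: bij_comp].
have cov : covariant (iter k alpha) (fun x => rho (gen_c x)) (fun h => rho (u ^+ k) (rho 1 h)).
  split=> [|g|x g].
  - exact: (bounded_op_comp (rep_bounded rr _) (rep_bounded rr _)).
  - apply: le_trans (rep1_le rr g); apply: rep_uX_le; exact: (rep1 rr).
  - by rewrite -!(repM rr) !mulr1 ?mul1r gen_covX.
have := rep_form_le rep_gen_c_star (defect_psd cov) _ h (lexx (cnorm y)).
have E g : rho 1 g = g -> defect (fun h => rho (u ^+ k) (rho 1 h)) g g = gap k g.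
  by move=> g1; rewrite /defect g1 -!hnorm2.
rewrite gen_c1 h1 !E //; last by rewrite -(repM rr) mul1r.
apply=> x h' k'; exact: (defect_adj aut rep_gen_c_star _ _ _ cov).
Qed.

End OneRep.

(* The elements of [D] vanishing at vectors on which all powers of [u] are
   asymptotically isometric. *)
Definition asym_null d : Prop := forall e : R, 0 < e -> exists (c : R) (k : nat), 0 <= c /\
  forall (H : hilbertType R) (rho : D -> H -> H), star_rep rho -> forall h, rho 1 h = h ->
    hnorm (rho d h) ^+ 2 <= e * hnorm h ^+ 2 + c * gap rho k h.

(** Covers elements that every representation kills; equality in [D] is never deduced from equality
    in all representations. *)
Lemma asym_null_ann d : (forall (H : hilbertType R) (rho : D -> H -> H),
  star_rep rho -> forall h, rho d h = 0) -> asym_null d.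
Proof.
move=> d0 e e0; exists 0, 0%N; split=> // H rho rr h h1.
by rewrite (d0 _ _ rr) hnorm0 expr0n mul0r addr0 mulr_ge0 ?sqr_ge0 ?ltW.
Qed.

Lemma asym_null0 : asym_null 0.
Proof. by apply: asym_null_ann => H rho rr h; exact: rep0. Qed.

Lemma asym_nullD d1 d2 : asym_null d1 -> asym_null d2 -> asym_null (d1 + d2).
Proof.
move=> n1 n2 e e0; have e4 : 0 < e / 4 by rewrite divr_gt0.
have [c1 [k1 [c10 h1]]] := n1 _ e4; have [c2 [k2 [c20 h2]]] := n2 _ e4.
exists (2 * c1 + 2 * c2), (maxn k1 k2); split; first by rewrite addr_ge0 ?mulr_ge0.
move=> H rho rr h hh; have := h1 H rho rr h hh; have := h2 H rho rr h hh.
have := ler_wpM2l c10 (gap_mono rr (leq_maxl k1 k2) hh).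
have := ler_wpM2l c20 (gap_mono rr (leq_maxr k1 k2) hh).
rewrite (repD rr); have := dnorm2D_le inner (rho d1 h) (rho d2 h).
rewrite /hnorm; lra.
Qed.

Lemma asym_nullMl x d : asym_null d -> asym_null (x * d).
Proof.
move=> nd e e0; pose m := cnorm x ^+ 2 + 1.
have m0 : 0 < m by rewrite ltr_wpDl ?sqr_ge0.
have em : 0 < e / m by rewrite divr_gt0.
have [c [k [c0 hd]]] := nd _ em; exists (m * c), k; split; first by rewrite mulr_ge0 // ltW.
move=> H rho rr h h1; rewrite (repM rr).
apply: (@le_trans _ _ (m * hnorm (rho d h) ^+ 2)).
  apply: (@le_trans _ _ ((cnorm x * hnorm (rho d h)) ^+ 2)).
    by rewrite ler_sqr ?nnegrE ?mulr_ge0 ?cnorm_ge0 ?dnorm_pos //; exact: rep_contractive.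
  by rewrite exprMn ler_wpM2r ?sqr_ge0 // /m lerDl.
apply: le_trans (ler_wpM2l (ltW m0) (hd H rho rr h h1)) _.
rewrite mulrDr (mulrA m c) (mulrA m (e / m)) (mulrC m (e / m)) divfK ?gt_eqF //.
Qed.

Lemma asym_nullZ (a : R[i]) d : asym_null d -> asym_null (a *: d).
Proof. by move=> nd; rewrite -mulr_algl; exact: asym_nullMl. Qed.

Lemma asym_nullMu d : asym_null d -> asym_null (d * u).
Proof.
move=> nd e e0; have [c [k [c0 hd]]] := nd _ e0; exists c, k.+1; split=> //.
move=> H rho rr h h1; have u1 : rho 1 (rho u h) = rho u h by rewrite -(repM rr) mul1r.
rewrite (repM rr); apply: le_trans (hd H rho rr _ u1) _; apply: lerD.
  by rewrite ler_wpM2l ?(ltW e0) // ler_sqr ?nnegrE ?dnorm_pos //; exact: rep_u_le.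
by rewrite ler_wpM2l //; exact: gap_u.
Qed.

Lemma asym_nullMuX d k : asym_null d -> asym_null (d * u ^+ k).
Proof.
move=> nd; elim: k => [|k IHk]; first by rewrite expr0 mulr1.
by rewrite exprSr mulrA; exact: asym_nullMu.
Qed.

Lemma asym_nullMc d (y : C) : asym_null d -> asym_null (d * gen_c y).
Proof.
move=> nd e e0; pose m := cnorm y ^+ 2 + 1.
have m0 : 0 < m by rewrite ltr_wpDl ?sqr_ge0.
have em : 0 < e / m by rewrite divr_gt0.
have [c [k [c0 hd]]] := nd _ em; exists (c * cnorm y ^+ 2), k.
split; first by rewrite mulr_ge0 // sqr_ge0.
move=> H rho rr h h1.
have y1 : rho 1 (rho (gen_c y) h) = rho (gen_c y) h by rewrite -(repM rr) mul1r.
rewrite (repM rr); apply: le_trans (hd H rho rr _ y1) _; apply: lerD; last first.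
  by rewrite -mulrA ler_wpM2l //; exact: gap_gen_c.
apply: (@le_trans _ _ (e / m * (m * hnorm h ^+ 2))); last by rewrite mulrA divfK ?gt_eqF.
rewrite ler_wpM2l ?(ltW em) //.
apply: (@le_trans _ _ ((cnorm y * hnorm h) ^+ 2)).
  rewrite ler_sqr ?nnegrE ?mulr_ge0 ?cnorm_ge0 ?dnorm_pos //.
  exact: (rep_contractive (rep_gen_c_star rr)).
by rewrite exprMn ler_wpM2r ?sqr_ge0 // /m lerDl.
Qed.

(** Null elements form a left ideal, but stability on the right must be proved generator by
    generator: [u] raises the index of the gap by one, and [gen_c y] scales the gap. *)
Lemma asym_nullMpoly d s : asym_null d -> asym_null (d * iota (kpoly s)).
Proof.
move=> nd; rewrite iota_kpoly mulr_sumr; elim: s => [|p s IHs].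
  by rewrite big_nil; exact: asym_null0.
rewrite big_cons; apply: asym_nullD => //; rewrite mulrA.
by apply: asym_nullMc; exact: asym_nullMuX.
Qed.

(** Expanding the square, ‖(u*u - 1)h‖² = ‖u*uh‖² - 2‖uh‖² + ‖h‖², at most ‖h‖² - ‖uh‖², the gap for
    k = 1. *)
Lemma asym_null_isometry : asym_null (star u * u - 1).
Proof.
move=> e e0; exists 1, 1%N; split=> // H rho rr h h1.
rewrite mul1r (repB rr) (repM rr) h1 /gap expr1.
have E : re_inner (rho (star u) (rho u h)) (- h) = - hnorm (rho u h) ^+ 2.
  rewrite hnorm2 /re_inner linearNr raddfN /= (rep_adj rr) starK; congr (- _).
have := dnorm2D inner (rho (star u) (rho u h)) (- h); rewrite dnormN.
rewrite -[complex.Re _]/(re_inner _ _) E /hnorm mulr2n => ->.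
have le : dnorm inner (rho (star u) (rho u h)) ^+ 2 <= dnorm inner (rho u h) ^+ 2.
  rewrite ler_sqr ?nnegrE ?dnorm_pos //.
  have := adjoint_le ler01 (rr.2 u) _ (rho u h); rewrite /hnorm !mul1r; apply=> g.
  by rewrite mul1r; exact: rep_u_le.
have := mulr_ge0 (ltW e0) (sqr_ge0 (dnorm inner h)); rewrite /hnorm; lra.
Qed.

(** Complete isometry enters here, at size 2. The hypothesis bounds the column of iota(kpoly s) and
    w u^k in all representations of [D], hence the same column over X and its image on l²(Z; H0).
    There the second entry is w times an isometry and contributes exactly w² ‖h‖² on the range of
    π̂(1); subtracting it leaves [q]. *)
Lemma weighted_column s k (w q : R) : 0 <= w -> 0 <= q ->
  (forall (H : hilbertType R) (rho : D -> H -> H), star_rep rho -> forall h, rho 1 h = h ->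
     hnorm (rho (iota (kpoly s)) h) ^+ 2 + w ^+ 2 * hnorm (rho (u ^+ k) h) ^+ 2 <=
     (q + w ^+ 2) * hnorm h ^+ 2) ->
  oanorm (kpoly s) ^+ 2 <= q.
Proof.
move=> w0 q0 hw; pose s2 := [:: (k, (w%:C%:A : C))].
(* The column is padded to a square matrix by the empty list, which represents 0. *)
pose S (i j : 'I_2) := if j == 0 then (if i == 0 then s else s2) else [::].
pose c := Num.sqrt (q + w ^+ 2).
have qw : 0 <= q + w ^+ 2 by rewrite addr_ge0 ?sqr_ge0.
have c2 : c ^+ 2 = q + w ^+ 2 by rewrite sqr_sqrtr.
have c0 : 0 <= c by exact: sqrtr_ge0.
have two (H : hilbertType R) (z : 'I_2 -> H) : sumnorm z ^+ 2 = hnorm (z 0) ^+ 2 + hnorm (z 1) ^+ 2.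
  by rewrite sumnorm2 sum_I2.
have iS2 : iota (kpoly s2) = w%:C *: u ^+ k.
  rewrite iota_kpoly big_seq1 /= -[w%:C%:A]addr0 gen_cP gen_c1.
  have -> : gen_c 0 = 0.
    by have := gen_cP (-1) 0 0; rewrite !scaleN1r !addNr.
  by rewrite addr0 mulr_algr.
have up : mxnorm (\matrix_(i, j) kpoly (S i j)) <= c.
  have [_ _ _ <-] := iota_ci; apply: (cstar_mxnorm_le K) => // H rho rr z.
  rewrite -ler_sqr ?nnegrE ?mulr_ge0 ?sumnorm_ge0 // exprMn c2 !two.
  have E (i : 'I_2) : mxapp (map_mx rho (map_mx iota (\matrix_(i, j) kpoly (S i j)))) z i =
      rho (iota (kpoly (if i == 0 then s else s2))) (rho 1 (z 0)).
    rewrite /mxapp sum_I2 !mxE /S /= /kpoly big_nil iota0 (rep0 rr) addr0.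
    by rewrite (rep1 rr).
  rewrite !E /= iS2 (repZ rr) /hnorm dnormZ Re_norm_real ger0_norm // exprMn.
  have := hw H rho rr (rho 1 (z 0)) (rep1 rr _ _).
  move/le_trans; apply; rewrite ler_wpM2l //.
  apply: (@le_trans _ _ (hnorm (z 0) ^+ 2)); last by rewrite lerDl sqr_ge0.
  by rewrite ler_sqr ?nnegrE ?dnorm_pos //; exact: rep1_le.
rewrite mxnorm_kpoly in up.
rewrite oanorm_kpoly.
have bb : bounded_mx (\matrix_(i, j) bpoly (S i j)).
  by move=> i i'; rewrite mxE; exact: bpoly_bounded.
have b0 := bpoly_bounded s.
rewrite -(sqr_sqrtr q0) ler_sqr ?nnegrE ?opnorm_ge0 ?sqrtr_ge0 //.
apply: opnorm_le => [|h]; first exact: sqrtr_ge0.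
(* The exact norm of the second entry is available only where π̂(1) acts as the identity; the first
   entry does not distinguish [h] from [h1]. *)
pose h1 := ph 1 h.
have sE : bpoly s h1 = bpoly s h.
  by rewrite /bpoly /laurent /h1; apply: eq_bigr => p _; rewrite (rep1 ph_rep).
have s2E : hnorm (bpoly s2 h1) = w * hnorm h1.
  rewrite /bpoly /laurent big_seq1 bishiftX_norm /= (repZ ph_rep) /h1 (rep1 ph_rep).
  by rewrite /hnorm dnormZ Re_norm_real ger0_norm.
pose z : 'I_2 -> K := fun i => if i == 0 then h1 else 0.
have zn : sumnorm z = hnorm h1.
  apply/eqP; rewrite -(@eqrXn2 _ 2) ?sumnorm_ge0 ?dnorm_pos // two /z /=.
  by rewrite hnorm0 expr0n addr0.
have app (i : 'I_2) : mxapp (\matrix_(i, j) bpoly (S i j)) z i =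
    bpoly (if i == 0 then s else s2) h1.
  rewrite /mxapp sum_I2 !mxE /S /z /=.
  by rewrite [bpoly [::] _]big_nil addr0.
have := opmx_normP z bb; rewrite zn => le.
have {}le : sumnorm (mxapp (\matrix_(i, j) bpoly (S i j)) z) ^+ 2 <= c ^+ 2 * hnorm h1 ^+ 2.
  rewrite -exprMn ler_sqr ?nnegrE ?mulr_ge0 ?sumnorm_ge0 ?dnorm_pos //.
  by apply: le_trans le _; rewrite ler_wpM2r ?dnorm_pos.
move: le; rewrite two !app /= s2E sE c2 exprMn mulrDl lerD2r => le.
exact: (sqrt_mul_le q0 (dnorm_pos _ _) (dnorm_pos _ _) (rep1_le ph_rep h) le).
Qed.

(* Weighting the second row of the column [(iota (kpoly s); u ^+ k)] absorbs the gap. *)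
Lemma asym_null_norm d M s : asym_null (d * u ^+ M - iota (kpoly s)) -> oanorm (kpoly s) <= rn d.
Proof.
move=> nd; set r := rn d; have r0 : 0 <= r := repnorm_ge0 K d.
have a0 := seminorm_ge0 (oanorm_seminorm X) (kpoly s).
rewrite -ler_sqr ?nnegrE //; apply/ler_addgt0Pr => e e0.
(* The quantity [q] below equals r² + t (r² + t + 1), so for t ≤ 1 the excess over r² is at most t
   m. *)
pose m := r ^+ 2 + 2; have m0 : 0 < m by rewrite ltr_wpDl ?sqr_ge0.
pose t := Num.min 1 (e / m).
have t0 : 0 < t by rewrite lt_min ltr01 divr_gt0.
have t1 : t <= 1 by rewrite ge_min lexx.
have tm : t * m <= e by rewrite -ler_pdivlMr // ge_min lexx orbT.
have t2 : 0 < t ^+ 2 by rewrite exprn_gt0.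
have [c [k [c0 hd]]] := nd _ t2.
have tV : 1 <= t^-1 by rewrite invf_ge1.
(* The square of the weight: the term L · gap and L ‖u^k h‖² add up to L ‖h‖². *)
pose L := (1 + t^-1) * c; have L0 : 0 <= L by rewrite mulr_ge0 // addr_ge0 // invr_ge0 ltW.
pose q := (1 + t) * r ^+ 2 + (1 + t^-1) * t ^+ 2.
have q0 : 0 <= q.
  by rewrite addr_ge0 // mulr_ge0 ?sqr_ge0 // addr_ge0 ?invr_ge0 // ltW.
have qe : q <= r ^+ 2 + e.
  have -> : q = r ^+ 2 + t * (r ^+ 2 + t + 1) by rewrite /q; field; rewrite gt_eqF.
  rewrite lerD2l; apply: le_trans tm; rewrite ler_wpM2l ?(ltW t0) // /m; lra.
apply: le_trans qe.
apply: (@weighted_column s k (Num.sqrt L) q) => //; first exact: sqrtr_ge0.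
move=> H rho rr h h1; rewrite (sqr_sqrtr L0).
have uM : rho 1 (rho (u ^+ M) h) = rho (u ^+ M) h by rewrite -(repM rr) mul1r.
have A2 : hnorm (rho (d * u ^+ M) h) ^+ 2 <= r ^+ 2 * hnorm h ^+ 2.
  rewrite -exprMn ler_sqr ?nnegrE ?mulr_ge0 ?dnorm_pos // (repM rr).
  apply: le_trans (repnormP _ _ rr) _; rewrite ler_wpM2l //; exact: rep_uX_le.
have B2 := hd H rho rr h h1; rewrite (repB rr) in B2.
set a := rho (d * u ^+ M) h in A2 B2; set b := rho (iota (kpoly s)) h in B2 *.
have tri : hnorm b ^+ 2 <= (1 + t) * hnorm a ^+ 2 + (1 + t^-1) * hnorm (a - b) ^+ 2.
  have n1 : hnorm b <= hnorm a + hnorm (a - b).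
    have sn := dnorm_seminorm (@inner R H).
    by have := seminorm_le_dist sn b a; rewrite (seminormC sn b).
  apply: (@le_trans _ _ ((hnorm a + hnorm (a - b)) ^+ 2)).
    by rewrite ler_sqr ?nnegrE ?addr_ge0 ?dnorm_pos.
  set x := hnorm a; set y := hnorm (a - b).
  (* The inequality 2xy ≤ t x² + y²/t. *)
  have : 0 <= (t * x - y) ^+ 2 / t by rewrite divr_ge0 ?sqr_ge0 ?ltW.
  have -> : (t * x - y) ^+ 2 / t = t * x ^+ 2 - 2 * x * y + t^-1 * y ^+ 2.
    by field; rewrite gt_eqF.
  rewrite sqrrD; lra.
have k1 : 0 <= 1 + t by lra.
have k2 : 0 <= 1 + t^-1 by lra.
apply: (@le_trans _ _ ((1 + t) * (r ^+ 2 * hnorm h ^+ 2) +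
    (1 + t^-1) * (t ^+ 2 * hnorm h ^+ 2 + c * gap rho k h) +
    L * hnorm (rho (u ^+ k) h) ^+ 2)).
  rewrite lerD2r; apply: (le_trans tri); apply: lerD; exact: ler_wpM2l.
by rewrite /q /L /gap; lra.
Qed.

(** * Polynomials times negative powers of [u], modulo null elements *)

Local Notation UX := (@bishiftX R H0).

(** Moving u^M from the right of a polynomial to its left applies α^M to the coefficients. *)
Definition twist M s : seq (nat * C) := [seq (p.1, iter M alpha p.2) | p <- s].

Lemma iota_twist M s : iota (kpoly s) * u ^+ M = u ^+ M * iota (kpoly (twist M s)).
Proof.
rewrite !iota_kpoly mulr_suml mulr_sumr /twist big_map.
apply: eq_bigr => p _ /=; rewrite -mulrA gen_covX.
by rewrite !mulrA -!exprD addnC.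
Qed.

Lemma bpoly_twist M s f : bpoly (twist M s) (UX (- M%:Z) f) = UX (- M%:Z) (bpoly s f).
Proof.
rewrite /bpoly /laurent (op_sum _ _ _ (bishiftX_bounded _ _)) !big_map.
apply: eq_bigr => p _; rewrite (pihat_shift alpha_aut pi_rep) !bishiftXD.
have -> : alphaX alpha (- M%:Z) (iter M alpha p.2) = p.2.
  by rewrite -(alphaX_iter alpha) -(alphaXD alpha_aut) addNr.
by rewrite addrC.
Qed.

Lemma bpoly_bpoly1 s k f : bpoly (poly_mul s [:: (k, 1)]) (UX (- k%:Z) f) = bpoly s f.
Proof.
rewrite bpolyM [in X in bpoly s X]/bpoly /laurent big_seq1.
rewrite (pihat_shift alpha_aut pi_rep) (alphaX1 alpha_aut) bishiftXD subrr.
by rewrite /bpoly /laurent; apply: eq_bigr => p _; exact: congr1 (rep1 ph_rep _ f).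
Qed.

(** [d] is treated as the fraction iota(F) u^(-M). Neither [M] nor [s] is determined by [d], hence a
    relation. *)
Definition asym_pair d (T : K -> K) : Prop := exists (M : nat) s,
  asym_null (d * u ^+ M - iota (kpoly s)) /\ T = (fun f => bpoly s (UX (- M%:Z) f)).

Lemma asym_pair_shift d M s k : asym_null (d * u ^+ M - iota (kpoly s)) ->
  asym_null (d * u ^+ (M + k) - iota (kpoly (poly_mul s [:: (k, 1)]))) /\
  forall f, bpoly (poly_mul s [:: (k, 1)]) (UX (- (M + k)%N%:Z) f) = bpoly s (UX (- M%:Z) f).
Proof.
move=> nd; split=> [|f].
  rewrite kpolyM iotaM exprD mulrA.
  have -> : iota (kpoly [:: (k, 1)]) = u ^+ k.
    by rewrite iota_kpoly big_seq1 gen_c1 mulr1.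
  by rewrite -mulrBl; exact: asym_nullMuX.
have -> : UX (- (M + k)%N%:Z) f = UX (- k%:Z) (UX (- M%:Z) f).
  by rewrite bishiftXD; congr (UX _ f); lia.
exact: bpoly_bpoly1.
Qed.

Lemma asym_pair_bounded d T : asym_pair d T ->
  bounded_op T /\ forall f, hnorm (T f) <= rn d * hnorm f.
Proof.
move=> [M [s [nd ->]]]; have bs := bpoly_bounded s.
split; first exact: (bounded_op_comp bs (bishiftX_bounded _ _)).
move=> f; rewrite -(bishiftX_norm (- M%:Z) f); apply: le_trans (opnormP _ bs) _.
rewrite ler_wpM2r ?dnorm_pos // -oanorm_kpoly.
exact: (asym_null_norm nd).
Qed.

Lemma asym_pair_crossed d T : asym_pair d T -> B T.
Proof.
move=> [M [s [_ ->]]].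
pose t := [seq (p.1%:Z - M%:Z, alphaX alpha (- M%:Z) p.2) | p <- s].
rewrite (_ : (fun _ => _) = laurent alpha pi t); first exact: crossed_laurent.
apply/funext => f; rewrite /bpoly /laurent !big_map; apply: eq_bigr => p _.
by rewrite (pihat_shift alpha_aut pi_rep) bishiftXD.
Qed.

Lemma asym_pair_lin (a : R[i]) d1 d2 T1 T2 : asym_pair d1 T1 -> asym_pair d2 T2 ->
  asym_pair (a *: d1 + d2) (fun f => a *: T1 f + T2 f).
Proof.
move=> [M [s [n1 ->]]] [M' [t [n2 ->]]].
have [n1' E1] := asym_pair_shift M' n1; have [n2' E2] := asym_pair_shift M n2.
rewrite addnC in n2' E2.
set s' := poly_mul s _ in n1' E1; set t' := poly_mul t _ in n2' E2.
exists (M + M')%N, ([seq (p.1, a *: p.2) | p <- s'] ++ t'); split.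
  rewrite kpoly_cat kpolyZ iotaP mulrDl -scalerAl opprD addrACA -scalerBr.
  by apply: asym_nullD => //; exact: asym_nullZ.
by apply/funext => f; rewrite bpoly_lin E1 E2.
Qed.

(** With p1, p2 the two polynomials, p2 u^M = u^M twist(p2). The error of the product is d1 (d2 u^M'
    - p2) u^M + (d1 u^M - p1) twist(p2), null by stability on both sides. *)
Lemma asym_pair_mul d1 d2 T1 T2 : asym_pair d1 T1 -> asym_pair d2 T2 ->
  asym_pair (d1 * d2) (T1 \o T2).
Proof.
move=> [M [s [n1 ->]]] [M' [t [n2 ->]]].
exists (M' + M)%N, (poly_mul s (twist M t)); split; last first.
  apply/funext => f /=; rewrite bpolyM -bpoly_twist.
  by congr (bpoly s (bpoly _ _)); rewrite bishiftXD; congr (UX _ f); lia.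
rewrite kpolyM iotaM.
have -> : d1 * d2 * u ^+ (M' + M) - iota (kpoly s) * iota (kpoly (twist M t)) =
    d1 * (d2 * u ^+ M' - iota (kpoly t)) * u ^+ M +
    (d1 * u ^+ M - iota (kpoly s)) * iota (kpoly (twist M t)).
  rewrite mulrBr !mulrBl exprD !mulrA -[d1 * iota _ * _]mulrA iota_twist !mulrA.
  by rewrite addrA subrK.
apply: asym_nullD; last exact: asym_nullMpoly.
by apply: asym_nullMuX; exact: asym_nullMl.
Qed.

Lemma asym_pair_poly s : asym_pair (iota (kpoly s)) (bpoly s).
Proof.
exists 0%N, s; split=> //; rewrite expr0 mulr1 subrr; exact: asym_null0.
Qed.

(** Nullity is not visibly preserved by [star], so the adjoint is carried along with a pair of its
    own. *)
Definition asym_star_pair d T : Prop :=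
  asym_pair d T /\ exists T', asym_pair (star d) T' /\ adjoint T' T.

Lemma asym_star_pair_lin (a : R[i]) d1 d2 T1 T2 :
  asym_star_pair d1 T1 -> asym_star_pair d2 T2 ->
  asym_star_pair (a *: d1 + d2) (fun f => a *: T1 f + T2 f).
Proof.
move=> [p1 [T1' [q1 a1]]] [p2 [T2' [q2 a2]]]; split; first exact: asym_pair_lin.
exists (fun f => Num.conj a *: T1' f + T2' f); split; last exact: adjoint_comb.
by rewrite star_conjlinear; exact: asym_pair_lin.
Qed.

Lemma asym_star_pair_mul d1 d2 T1 T2 : asym_star_pair d1 T1 -> asym_star_pair d2 T2 ->
  asym_star_pair (d1 * d2) (T1 \o T2).
Proof.
move=> [p1 [T1' [q1 a1]]] [p2 [T2' [q2 a2]]]; split; first exact: asym_pair_mul.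
exists (T2' \o T1'); split; first by rewrite starM; exact: asym_pair_mul.
by move=> f g /=; rewrite a1 a2.
Qed.

Lemma asym_star_pair_star d T : asym_star_pair d T -> exists T', asym_star_pair (star d) T'.
Proof.
move=> [p [T' [q a]]]; exists T'; split=> //; exists T; rewrite starK; split=> //.
exact: adjoint_sym.
Qed.

(** [star u] corresponds to U^(-1) with M = 1 and the polynomial 1, because [star u * u - 1] is
    null. *)
Lemma asym_star_pair_u : exists T, asym_star_pair u T.
Proof.
have uE : u = iota (kpoly [:: (1%N, 1)]) by rewrite /kpoly big_seq1.
exists (bpoly [:: (1%N, 1)]); split; first by rewrite {1}uE; exact: asym_pair_poly.
exists (fun f => bpoly [:: (0%N, 1)] (UX (- 1%:Z) f)); split.
  exists 1%N, [:: (0%N, 1)]; split=> //.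
  have -> : iota (kpoly [:: (0%N, 1)]) = 1.
    by rewrite iota_kpoly big_seq1 gen_c1 mulr1.
  by rewrite expr1; exact: asym_null_isometry.
move=> f g; rewrite /bpoly /laurent !big_seq1.
rewrite -[LHS]/(inner (UX 1 (ph 1 f)) g) -[RHS]/(inner f (ph 1 (UX (- 1) g))).
by rewrite bishiftX_adj (rep_adj ph_rep) star1.
Qed.

(** [star (gen_c x)] and [gen_c (star x)] have the same image in every representation, so their
    difference is null. *)
Lemma asym_star_pair_c (x : C) : exists T, asym_star_pair (gen_c x) T.
Proof.
have E y : gen_c y = iota (kpoly [:: (0%N, y)]) by rewrite /kpoly big_seq1.
exists (bpoly [:: (0%N, x)]); split; first by rewrite E; exact: asym_pair_poly.
exists (bpoly [:: (0%N, star x)]); split; last first.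
  move=> f g; rewrite /bpoly /laurent !big_seq1.
  rewrite -[LHS]/(inner (ph x f) g) -[RHS]/(inner f (ph (star x) g)).
  exact: (rep_adj ph_rep).
exists 0%N, [:: (0%N, star x)]; split=> //; rewrite expr0 mulr1 -E.
apply: asym_null_ann => H rho rr h; rewrite (repB rr).
have [_ adj] := rep_gen_c_star rr.
have -> : rho (star (gen_c x)) = rho (gen_c (star x)).
  exact: (adjoint_unique (rr.2 (gen_c x)) (adj x)).
by rewrite subrr.
Qed.

Lemma asym_star_pair_poly s : exists T, asym_star_pair (iota (kpoly s)) T.
Proof.
have zero : asym_star_pair 0 (fun=> 0).
  have P : asym_pair 0 (fun=> 0).
    have := asym_pair_poly [::]; rewrite /kpoly big_nil iota0.
    by congr (asym_pair _ _); apply/funext => f; rewrite /bpoly /laurent big_nil.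
  by split=> //; exists (fun=> 0); rewrite star0; split=> //; exact: adjoint0.
have pow n : exists T, asym_star_pair (u ^+ n) T.
  elim: n => [|n [T IHn]].
    by have [T h] := asym_star_pair_c 1; exists T; rewrite expr0 -gen_c1.
  have [S h] := asym_star_pair_u; exists (S \o T); rewrite exprS.
  exact: asym_star_pair_mul.
rewrite iota_kpoly; elim: s => [|p s [T IHs]].
  by exists (fun=> 0); rewrite big_nil.
have [S1 h1] := pow p.1; have [S2 h2] := asym_star_pair_c p.2.
exists (fun f => 1 *: (S1 \o S2) f + T f); rewrite big_cons -[X in X + _]scale1r.
by apply: asym_star_pair_lin => //; exact: asym_star_pair_mul.
Qed.

Hypothesis iota_gen : cstar_generated (range iota).

Let snD := repnorm_seminorm D K.

Lemma asym_star_pair_dense d (e : R) : 0 < e ->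
  exists d' T, asym_star_pair d' T /\ rn (d - d') <= e.
Proof.
move=> e0.
have [||||d' [[T hT] le]] := @cstar_generated_dense R D rn snD (repnormZ K) (repnormM K)
  (repnorm_star K) (repnorm_cnorm K) (fun d => exists T, asym_star_pair d T)
  _ _ _ _ _ iota_gen d e e0.
- move=> a x y [S hS] [T hT]; exists (fun f => a *: S f + T f); exact: asym_star_pair_lin.
- by move=> x y [S hS] [T hT]; exists (S \o T); exact: asym_star_pair_mul.
- by move=> x [T /asym_star_pair_star].
- move=> _ [x _ <-] t t0; have [s hs] := kpoly_dense x t0.
  exists (iota (kpoly s)); split; first exact: asym_star_pair_poly.
  by rewrite -iotaB iota_norm.
by exists d', T.
Qed.

Lemma envelope_extension : exists Psi : D -> K -> K,
  [/\ star_rep Psi, range Psi = B & forall x, Psi (iota x) = j x].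
Proof.
have [||||||Psi [Pa PQ Ple Pcl]] := @dense_extension R D rn K snD (repnorm0 D K)
  _ _ asym_star_pair.
- exact: (repnormZ K).
- exact: (repnormM K).
- by move=> d T [/asym_pair_bounded].
- exact: asym_star_pair_lin.
- exact: asym_star_pair_mul.
- exact: asym_star_pair_dense.
have Pb d : bounded_op (Psi d) by case: Pa.
have PB d1 d2 h : Psi (d1 - d2) h = Psi d1 h - Psi d2 h.
  by case: Pa => _ l _; have := l (-1) d2 d1 h; rewrite !scaleN1r ![- _ + _]addrC.
have Pclose d1 d2 (e : R) : rn (d1 - d2) <= e -> op_close e (Psi d1) (Psi d2).
  move=> le h; rewrite -PB; apply: le_trans (Ple _ _) _.
  by rewrite ler_wpM2r ?dnorm_pos.
have Pstar d : adjoint (Psi (star d)) (Psi d).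
  have /choice[v hv] : forall n : nat, exists p : D * (K -> K),
      asym_star_pair p.1 p.2 /\ rn (d - p.1) <= n.+1%:R^-1.
    move=> n; have n0 : 0 < (n.+1%:R : R)^-1 by rewrite invr_gt0.
    by have [d' [T h]] := asym_star_pair_dense d n0; exists (d', T).
  apply: (@adjoint_limit R K (fun n => Psi (star (v n).1)) (fun n => Psi (v n).1)).
  - move=> e /harmonic_small[n0 h0]; exists n0 => n hn; apply: Pclose.
    by rewrite (seminormC snD); apply: le_trans (hv n).2 _; exact: h0.
  - move=> e /harmonic_small[n0 h0]; exists n0 => n hn; apply: Pclose.
    rewrite (seminormC snD) -starB; apply: le_trans (repnorm_star K _) _.
    by apply: le_trans (hv n).2 _; exact: h0.
  move=> n; have [[p [T' [q a]]] _] := hv n.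
  have -> : Psi (v n).1 = (v n).2 by apply: PQ; split=> //; exists T'.
  rewrite (_ : Psi (star (v n).1) = T') //; apply: PQ; split=> //.
  by exists (v n).2; rewrite starK; split=> //; exact: adjoint_sym.
have Prep : star_rep Psi by split.
have Pkp s : Psi (iota (kpoly s)) = bpoly s.
  have [T hT] := asym_star_pair_poly s.
  have [p [T' [q a]]] := hT; rewrite (PQ _ _ hT).
  (* The operator found for [iota (kpoly s)] is anonymous; uniqueness of values for [asym_pair]
     identifies it with [bpoly s]. *)
  apply: (@closure_pair_unique R D rn K snD (repnorm0 D K) (repnormZ K) asym_pair _ _
    (iota (kpoly s))).
  - exact: asym_pair_bounded.
  - exact: asym_pair_lin.
  - exact: (closure_pair_Q (repnorm0 D K) asym_pair_bounded p).
  - exact: (closure_pair_Q (repnorm0 D K) asym_pair_bounded (asym_pair_poly s)).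
have Pj x : Psi (iota x) = j x.
  apply: op_close_eq => e e0; have [s hs] := kpoly_dense x e0.
  exists (bpoly s); split; last by rewrite -j_kpoly; exact: embedding_close.
  by rewrite -Pkp; apply: Pclose; rewrite -iotaB iota_norm.
exists Psi; split=> //; apply/seteqP; split.
  move=> _ [d _ <-]; apply: crossed_closed => // e /(asym_star_pair_dense d)[d' [T [hT le]]].
  exists T; last by rewrite -(PQ _ _ hT); exact: Pclose.
  by have [p _] := hT; exact: asym_pair_crossed p.
(* Surjectivity: the range is a norm-closed operator C*-algebra containing the range of [j], so
   minimality of the crossed product applies. *)
have opc : is_operator_cstar (range Psi).
  split.
  - by move=> _ [d _ <-].
  - split.
      by exists 0 => //; apply/funext => h; exact: (rep0 Prep).
    move=> a _ _ [d1 _ <-] [d2 _ <-]; exists (a *: d1 + d2) => //.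
    by apply/funext => h; rewrite (repP Prep).
  - move=> _ _ [d1 _ <-] [d2 _ <-]; exists (d1 * d2) => //.
    by case: Pa => _ _ ->.
  - by move=> _ [d _ <-]; exists (Psi (star d)); [exists (star d) | exact: Pstar].
  move=> T bT appr; suff [d ->] : exists d, T = Psi d by exists d.
  apply: star_rep_range_closed => // e /appr[_ [d _ <-] le]; exists d.
  have e0 : 0 <= e by apply: le_trans (ltW le); exact: opnorm_ge0 (bounded_opB bT (Pb d)).
  by apply/(op_close_opnorm bT (Pb d) e0); exact: ltW.
apply: (crossed_minimal opc) => _ [x _ <-].
by exists (iota x).
Qed.

End Embedding.

Theorem theorem1p5 (R : realType) (C : cstarType R) (alpha : C -> C)
    (alpha_aut : star_automorphism alpha)
    (H0 : hilbertType R) (pi : C -> H0 -> H0)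
    (pi_rep : star_rep pi) (pi_faithful : injective pi)
    (X : opAlgType R) (kappa : (nat -> C) -> X)
    (X_semicrossed : is_semicrossed_product alpha kappa) :
  exists j : X -> l2Z H0 -> l2Z H0,
    (forall (n : nat) (x : C),
       j (kappa (delta n x)) = bishiftX (Posz n) \o pihat alpha pi x) /\
    is_cstar_envelope (reduced_crossed_product alpha pi) j.
Proof.
have [j [ja jk jle]] := embedding_exists alpha_aut pi_rep pi_faithful X_semicrossed.
exists j; split=> [n x|]; first exact: (embedding_delta jk).
split.
- exact: crossed_cstar.
- split=> //.
  + move=> x; exact: (embedding_crossed alpha_aut pi_rep X_semicrossed ja jk jle).
  + move=> T; exact: (crossed_unit alpha_aut pi_rep X_semicrossed jk).
  + move=> n M; exact: (embedding_mxnorm alpha_aut pi_rep pi_faithful X_semicrossed ja jk jle).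
- move=> E; exact: (crossed_minimal alpha_aut pi_rep jk).
move=> D iota ci gen.
exact: (envelope_extension alpha_aut pi_rep pi_faithful X_semicrossed ja jk jle ci gen).
Qed.
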